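(* There are elements $a,b \in M_{2^\infty}$ and $\delta > 0$ such that (1) $\operatorname{dist}(U(a^{(2^k)}),U(b^{(2^k)})) = \delta$ for all $k \in \mathbb{N}$; (2) $\operatorname{dist}(U(a^{(3k)}),U(b^{(3k)})) = 0$ for all $k \in \mathbb{N}$.
   Context: $\mathbb{N}=\{1,2,\dots\}$. $M_m$ is the C*-algebra of $m\times m$ complex matrices and $M_{2^\infty}$ is the CAR algebra, i.e. the UHF algebra $\bigotimes_{i=1}^\infty M_2$. For a unital C*-algebra $B$ with unitary group $U(B)$ and $x \in B$, the unitary orbit of $x$ is $U(x) = \{u^*xu : u \in U(B)\}$, and for $x,y\in B$, $\operatorname{dist}(U(x),U(y)) = \inf\{\|x'-y'\| : x' \in U(x), y' \in U(y)\}$. For a unital C*-algebra $A$ and $a\in A$, $a^{(m)} = 1_{M_m}\otimes a \in M_m(A)$ is the $m$-fold direct sum of $a$ with itself; $\operatorname{dist}(U(a^{(m)}),U(b^{(m)}))$ is computed using unitaries of $M_m(A)$ (here $A = M_{2^\infty}$). *)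

(* Defs.v *)
From HB Require Import structures.
From mathcomp Require Import all_boot all_order all_algebra.
From mathcomp Require Import all_classical all_reals topology normedtype sequences.
From mathcomp Require Import complex.

Set Implicit Arguments.
Unset Strict Implicit.
Unset Printing Implicit Defensive.

Import Order.TTheory GRing.Theory Num.Theory.
Import numFieldNormedType.Exports.
Import Normc.

Local Open Scope classical_set_scope.
Local Open Scope ring_scope.

HB.lock Definition enorm (R : realType) n (v : 'cV[R[i]]_n) : R :=
  Num.sqrt (\sum_(i < n) normc (v i 0) ^+ 2).

HB.lock Definition opnorm (R : realType) n (A : 'M[R[i]]_n) : R :=
  sup [set enorm (A *m v) | v in [set v : 'cV[R[i]]_n | enorm v <= 1]].

Section OperatorNorm.
Variable R : realType.
Implicit Types n : nat.

Lemma normc_ge0 (z : R[i]) : 0 <= normc z.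
Proof. by case: z => a b; exact: sqrtr_ge0. Qed.

Lemma normc_conj (z : R[i]) : normc z^*%C = normc z.
Proof. by case: z => a b; rewrite /= sqrrN. Qed.

Lemma enorm_ge0 n (v : 'cV[R[i]]_n) : 0 <= enorm v.
Proof. by rewrite enorm.unlock sqrtr_ge0. Qed.

Lemma sqr_enorm n (v : 'cV[R[i]]_n) :
  enorm v ^+ 2 = \sum_(i < n) normc (v i 0) ^+ 2.
Proof.
by rewrite enorm.unlock sqr_sqrtr// sumr_ge0// => i _; rewrite exprn_ge0// normc_ge0.
Qed.

Lemma enorm0 n : enorm (0 : 'cV[R[i]]_n) = 0.
Proof.
by rewrite enorm.unlock big1 ?sqrtr0// => i _; rewrite mxE normc0 expr0n.
Qed.

Lemma enorm_eq0 n (v : 'cV[R[i]]_n) : enorm v = 0 -> v = 0.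
Proof.
move=> v0; apply/matrixP => i j; rewrite ord1 mxE.
have := sqr_enorm v; rewrite v0 expr0n/= => /esym/psumr_eq0P => h.
have {}h : normc (v i 0) ^+ 2 = 0.
  by apply: h => // k _; rewrite exprn_ge0// normc_ge0.
by apply: eq0_normc; apply/eqP; rewrite -sqrf_eq0 h.
Qed.

Lemma enormZ n (z : R[i]) (v : 'cV[R[i]]_n) : enorm (z *: v) = normc z * enorm v.
Proof.
apply/eqP; rewrite -(@eqrXn2 _ 2%N)// ?mulr_ge0 ?enorm_ge0 ?normc_ge0//.
rewrite exprMn !sqr_enorm mulr_sumr; apply/eqP/eq_bigr => i _.
by rewrite mxE normcM exprMn.
Qed.

Lemma normc_sum (I : finType) (F : I -> R[i]) :
  normc (\sum_i F i) <= \sum_i normc (F i).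
Proof.
elim/big_ind2 : _ => [|x1 x2 y1 y2 h1 h2|//]; first by rewrite normc0.
by rewrite (le_trans (le_normcD _ _))// lerD.
Qed.

Lemma real_CauchySchwarz n (a b : 'I_n -> R) :
  \sum_i a i * b i <=
  Num.sqrt (\sum_i a i ^+ 2) * Num.sqrt (\sum_i b i ^+ 2).
Proof.
set s := Num.sqrt (\sum_i a i ^+ 2); set t := Num.sqrt (\sum_i b i ^+ 2).
have sE : s ^+ 2 = \sum_i a i ^+ 2.
  by rewrite sqr_sqrtr// sumr_ge0// => i _; exact: sqr_ge0.
have tE : t ^+ 2 = \sum_i b i ^+ 2.
  by rewrite sqr_sqrtr// sumr_ge0// => i _; exact: sqr_ge0.
have s0 : 0 <= s by exact: sqrtr_ge0.
have t0 : 0 <= t by exact: sqrtr_ge0.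
have [s00|sN0] := eqVneq s 0.
  rewrite s00 mul0r big1// => i _.
  have : \sum_i a i ^+ 2 = 0 by rewrite -sE s00 expr0n.
  move/psumr_eq0P => h; have /eqP : a i ^+ 2 = 0.
    by apply: h => // k _; exact: sqr_ge0.
  by rewrite sqrf_eq0 => /eqP ->; rewrite mul0r.
have [t00|tN0] := eqVneq t 0.
  rewrite t00 mulr0 big1// => i _.
  have : \sum_i b i ^+ 2 = 0 by rewrite -tE t00 expr0n.
  move/psumr_eq0P => h; have /eqP : b i ^+ 2 = 0.
    by apply: h => // k _; exact: sqr_ge0.
  by rewrite sqrf_eq0 => /eqP ->; rewrite mulr0.
have st : 0 < s * t by rewrite mulr_gt0// lt_neqAle eq_sym ?sN0 ?tN0.
have : 0 <= \sum_i (a i * t - b i * s) ^+ 2.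
  by rewrite sumr_ge0// => i _; exact: sqr_ge0.
have -> : \sum_i (a i * t - b i * s) ^+ 2 =
    t ^+ 2 * s ^+ 2 - (s * t * \sum_i a i * b i) *+ 2 + s ^+ 2 * t ^+ 2.
  rewrite {1}sE {2}tE !mulr_sumr -sumrMnl -sumrN -!big_split/=.
  apply: eq_bigr => i _; rewrite sqrrB !exprMn; congr (_ - _ + _).
  - by rewrite mulrC.
  - by congr (_ *+ 2); rewrite mulrACA mulrC [t * s]mulrC.
  - by rewrite mulrC.
rewrite mulrC -addrA [- _ + _]addrC addrA -mulr2n subr_ge0 ler_pMn2r//.
by rewrite -exprMn expr2 ler_pM2l.
Qed.

Lemma enormD n (u v : 'cV[R[i]]_n) : enorm (u + v) <= enorm u + enorm v.
Proof.
rewrite -(@ler_pXn2r _ 2)// ?nnegrE ?addr_ge0 ?enorm_ge0//.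
rewrite sqr_enorm sqrrD !sqr_enorm.
apply: (@le_trans _ _ (\sum_(i < n) (normc (u i 0) + normc (v i 0)) ^+ 2)).
  apply: ler_sum => i _; rewrite ler_pXn2r ?nnegrE ?addr_ge0 ?normc_ge0//.
  by rewrite mxE le_normcD.
under eq_bigr do rewrite sqrrD.
rewrite !big_split/= lerD2r lerD2l -mulr2n ler_pMn2r//.
by rewrite enorm.unlock real_CauchySchwarz.
Qed.

Lemma enorm_mul_bounded n (A : 'M[R[i]]_n) :
  exists2 c, 0 <= c & forall v, enorm (A *m v) <= c * enorm v.
Proof.
pose r i := Num.sqrt (\sum_j normc (A i j) ^+ 2).
exists (Num.sqrt (\sum_i r i ^+ 2)) => [|v]; first exact: sqrtr_ge0.
have S0 : 0 <= \sum_i r i ^+ 2 by apply: sumr_ge0 => i _; exact: sqr_ge0.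
rewrite -(@ler_pXn2r _ 2)// ?nnegrE ?mulr_ge0 ?enorm_ge0 ?sqrtr_ge0//.
rewrite exprMn (sqr_sqrtr S0) [leLHS]sqr_enorm mulr_suml.
apply: ler_sum => i _; rewrite -exprMn.
rewrite ler_pXn2r ?nnegrE ?mulr_ge0 ?normc_ge0 ?enorm_ge0 ?sqrtr_ge0//.
rewrite mxE (le_trans (normc_sum _))//.
under eq_bigr do rewrite normcM.
by rewrite enorm.unlock real_CauchySchwarz.
Qed.

Lemma opnorm_has_sup n (A : 'M[R[i]]_n) :
  has_sup [set enorm (A *m v) | v in [set v : 'cV[R[i]]_n | enorm v <= 1]].
Proof.
split; first by exists (enorm (A *m 0)), 0 => //=; rewrite enorm0.
have [c c0 cP] := enorm_mul_bounded A.
by exists c => _ [v /= v1 <-]; rewrite (le_trans (cP v))// ler_piMr.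
Qed.

Lemma opnorm_ge0 n (A : 'M[R[i]]_n) : 0 <= opnorm A.
Proof.
rewrite opnorm.unlock; apply: sup_upper_bound; first exact: opnorm_has_sup.
by exists 0; rewrite /= ?mulmx0 enorm0.
Qed.

Lemma enorm_mulmx_le n (A : 'M[R[i]]_n) v : enorm (A *m v) <= opnorm A * enorm v.
Proof.
have [v0|vN0] := eqVneq (enorm v) 0.
  by rewrite (enorm_eq0 v0) mulmx0 enorm0 mulr0.
have v_gt0 : 0 < enorm v by rewrite lt_neqAle eq_sym vN0 enorm_ge0.
pose w := ((enorm v)^-1)%:C%C *: v.
have nE : normc ((enorm v)^-1)%:C%C = (enorm v)^-1.
  by rewrite /= expr0n addr0 sqrtr_sqr ger0_norm// invr_ge0 enorm_ge0.
rewrite -ler_pdivrMr// mulrC -nE -enormZ scalemxAr.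
rewrite opnorm.unlock; apply: sup_upper_bound; first exact: opnorm_has_sup.
by exists w => //=; rewrite enormZ nE mulVf.
Qed.

Lemma opnorm_le n (A : 'M[R[i]]_n) c : 0 <= c ->
  (forall v, enorm (A *m v) <= c * enorm v) -> opnorm A <= c.
Proof.
move=> c0 cP; rewrite opnorm.unlock; apply: ge_sup; first by have [] := opnorm_has_sup A.
by move=> _ [v /= v1 <-]; rewrite (le_trans (cP v))// ler_piMr.
Qed.

Lemma opnormD n (A B : 'M[R[i]]_n) : opnorm (A + B) <= opnorm A + opnorm B.
Proof.
apply: opnorm_le => [|v]; first by rewrite addr_ge0 ?opnorm_ge0.
by rewrite mulmxDl (le_trans (enormD _ _))// mulrDl lerD// enorm_mulmx_le.
Qed.

Lemma opnormM n (A B : 'M[R[i]]_n) : opnorm (A *m B) <= opnorm A * opnorm B.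
Proof.
apply: opnorm_le => [|v]; first by rewrite mulr_ge0 ?opnorm_ge0.
rewrite -mulmxA (le_trans (enorm_mulmx_le _ _))// -mulrA ler_wpM2l ?opnorm_ge0//.
exact: enorm_mulmx_le.
Qed.

Lemma opnormZ n (z : R[i]) (A : 'M[R[i]]_n) : opnorm (z *: A) = normc z * opnorm A.
Proof.
have le_ y (B : 'M[R[i]]_n) : opnorm (y *: B) <= normc y * opnorm B.
  apply: opnorm_le => [|v]; first by rewrite mulr_ge0 ?opnorm_ge0 ?normc_ge0.
  rewrite -scalemxAl enormZ -mulrA ler_wpM2l ?normc_ge0//.
  exact: enorm_mulmx_le.
apply/eqP; rewrite eq_le le_/=.
have [->|z0] := eqVneq z 0; first by rewrite normc0 mul0r opnorm_ge0.
have nz0 : 0 < normc z.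
  rewrite lt_neqAle normc_ge0 andbT eq_sym.
  by apply: contra z0 => /eqP/eq0_normc ->.
rewrite -ler_pdivlMl// -normcV -[leLHS](_ : opnorm (z^-1 *: (z *: A)) = _) ?le_//.
by rewrite scalerA mulVf// scale1r.
Qed.

Lemma opnormN n (A : 'M[R[i]]_n) : opnorm (- A) = opnorm A.
Proof. by rewrite -scaleN1r opnormZ normcN normc1 mul1r. Qed.

Lemma opnorm0 n : opnorm (0 : 'M[R[i]]_n) = 0.
Proof. by rewrite -(scale0r 0) opnormZ normc0 mul0r. Qed.

Lemma opnormB n (A B : 'M[R[i]]_n) : opnorm (A - B) = opnorm (B - A).
Proof. by rewrite -opnormN opprB. Qed.

Lemma opnorm1_le n : opnorm (1%:M : 'M[R[i]]_n) <= 1.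
Proof. by apply: opnorm_le => // v; rewrite mul1mx mul1r. Qed.

Lemma opnorm1 n : (0 < n)%N -> opnorm (1%:M : 'M[R[i]]_n) = 1.
Proof.
case: n => // n _; apply/eqP; rewrite eq_le opnorm1_le/=.
pose v : 'cV[R[i]]_n.+1 := const_mx 1.
have v0 : 0 < enorm v.
  rewrite lt_neqAle enorm_ge0 andbT eq_sym; apply/eqP => /enorm_eq0/matrixP.
  by move=> /(_ 0 0); rewrite !mxE; apply/eqP; exact: oner_neq0.
by have := enorm_mulmx_le 1%:M v; rewrite mul1mx -ler_pdivrMr// divff// gt_eqF.
Qed.

Lemma normc_real (x : R) : normc x%:C%C = `|x|.
Proof. by rewrite /= expr0n addr0 sqrtr_sqr. Qed.

Definition ctrmx m n (A : 'M[R[i]]_(m, n)) : 'M[R[i]]_(n, m) :=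
  map_mx (@conjc R) A^T.

Lemma ctrmxK m n (A : 'M[R[i]]_(m, n)) : ctrmx (ctrmx A) = A.
Proof. by apply/matrixP => i j; rewrite !mxE conjcK. Qed.

Lemma ctrmxM m n p (A : 'M[R[i]]_(m, n)) (B : 'M[R[i]]_(n, p)) :
  ctrmx (A *m B) = ctrmx B *m ctrmx A.
Proof. by rewrite /ctrmx trmx_mul map_mxM. Qed.

Lemma ctrmxD m n (A B : 'M[R[i]]_(m, n)) : ctrmx (A + B) = ctrmx A + ctrmx B.
Proof. by apply/matrixP => i j; rewrite !mxE rmorphD. Qed.

Lemma ctrmxB m n (A B : 'M[R[i]]_(m, n)) : ctrmx (A - B) = ctrmx A - ctrmx B.
Proof. by apply/matrixP => i j; rewrite !mxE rmorphB. Qed.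

Lemma normc_inner_le n (u v : 'cV[R[i]]_n) :
  normc ((ctrmx u *m v) 0 0) <= enorm u * enorm v.
Proof.
rewrite mxE (le_trans (normc_sum _))//.
under eq_bigr do rewrite normcM !mxE normc_conj.
by rewrite enorm.unlock real_CauchySchwarz.
Qed.

Lemma innervv n (v : 'cV[R[i]]_n) : (ctrmx v *m v) 0 0 = (enorm v ^+ 2)%:C%C.
Proof.
rewrite sqr_enorm mxE rmorph_sum/=; apply: eq_bigr => i _.
rewrite !mxE; case: (v i 0) => a b /=.
rewrite sqr_sqrtr ?addr_ge0 ?sqr_ge0//.
by apply/eqP; rewrite eq_complex/= !expr2 mulNr opprK [a * b]mulrC mulNr subrr !eqxx.
Qed.

Lemma sqr_opnorm_le n (A : 'M[R[i]]_n) : opnorm A ^+ 2 <= opnorm (ctrmx A *m A).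
Proof.
have c0 : 0 <= opnorm (ctrmx A *m A) by exact: opnorm_ge0.
rewrite -(@sqr_sqrtr _ (opnorm (ctrmx A *m A)))//.
rewrite ler_pXn2r ?nnegrE ?opnorm_ge0 ?sqrtr_ge0//.
apply: opnorm_le => [|v]; first exact: sqrtr_ge0.
rewrite -(@ler_pXn2r _ 2)// ?nnegrE ?mulr_ge0 ?enorm_ge0 ?sqrtr_ge0//.
rewrite exprMn (sqr_sqrtr c0).
have -> : enorm (A *m v) ^+ 2 = normc ((ctrmx v *m (ctrmx A *m A *m v)) 0 0).
  by rewrite mulmxA mulmxA -ctrmxM -mulmxA innervv normc_real ger0_norm// sqr_ge0.
rewrite (le_trans (normc_inner_le _ _))// mulrC expr2 mulrA.
by rewrite ler_wpM2r ?enorm_ge0// enorm_mulmx_le.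
Qed.

Lemma opnorm_ctrmx_le n (A : 'M[R[i]]_n) : opnorm A <= opnorm (ctrmx A).
Proof.
have [->|A0] := eqVneq (opnorm A) 0; first exact: opnorm_ge0.
have A_gt0 : 0 < opnorm A by rewrite lt_neqAle eq_sym A0 opnorm_ge0.
by rewrite -(ler_pM2r A_gt0) -expr2 (le_trans (sqr_opnorm_le A))// opnormM.
Qed.

Lemma opnorm_ctrmx n (A : 'M[R[i]]_n) : opnorm (ctrmx A) = opnorm A.
Proof.
apply/eqP; rewrite eq_le opnorm_ctrmx_le andbT.
by have := opnorm_ctrmx_le (ctrmx A); rewrite ctrmxK.
Qed.

Lemma opnorm_Cstar n (A : 'M[R[i]]_n) : opnorm (ctrmx A *m A) = opnorm A ^+ 2.
Proof.
apply/eqP; rewrite eq_le sqr_opnorm_le andbT.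
by rewrite (le_trans (opnormM _ _))// opnorm_ctrmx expr2.
Qed.

Lemma opnorm_eq0 n (A : 'M[R[i]]_n) : opnorm A = 0 -> A = 0.
Proof.
move=> A0; have Av (v : 'cV_n) : A *m v = 0.
  apply: enorm_eq0; apply/eqP; rewrite eq_le enorm_ge0 andbT.
  by rewrite (le_trans (enorm_mulmx_le _ _))// A0 mul0r.
apply/matrixP => i j; have := Av (delta_mx j 0).
by rewrite -colE => /matrixP/(_ i 0); rewrite !mxE.
Qed.

End OperatorNorm.

(* dim n = 2 ^ n, defined so that dim n.+1 is convertible to dim n + dim n;    *)
(* amp1 is the connecting map x |-> x (+) x from M_(2^n) to M_(2^(n+1)).       *)
Fixpoint dim (n : nat) : nat := if n is n'.+1 then dim n' + dim n' else 1.

Lemma dimE n : dim n = (2 ^ n)%N.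
Proof. by elim: n => //= n ->; rewrite expnS mul2n addnn. Qed.

Lemma dim_gt0 n : (0 < dim n)%N.
Proof. by rewrite dimE expn_gt0. Qed.

Definition amp1 (R : realType) n (x : 'M[R[i]]_(dim n)) : 'M[R[i]]_(dim n.+1) :=
  block_mx x 0 0 x.

Fixpoint amp (R : realType) k n (x : 'M[R[i]]_(dim n)) : 'M[R[i]]_(dim (k + n)) :=
  if k is k'.+1 then amp1 (amp k' x) else x.

Section Amplification.
Variables (R : realType) (k n : nat).
Implicit Types x y : 'M[R[i]]_(dim n).

Lemma enorm_col_mx p q (u : 'cV[R[i]]_p) (v : 'cV[R[i]]_q) :
  enorm (col_mx u v) ^+ 2 = enorm u ^+ 2 + enorm v ^+ 2.
Proof.
rewrite !sqr_enorm big_split_ord/=; congr (_ + _); apply: eq_bigr => i _.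
  by rewrite col_mxEu.
by rewrite col_mxEd.
Qed.

Lemma ampB x y : amp k (x - y) = amp k x - amp k y.
Proof.
elim: k => //= k' ->.
by rewrite /amp1 opp_block_mx add_block_mx !subr0.
Qed.

Lemma ampD x y : amp k (x + y) = amp k x + amp k y.
Proof. by elim: k => //= k' ->; rewrite /amp1 add_block_mx !addr0. Qed.

Lemma ampZ (c : R[i]) x : amp k (c *: x) = c *: amp k x.
Proof. by elim: k => //= k' ->; rewrite /amp1 scale_block_mx !scaler0. Qed.

Lemma ampM x y : amp k (x *m y) = amp k x *m amp k y.
Proof.
elim: k => //= k' ->.
by rewrite /amp1 mulmx_block !mulmx0 !mul0mx !addr0 !add0r.
Qed.

Lemma amp_scalar (c : R[i]) : amp k (c%:M : 'M_(dim n)) = c%:M.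
Proof. by elim: k => //= k' ->; rewrite /amp1 -scalar_mx_block. Qed.

Lemma amp_ctrmx x : amp k (ctrmx x) = ctrmx (amp k x).
Proof.
elim: k => //= k' ->.
by rewrite /amp1 /ctrmx tr_block_mx map_block_mx !trmx0 !map_mx0.
Qed.

End Amplification.

Section AmplificationNorm.
Variable R : realType.

Lemma opnorm_amp1 n (x : 'M[R[i]]_(dim n)) : opnorm (amp1 x) = opnorm x.
Proof.
apply/eqP; rewrite eq_le; apply/andP; split; apply: opnorm_le => [|v].
- exact: opnorm_ge0.
- rewrite -[v]vsubmxK /amp1 mul_block_col !mul0mx addr0 add0r.
  rewrite -(@ler_pXn2r _ 2)// ?nnegrE ?mulr_ge0 ?enorm_ge0 ?opnorm_ge0//.
  rewrite exprMn !enorm_col_mx mulrDr -!exprMn.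
  by rewrite lerD// ler_pXn2r ?nnegrE ?mulr_ge0 ?enorm_ge0 ?opnorm_ge0//
     enorm_mulmx_le.
- exact: opnorm_ge0.
- have e0 (w : 'cV[R[i]]_(dim n)) : enorm (col_mx w (0 : 'cV[R[i]]_(dim n))) = enorm w.
    apply/eqP; rewrite -(@eqrXn2 _ 2%N)// ?enorm_ge0//.
    by rewrite enorm_col_mx enorm0 expr0n addr0.
  rewrite -e0 -(e0 v).
  have := enorm_mulmx_le (amp1 x) (col_mx v (0 : 'cV[R[i]]_(dim n))).
  by rewrite /amp1 mul_block_col !mul0mx !mulmx0 !addr0.
Qed.

Lemma opnorm_amp k n (x : 'M[R[i]]_(dim n)) : opnorm (amp k x) = opnorm x.
Proof. by elim: k => //= k IH; rewrite opnorm_amp1. Qed.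

End AmplificationNorm.

Definition matseq (R : realType) := forall n, 'M[R[i]]_(dim n).

Section MatSeq.
Variable R : realType.
Local Notation S := (matseq R).
Implicit Types x y z : S.

HB.instance Definition _ := gen_eqMixin S.
HB.instance Definition _ := gen_choiceMixin S.

Let ms0 : S := fun n => 0.
Let msopp x : S := fun n => - x n.
Let msadd x y : S := fun n => x n + y n.
Let ms1 : S := fun n => 1%:M.
Let msmul x y : S := fun n => x n *m y n.
Let msscale (c : R[i]) x : S := fun n => c *: x n.

Fact msaddA : associative msadd.
Proof. by move=> x y z; apply: functional_extensionality_dep => n; exact: addrA. Qed.
Fact msaddC : commutative msadd.
Proof. by move=> x y; apply: functional_extensionality_dep => n; exact: addrC. Qed.
Fact msadd0 : left_id ms0 msadd.
Proof. by move=> x; apply: functional_extensionality_dep => n; exact: add0r. Qed.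
Fact msaddN : left_inverse ms0 msopp msadd.
Proof. by move=> x; apply: functional_extensionality_dep => n; exact: addNr. Qed.
HB.instance Definition _ := GRing.isZmodule.Build S msaddA msaddC msadd0 msaddN.

Fact msmulA : associative msmul.
Proof. by move=> x y z; apply: functional_extensionality_dep => n; exact: mulmxA. Qed.
Fact ms1mul : left_id ms1 msmul.
Proof. by move=> x; apply: functional_extensionality_dep => n; exact: mul1mx. Qed.
Fact msmul1 : right_id ms1 msmul.
Proof. by move=> x; apply: functional_extensionality_dep => n; exact: mulmx1. Qed.
Fact msmulDl : left_distributive msmul +%R.
Proof. by move=> x y z; apply: functional_extensionality_dep => n; exact: mulmxDl. Qed.
Fact msmulDr : right_distributive msmul +%R.
Proof. by move=> x y z; apply: functional_extensionality_dep => n; exact: mulmxDr. Qed.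
Fact ms1_neq0 : ms1 != 0.
Proof.
apply/eqP => /(congr1 (fun x : S => x 0%N 0 0)); rewrite !mxE eqxx.
by apply/eqP; exact: oner_neq0.
Qed.
HB.instance Definition _ := GRing.Zmodule_isNzRing.Build S
  msmulA ms1mul msmul1 msmulDl msmulDr ms1_neq0.

Fact msscaleA a b x : msscale a (msscale b x) = msscale (a * b) x.
Proof. by apply: functional_extensionality_dep => n; exact: scalerA. Qed.
Fact msscale1 : left_id 1 msscale.
Proof. by move=> x; apply: functional_extensionality_dep => n; exact: scale1r. Qed.
Fact msscaleDr : right_distributive msscale +%R.
Proof. by move=> c x y; apply: functional_extensionality_dep => n; exact: scalerDr. Qed.
Fact msscaleDl x : {morph msscale^~ x : a b / a + b}.
Proof. by move=> a b; apply: functional_extensionality_dep => n; exact: scalerDl. Qed.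
HB.instance Definition _ := GRing.Zmodule_isLmodule.Build R[i] S
  msscaleA msscale1 msscaleDr msscaleDl.

Fact msscaleAl (c : R[i]) x y : c *: (x * y) = (c *: x) * y.
Proof. by apply: functional_extensionality_dep => n; exact: scalemxAl. Qed.
HB.instance Definition _ := GRing.Lmodule_isLalgebra.Build R[i] S msscaleAl.
Fact msscaleAr (c : R[i]) x y : c *: (x * y) = x * (c *: y).
Proof. by apply: functional_extensionality_dep => n; exact: scalemxAr. Qed.
HB.instance Definition _ := GRing.Lalgebra_isAlgebra.Build R[i] S msscaleAr.

Definition msstar x : S := fun n => ctrmx (x n).

End MatSeq.

(* Sequences that are Cauchy in the algebraic inductive limit of the M_(2^n)   *)
(* along amp1, i.e. with |x_(k+n) - amp k x_n| small for n large, all k.       *)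
Definition cauchy_matseq (R : realType) : pred (matseq R) := fun x =>
  `[< forall e : R, 0 < e ->
      \forall n \near \oo, forall k, opnorm (x (k + n)%N - amp k (x n)) <= e >].

Section Cauchy.
Variable R : realType.
Implicit Types x y : matseq R.

Lemma cauchy_bounded x : x \in @cauchy_matseq R ->
  exists2 B : R, 0 < B & \forall n \near \oo, opnorm (x n) <= B.
Proof.
move=> /asboolP/(_ _ ltr01)[N _ NP].
exists (1 + opnorm (x N)); first by rewrite ltr_pwDl// opnorm_ge0.
exists N => // n /= Nn; rewrite -(subnK Nn).
rewrite -[x (_ + _)%N](subrK (amp (n - N) (x N))).
by rewrite (le_trans (opnormD _ _))// opnorm_amp lerD// NP/=.
Qed.

Lemma cauchy_subalg : GRing.subsemialg_closed (@cauchy_matseq R).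
Proof.
have cauchyD x y : cauchy_matseq x -> cauchy_matseq y -> cauchy_matseq (x + y).
  move=> /asboolP xP /asboolP yP; apply/asboolP => e e0.
  have e20 : 0 < e / 2 by rewrite divr_gt0.
  near=> n => k.
  have -> : (x + y) (k + n)%N - amp k ((x + y) n) =
      (x (k + n)%N - amp k (x n)) + (y (k + n)%N - amp k (y n)).
    by rewrite -[LHS]/(x _ + y _ - amp k (x n + y n)) ampD opprD addrACA.
  rewrite (le_trans (opnormD _ _))// (splitr e) lerD//.
    by move: k; near: n; exact: xP.
  by move: k; near: n; exact: yP.
have cauchyZ c x : cauchy_matseq x -> cauchy_matseq (c *: x).
  move=> /asboolP xP; apply/asboolP => e e0.
  have c0 : 0 < normc c + 1 by rewrite ltr_wpDl// normc_ge0.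
  near=> n => k.
  rewrite -[X in opnorm X]/(c *: x _ - amp k (c *: x n)) ampZ -scalerBr opnormZ.
  rewrite (@le_trans _ _ ((normc c + 1) * (e / (normc c + 1))))//; last first.
    by rewrite mulrC divfK// gt_eqF.
  rewrite ler_pM ?normc_ge0 ?opnorm_ge0// ?lerDl//.
  by move: k; near: n; apply: xP; rewrite divr_gt0.
have cauchyM x y : cauchy_matseq x -> cauchy_matseq y -> cauchy_matseq (x * y).
  move=> xC yC; have [A A0 xA] := cauchy_bounded xC.
  have [B B0 yB] := cauchy_bounded yC.
  move: xC yC => /asboolP xP /asboolP yP; apply/asboolP => e e0.
  have [N _ NP] := yB.
  near=> n => k.
  have -> : (x * y) (k + n)%N - amp k ((x * y) n) =
      (x (k + n)%N - amp k (x n)) *m y (k + n)%N +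
      amp k (x n) *m (y (k + n)%N - amp k (y n)).
    rewrite -[LHS]/(x _ *m y _ - amp k (x n *m y n)) ampM.
    by rewrite mulmxBl mulmxBr addrA subrK.
  rewrite (le_trans (opnormD _ _))// (splitr e) lerD//.
    rewrite (le_trans (opnormM _ _))// -[e / 2](divfK (lt0r_neq0 B0)).
    rewrite ler_pM ?opnorm_ge0//; last first.
      by apply: NP => /=; rewrite (leq_trans _ (leq_addl _ _))//; near: n; exact: nbhs_infty_ge.
    by move: k; near: n; apply: xP; rewrite !divr_gt0.
  rewrite (le_trans (opnormM _ _))// opnorm_amp -[e / 2](divfK (lt0r_neq0 A0)) mulrC.
  rewrite ler_pM ?opnorm_ge0//; last by near: n; exact: xA.
  by move: k; near: n; apply: yP; rewrite !divr_gt0.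
have cauchyS (c : R[i]) : cauchy_matseq (c *: (1 : matseq R)).
  apply: cauchyZ; apply/asboolP => e e0; apply: nearW => n k.
  by rewrite -[X in opnorm X]/(1%:M - amp k 1%:M) amp_scalar subrr opnorm0 ltW.
split=> [||c x|x y].
- by have := cauchyS 1; rewrite scale1r.
- by split=> [|x y]; [have := cauchyS 0; rewrite scale0r|exact: cauchyD].
- exact: cauchyZ.
- exact: cauchyM.
Unshelve. all: by end_near. Qed.

HB.instance Definition _ := GRing.isSubalgClosed.Build R[i] (matseq R) (@cauchy_matseq R)
  cauchy_subalg.

Lemma cauchy_star x : x \in @cauchy_matseq R -> msstar x \in @cauchy_matseq R.
Proof.
move=> /asboolP xP; apply/asboolP => e e0; near=> n => k.
rewrite -[X in opnorm X]/(ctrmx _ - amp k (ctrmx _)) amp_ctrmx -ctrmxB opnorm_ctrmx.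
by move: k; near: n; exact: xP.
Unshelve. all: by end_near. Qed.

End Cauchy.

Record cseq (R : realType) := CSeq { cseq_val :> matseq R; _ : cseq_val \in @cauchy_matseq R }.

Section CSeq.
Variable R : realType.

HB.instance Definition _ := [isSub for @cseq_val R].
HB.instance Definition _ := [Choice of cseq R by <:].
HB.instance Definition _ := [SubChoice_isSubAlgebra of cseq R by <:].

End CSeq.

Definition null_cseq (R : realType) : pred (cseq R) := fun x =>
  `[< opnorm (cseq_val x n) @[n --> \oo] --> (0 : R) >].

Section Null.
Variable R : realType.
Implicit Types x y : cseq R.

Lemma null_zmod : zmod_closed (@null_cseq R).
Proof.
split=> [|x y /asboolP x0 /asboolP y0]; apply/asboolP.
  by rewrite [X in X @ _](_ : _ = fun=> 0) ?funeqE => [|n]; [exact: cvg_cst|exact: opnorm0].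
apply: (@squeeze_cvgr _ _ _ _ (fun=> 0) (fun n => opnorm (cseq_val x n) + opnorm (cseq_val y n))).
- apply: nearW => n; rewrite opnorm_ge0/= -(opnormN (cseq_val y n)).
  exact: opnormD.
- exact: cvg_cst.
- by rewrite -[X in _ --> X](addr0 0); exact: cvgD.
Qed.
HB.instance Definition _ := GRing.isZmodClosed.Build (cseq R) (@null_cseq R) null_zmod.

Lemma nullMl x y : y \in @null_cseq R -> x * y \in @null_cseq R.
Proof.
move=> /asboolP y0; apply/asboolP.
have [B B0 xB] := cauchy_bounded (valP x).
apply: (@squeeze_cvgr _ _ _ _ (fun=> 0) (fun n => B * opnorm (cseq_val y n))).
- near=> n; rewrite opnorm_ge0/= (le_trans (opnormM _ _))// ler_wpM2r ?opnorm_ge0//.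
  by near: n; exact: xB.
- exact: cvg_cst.
- by rewrite -[X in _ --> X](mulr0 B); apply: cvgMr; exact: y0.
Unshelve. all: by end_near. Qed.

Lemma nullMr x y : x \in @null_cseq R -> x * y \in @null_cseq R.
Proof.
move=> /asboolP x0; apply/asboolP.
have [B B0 yB] := cauchy_bounded (valP y).
apply: (@squeeze_cvgr _ _ _ _ (fun=> 0) (fun n => opnorm (cseq_val x n) * B)).
- near=> n; rewrite opnorm_ge0/= (le_trans (opnormM _ _))// ler_wpM2l ?opnorm_ge0//.
  by near: n; exact: yB.
- exact: cvg_cst.
- by rewrite -[X in _ --> X](mul0r B); apply: cvgMl; exact: x0.
Unshelve. all: by end_near. Qed.

Lemma nullZ c x : x \in @null_cseq R -> c *: x \in @null_cseq R.
Proof. by move=> x0; rewrite -[x]mul1r scalerAl nullMl. Qed.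

End Null.

Definition cstar (R : realType) (x : cseq R) : cseq R := CSeq (cauchy_star (valP x)).

(* The CAR algebra: the completion of the algebraic inductive limit of         *)
(* M_1 -> M_2 -> M_4 -> ..., as Cauchy sequences modulo null sequences.        *)
Definition car (R : realType) := @Quotient.quot (cseq R) (GRing.ZmodClosed.clone (cseq R) (@null_cseq R) _).
HB.instance Definition _ (R : realType) := Choice.on (car R).
HB.instance Definition _ (R : realType) := GRing.Zmodule.on (car R).
HB.instance Definition _ (R : realType) := EqQuotient.on (car R).

Section Car.
Variable R : realType.
Local Open Scope quotient_scope.
Implicit Types x y z : car R.
Local Notation pi := (\pi_(car R)).

Lemma pi_eqE (u v : cseq R) : (pi u = pi v) <-> (u - v \in @null_cseq R).
Proof. by rewrite Quotient.idealrBE; split => /eqP. Qed.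

Definition car_one : car R := pi 1.
Definition car_mul := lift_op2 (car R) *%R.
Definition car_scale (c : R[i]) := lift_op1 (car R) ( *:%R c).

Fact pi_mul (u v : cseq R) : car_mul (pi u) (pi v) = pi (u * v).
Proof.
rewrite /car_mul; unlock; apply/pi_eqE; set u' := repr _; set v' := repr _.
have u'u : u' - u \in @null_cseq R by apply/pi_eqE; rewrite reprK.
have v'v : v' - v \in @null_cseq R by apply/pi_eqE; rewrite reprK.
rewrite (_ : _ - _ = (u' - u) * v' + u * (v' - v)).
  by apply: rpredD; [exact: nullMr|exact: nullMl].
by rewrite mulrBl mulrBr addrA subrK.
Qed.

Fact pi_scale c (u : cseq R) : car_scale c (pi u) = pi (c *: u).
Proof.
rewrite /car_scale; unlock; apply/pi_eqE; rewrite -scalerBr nullZ//.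
by apply/pi_eqE; rewrite reprK.
Qed.

Fact pi_add (u v : cseq R) : pi u + pi v = pi (u + v).
Proof. by apply/esym; exact: Quotient.pi_add. Qed.

Fact pi_zero : pi 0 = 0.
Proof. by apply: (addrI (pi 0)); rewrite pi_add !addr0. Qed.

Fact mulqA : associative car_mul.
Proof. by move=> x y z; rewrite -[x]reprK -[y]reprK -[z]reprK !pi_mul mulrA. Qed.
Fact mul1q : left_id car_one car_mul.
Proof. by move=> x; rewrite -[x]reprK [LHS]pi_mul mul1r. Qed.
Fact mulq1 : right_id car_one car_mul.
Proof. by move=> x; rewrite -[x]reprK [LHS]pi_mul mulr1. Qed.
Fact mulqDl : left_distributive car_mul +%R.
Proof.
by move=> x y z; rewrite -[x]reprK -[y]reprK -[z]reprK pi_add !pi_mul pi_add mulrDl.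
Qed.
Fact mulqDr : right_distributive car_mul +%R.
Proof.
by move=> x y z; rewrite -[x]reprK -[y]reprK -[z]reprK pi_add !pi_mul pi_add mulrDr.
Qed.
Fact oneq_neq0 : car_one != 0.
Proof.
apply/eqP; rewrite -pi_zero => /pi_eqE/asboolP; rewrite subr0.
move=> /cvgrPdist_lt/(_ _ ltr01)[n _ /(_ n (leqnn n))].
rewrite sub0r normrN ger0_norm ?opnorm_ge0// ltNge.
by rewrite -[X in opnorm X]/(1%:M) (opnorm1 R (dim_gt0 n)) lexx.
Qed.
HB.instance Definition _ := GRing.Zmodule_isNzRing.Build (car R)
  mulqA mul1q mulq1 mulqDl mulqDr oneq_neq0.

Fact scaleqA a b x : car_scale a (car_scale b x) = car_scale (a * b) x.
Proof. by rewrite -[x]reprK !pi_scale scalerA. Qed.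
Fact scale1q : left_id 1 car_scale.
Proof. by move=> x; rewrite -[x]reprK pi_scale scale1r. Qed.
Fact scaleqDr : right_distributive car_scale +%R.
Proof. by move=> c x y; rewrite -[x]reprK -[y]reprK pi_add !pi_scale pi_add scalerDr. Qed.
Fact scaleqDl x : {morph car_scale^~ x : a b / a + b}.
Proof. by move=> a b; rewrite -[x]reprK !pi_scale pi_add scalerDl. Qed.
HB.instance Definition _ := GRing.Zmodule_isLmodule.Build R[i] (car R)
  scaleqA scale1q scaleqDr scaleqDl.

Fact scaleqAl (c : R[i]) x y : c *: (x * y) = (c *: x) * y.
Proof.
by rewrite -[x]reprK -[y]reprK -[LHS]/(car_scale _ (car_mul _ _)) -[RHS]/(car_mul (car_scale _ _) _)
  !(pi_mul, pi_scale) scalerAl.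
Qed.
HB.instance Definition _ := GRing.Lmodule_isLalgebra.Build R[i] (car R) scaleqAl.
Fact scaleqAr (c : R[i]) x y : c *: (x * y) = x * (c *: y).
Proof.
by rewrite -[x]reprK -[y]reprK -[LHS]/(car_scale _ (car_mul _ _)) -[RHS]/(car_mul _ (car_scale _ _))
  !(pi_mul, pi_scale) scalerAr.
Qed.
HB.instance Definition _ := GRing.Lalgebra_isAlgebra.Build R[i] (car R) scaleqAr.

Definition car_star := lift_op1 (car R) (@cstar R).

Lemma car_star_pi (u : cseq R) : car_star (pi u) = pi (cstar u).
Proof.
rewrite /car_star; unlock; apply/pi_eqE; set u' := repr _.
have /asboolP u'u : u' - u \in @null_cseq R by apply/pi_eqE; rewrite reprK.
apply/asboolP; apply: cvg_trans u'u; apply: near_eq_cvg; apply: nearW => n.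
by rewrite -[RHS]/(opnorm (ctrmx _ - ctrmx _)) -ctrmxB opnorm_ctrmx.
Qed.

End Car.

Section BlockNorm.
Variables (R : realType) (m : nat).

Lemma sqr_enorm_mxcol n (u : 'I_m -> 'cV[R[i]]_n) :
  enorm (\mxcol_(i < m) u i) ^+ 2 = \sum_(i < m) enorm (u i) ^+ 2.
Proof.
rewrite sqr_enorm; under [RHS]eq_bigr do rewrite sqr_enorm.
rewrite sig_big_dep/= (reindex _ tagnat.sig_bij_on)/=.
by apply: eq_bigr => s _; rewrite mxE.
Qed.

Lemma enorm_mxcol_ge n (u : 'I_m -> 'cV[R[i]]_n) i :
  enorm (u i) <= enorm (\mxcol_(i < m) u i).
Proof.
rewrite -(@ler_pXn2r _ 2)// ?nnegrE ?enorm_ge0// sqr_enorm_mxcol (bigD1 i)//=.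
by rewrite lerDl sumr_ge0// => j _; exact: sqr_ge0.
Qed.

Lemma enorm_mxcol_le n (u : 'I_m -> 'cV[R[i]]_n) :
  enorm (\mxcol_(i < m) u i) <= \sum_(i < m) enorm (u i).
Proof.
have s0 : 0 <= \sum_(i < m) enorm (u i) by rewrite sumr_ge0// => i _; exact: enorm_ge0.
rewrite -(@ler_pXn2r _ 2)// ?nnegrE ?enorm_ge0// sqr_enorm_mxcol expr2 mulr_suml.
apply: ler_sum => i _; rewrite expr2 ler_wpM2l ?enorm_ge0// (bigD1 i)//= lerDl.
by rewrite sumr_ge0// => j _; exact: enorm_ge0.
Qed.

Lemma enorm_sum n (I : finType) (F : I -> 'cV[R[i]]_n) :
  enorm (\sum_i F i) <= \sum_i enorm (F i).
Proof.
elim/big_ind2 : _ => [|x1 x2 y1 y2 h1 h2|//]; first by rewrite enorm0.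
by rewrite (le_trans (enormD _ _))// lerD.
Qed.

Variable n : nat.
Implicit Types x : 'I_m -> 'I_m -> 'M[R[i]]_n.

Lemma opnorm_mxblock_le x :
  opnorm (\mxblock_(i < m, j < m) x i j) <= \sum_(i < m) \sum_(j < m) opnorm (x i j).
Proof.
apply: opnorm_le => [|v].
  by rewrite sumr_ge0// => i _; rewrite sumr_ge0// => j _; exact: opnorm_ge0.
rewrite -(submxcolK v) mul_mxblock_mxrow (le_trans (enorm_mxcol_le _))//.
rewrite mulr_suml ler_sum// => i _; rewrite (le_trans (enorm_sum _))//.
rewrite mulr_suml ler_sum// => j _; rewrite (le_trans (enorm_mulmx_le _ _))//.
by rewrite ler_wpM2l ?opnorm_ge0// enorm_mxcol_ge.
Qed.

Lemma opnorm_mxblock_ge x i j :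
  opnorm (x i j) <= opnorm (\mxblock_(i < m, j < m) x i j).
Proof.
apply: opnorm_le => [|v]; first exact: opnorm_ge0.
pose w := \mxcol_(k < m) (if k == j then v else 0).
have wE : enorm w = enorm v.
  apply/eqP; rewrite -(@eqrXn2 _ 2%N)// ?enorm_ge0// sqr_enorm_mxcol (bigD1 j)//= eqxx.
  by rewrite big1 ?addr0// => k /negPf ->; rewrite enorm0 expr0n.
rewrite -wE; apply: le_trans (enorm_mulmx_le _ _).
rewrite mul_mxblock_mxrow.
apply: le_trans (enorm_mxcol_ge (fun i => \sum_k (x i k *m (if k == j then v else 0))) i).
by rewrite (bigD1 j)//= eqxx big1 ?addr0// => k /negPf ->; rewrite mulmx0.
Qed.

End BlockNorm.

Lemma opnorm_mxblock_amp1 (R : realType) m n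
    (x : 'I_m -> 'I_m -> 'M[R[i]]_(dim n)) :
  opnorm (\mxblock_(i < m, j < m) amp1 (x i j)) =
  opnorm (\mxblock_(i < m, j < m) x i j).
Proof.
set X := \mxblock_(i, j) x i j.
pose uc (v : 'I_m -> 'cV[R[i]]_(dim n)) := \mxcol_(i < m) v i.
have split2 (v w : 'I_m -> 'cV[R[i]]_(dim n)) :
    enorm (\mxcol_(i < m) (col_mx (v i) (w i) : 'cV_(dim n.+1))) ^+ 2 =
    enorm (uc v) ^+ 2 + enorm (uc w) ^+ 2.
  rewrite !sqr_enorm_mxcol -big_split/=.
  by apply: eq_bigr => i _; rewrite enorm_col_mx.
have mulE (v w : 'I_m -> 'cV[R[i]]_(dim n)) :
    \mxblock_(i < m, j < m) amp1 (x i j) *m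
      \mxcol_(i < m) (col_mx (v i) (w i) : 'cV_(dim n.+1)) =
    \mxcol_(i < m) (col_mx (\sum_j (x i j *m v j)) (\sum_j (x i j *m w j))
                    : 'cV_(dim n.+1)).
  rewrite mul_mxblock_mxrow; apply: eq_mxcol => i.
  rewrite -[RHS](_ : \sum_j col_mx (x i j *m v j) (x i j *m w j) = _).
    by apply: eq_bigr => j _; rewrite /amp1 mul_block_col !mul0mx addr0 add0r.
  elim/big_rec3 : _ => [|j a b c _ ->]; first by rewrite col_mx0.
  by rewrite add_col_mx.
have XE v : X *m uc v = uc (fun i => \sum_j (x i j *m v j)) by exact: mul_mxblock_mxrow.
apply/eqP; rewrite eq_le; apply/andP; split; apply: opnorm_le => [|v];
  rewrite ?opnorm_ge0//.
- pose v1 i : 'cV_(dim n) := usubmx (submxcol v i : 'cV_(dim n + dim n)).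
  pose v2 i : 'cV_(dim n) := dsubmx (submxcol v i : 'cV_(dim n + dim n)).
  have -> : v = \mxcol_(i < m) (col_mx (v1 i) (v2 i) : 'cV_(dim n.+1)).
    by rewrite -[LHS]submxcolK; apply: eq_mxcol => i; rewrite vsubmxK.
  rewrite mulE -(@ler_pXn2r _ 2)// ?nnegrE ?mulr_ge0 ?enorm_ge0 ?opnorm_ge0//.
  rewrite exprMn !split2 mulrDr -!exprMn -!XE.
  by rewrite lerD// ler_pXn2r ?nnegrE ?mulr_ge0 ?enorm_ge0 ?opnorm_ge0//
     enorm_mulmx_le.
- have e0 (w : 'I_m -> 'cV[R[i]]_(dim n)) :
      enorm (\mxcol_(i < m) (col_mx (w i) 0 : 'cV_(dim n.+1))) = enorm (uc w).
    apply/eqP; rewrite -(@eqrXn2 _ 2%N)// ?enorm_ge0// (split2 w (fun=> 0)).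
    by rewrite [uc (fun=> 0)]mxcol0 enorm0 expr0n addr0.
  have -> : v = uc (submxcol v) by rewrite /uc submxcolK.
  rewrite XE -!e0.
  have := enorm_mulmx_le (\mxblock_(i < m, j < m) amp1 (x i j))
    (\mxcol_(i < m) (col_mx (submxcol v i) 0 : 'cV_(dim n.+1))).
  rewrite (mulE (submxcol v) (fun=> 0)).
  congr (enorm _ <= _); apply: eq_mxcol => i; congr (col_mx _ _).
  by apply: big1 => j _; rewrite mulmx0.
Qed.

Lemma opnorm_mxblock_amp (R : realType) m k n
    (x : 'I_m -> 'I_m -> 'M[R[i]]_(dim n)) :
  opnorm (\mxblock_(i < m, j < m) amp k (x i j)) =
  opnorm (\mxblock_(i < m, j < m) x i j).
Proof. by elim: k => //= k <-; rewrite opnorm_mxblock_amp1. Qed.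

Section MatrixAlgebra.
Variables (R : realType) (m : nat).
Local Open Scope quotient_scope.

(* M_m(M_(2^n)) is identified with M_(m 2^n) by forgetting the block structure. *)
Definition blockseq (x : 'I_m -> 'I_m -> cseq R) n :
    'M[R[i]]_(\sum_(i < m) dim n) :=
  \mxblock_(i < m, j < m) cseq_val (x i j) n.

(* M_m(car R) is the completion of the inductive limit of the M_m(M_(2^n)), so *)
(* its C*-norm is the limit of their operator norms.                           *)
Definition mxcar_norm (X : 'M[car R]_m) : R :=
  limn (fun n => opnorm (blockseq (fun i j => repr (X i j)) n)).

Definition mxcar_star (X : 'M[car R]_m) : 'M[car R]_m :=
  map_mx (@car_star R) X^T.

Lemma opnorm_dist n (A B : 'M[R[i]]_n) : `|opnorm A - opnorm B| <= opnorm (A - B).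
Proof.
have h (C D : 'M[R[i]]_n) : opnorm C - opnorm D <= opnorm (C - D).
  by rewrite lerBlDr -{1}(subrK D C) opnormD.
by rewrite ler_norml h andbT lerNl opprB opnormB h.
Qed.

Lemma blockseq_dist x k n :
  `|opnorm (blockseq x (k + n)%N) - opnorm (blockseq x n)| <=
  \sum_i \sum_j opnorm (cseq_val (x i j) (k + n)%N - amp k (cseq_val (x i j) n)).
Proof.
rewrite /blockseq -[X in _ - X](opnorm_mxblock_amp k) (le_trans (opnorm_dist _ _))//.
by rewrite -mxblockB opnorm_mxblock_le.
Qed.

Lemma blockseq_cvg x : cvgn (fun n => opnorm (blockseq x n)).
Proof.
apply/cauchy_cvgP/cauchy_exP => e e0.
pose d := e / (m * m).+1%:R.
have d0 : 0 < d by rewrite divr_gt0.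
have : \forall n \near \oo, forall p : 'I_m * 'I_m, forall k,
    opnorm (cseq_val (x p.1 p.2) (k + n)%N - amp k (cseq_val (x p.1 p.2) n)) <= d.
  by apply: filter_forall => -[i j]; have /asboolP/(_ _ d0) := valP (x i j).
case=> N _ /(_ N (leqnn N)) NP.
exists (opnorm (blockseq x N)); exists N => // n /= Nn.
rewrite /ball/= distrC -(subnK Nn) (le_lt_trans (blockseq_dist _ _ _))//.
apply: (@le_lt_trans _ _ (\sum_(i < m) \sum_(j < m) d)).
  by apply: ler_sum => i _; apply: ler_sum => j _; exact: (NP (i, j)).
rewrite !sumr_const !card_ord -mulrnA -mulr_natr /d -mulrA gtr_pMr// mulrC.
by rewrite ltr_pdivrMr// mul1r ltr_nat.
Qed.

Lemma blockseq_limB0 x y : (forall i j, x i j - y i j \in @null_cseq R) ->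
  opnorm (blockseq x n) - opnorm (blockseq y n) @[n --> \oo] --> (0 : R).
Proof.
move=> xy; apply/norm_cvg0P.
apply: (@squeeze_cvgr _ _ _ _ (fun=> 0)
  (fun n => \sum_i \sum_j opnorm (cseq_val (x i j - y i j) n))).
- apply: nearW => n; rewrite normr_ge0/= (le_trans (opnorm_dist _ _))//.
  by rewrite -mxblockB opnorm_mxblock_le.
- exact: cvg_cst.
- rewrite [X in _ --> X](_ : _ = \sum_(i < m) \sum_(j < m) 0); last first.
    by rewrite big1// => i _; rewrite big1.
  apply: cvg_big => [|i _]; first exact: add_continuous.
  apply: cvg_big => [|j _]; first exact: add_continuous.
  by have /asboolP := xy i j.
Qed.

Lemma mxcar_norm_pi x :
  mxcar_norm (\matrix_(i, j) \pi_(car R) (x i j)) = limn (fun n => opnorm (blockseq x n)).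
Proof.
pose y i j := repr ((\matrix_(i, j) \pi_(car R) (x i j)) i j).
have yx i j : y i j - x i j \in @null_cseq R by apply/pi_eqE; rewrite /y reprK mxE.
apply/eqP; rewrite -subr_eq0 /mxcar_norm -[X in X - _]/(limn (fun n => opnorm (blockseq y n))).
by rewrite -limB ?(cvg_lim _ (blockseq_limB0 yx))//; exact: blockseq_cvg.
Qed.

Lemma mxcar_norm_cvg x :
  opnorm (blockseq x n) @[n --> \oo] -->
    mxcar_norm (\matrix_(i, j) \pi_(car R) (x i j)).
Proof. by rewrite mxcar_norm_pi; exact: blockseq_cvg. Qed.

Lemma matrix_piP (X : 'M[car R]_m) :
  exists x : 'I_m -> 'I_m -> cseq R, X = \matrix_(i, j) \pi_(car R) (x i j).
Proof. by exists (fun i j => repr (X i j)); apply/matrixP => i j; rewrite mxE reprK. Qed.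

Lemma pi_sum (I : finType) (F : I -> cseq R) :
  \pi_(car R) (\sum_i F i) = \sum_i \pi_(car R) (F i).
Proof. by apply: big_morph => [u v|]; rewrite ?pi_add ?pi_zero. Qed.

Lemma cseq_val_sum (I : finType) (F : I -> cseq R) n :
  cseq_val (\sum_i F i) n = \sum_i cseq_val (F i) n.
Proof. by apply: (big_morph (fun u : cseq R => cseq_val u n)). Qed.

Lemma mxcar_norm_ge0 X : 0 <= mxcar_norm X.
Proof.
by apply: limr_ge; [exact: blockseq_cvg|apply: nearW => n; exact: opnorm_ge0].
Qed.

Lemma mxcar_norm_eq0 X : mxcar_norm X = 0 -> X = 0.
Proof.
have [x ->] := matrix_piP X => X0; apply/matrixP => i j; rewrite !mxE -pi_zero.
apply/pi_eqE; rewrite subr0; apply/asboolP.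
apply: (@squeeze_cvgr _ _ _ _ (fun=> 0) (fun n => opnorm (blockseq x n))).
- apply: nearW => n; rewrite opnorm_ge0/=.
  exact: (opnorm_mxblock_ge (fun i j => cseq_val (x i j) n)).
- exact: cvg_cst.
- by rewrite -[X in _ --> X]X0; exact: mxcar_norm_cvg.
Qed.

Lemma mxcar_normD X Y : mxcar_norm (X + Y) <= mxcar_norm X + mxcar_norm Y.
Proof.
have [x ->] := matrix_piP X; have [y ->] := matrix_piP Y.
have -> : \matrix_(i, j) \pi_(car R) (x i j) + \matrix_(i, j) \pi_(car R) (y i j) =
    \matrix_(i, j) \pi_(car R) (x i j + y i j).
  by apply/matrixP => i j; rewrite !mxE pi_add.
rewrite !mxcar_norm_pi -limD; [|exact: blockseq_cvg..].
apply: ler_lim; [exact: blockseq_cvg|by apply: is_cvgD; exact: blockseq_cvg|].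
by apply: nearW => n; rewrite /blockseq (le_trans _ (opnormD _ _))// -mxblockD.
Qed.

Lemma mxcar_normZ (c : R[i]) X :
  mxcar_norm (map_mx ( *:%R c) X) = normc c * mxcar_norm X.
Proof.
have [x ->] := matrix_piP X.
have -> : map_mx ( *:%R c) (\matrix_(i, j) \pi_(car R) (x i j)) =
    \matrix_(i, j) \pi_(car R) (c *: x i j).
  by apply/matrixP => i j; rewrite !mxE -[LHS]/(car_scale c _) pi_scale.
rewrite !mxcar_norm_pi; apply: cvg_lim => //.
rewrite [X in X @ _](_ : _ = fun n => normc c * opnorm (blockseq x n)).
  by apply: cvgMr; exact: blockseq_cvg.
apply/funext => n; rewrite -opnormZ; congr opnorm.
by apply/matrixP => a b; rewrite !mxE.
Qed.

Lemma mxcar_normM X Y : mxcar_norm (X *m Y) <= mxcar_norm X * mxcar_norm Y.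
Proof.
have [x ->] := matrix_piP X; have [y ->] := matrix_piP Y.
have -> : \matrix_(i, j) \pi_(car R) (x i j) *m \matrix_(i, j) \pi_(car R) (y i j) =
    \matrix_(i, j) \pi_(car R) (\sum_k x i k * y k j).
  apply/matrixP => i j; rewrite !mxE pi_sum; apply: eq_bigr => k _.
  by rewrite !mxE -[LHS]/(car_mul _ _) pi_mul.
rewrite !mxcar_norm_pi -limM; [|exact: blockseq_cvg..].
apply: ler_lim; [exact: blockseq_cvg|by apply: is_cvgM; exact: blockseq_cvg|].
apply: nearW => n; rewrite /blockseq (le_trans _ (opnormM _ _))// mul_mxblock.
rewrite le_eqVlt; apply/orP; left; apply/eqP; congr opnorm.
by apply: eq_mxblock => i j; rewrite cseq_val_sum.
Qed.

Lemma mxcar_norm_Cstar X : mxcar_norm (mxcar_star X *m X) = mxcar_norm X ^+ 2.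
Proof.
have [x ->] := matrix_piP X.
have -> : mxcar_star (\matrix_(i, j) \pi_(car R) (x i j)) *m
    \matrix_(i, j) \pi_(car R) (x i j) =
    \matrix_(i, j) \pi_(car R) (\sum_k cstar (x k i) * x k j).
  apply/matrixP => i j; rewrite !mxE pi_sum; apply: eq_bigr => k _.
  by rewrite !mxE car_star_pi -[LHS]/(car_mul _ _) pi_mul.
rewrite !mxcar_norm_pi expr2; apply: cvg_lim => //.
rewrite [X in X @ _](_ : _ = fun n => opnorm (blockseq x n) * opnorm (blockseq x n)).
  by apply: cvgM; exact: blockseq_cvg.
apply/funext => n; rewrite -expr2 -opnorm_Cstar.
congr opnorm; rewrite /blockseq [in RHS]/ctrmx tr_mxblock.
have -> : map_mx (@conjc R) (\mxblock_(i, j) (cseq_val (x j i) n)^T) =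
    \mxblock_(i, j) ctrmx (cseq_val (x j i) n).
  by apply/matrixP => i j; rewrite !mxE.
by rewrite mul_mxblock; apply: eq_mxblock => i j; rewrite cseq_val_sum.
Qed.

End MatrixAlgebra.

(* Intended for a unital C*-algebra B with involution star and C*-norm nrm. *)
Section UnitaryOrbits.
Variables (R : realType) (B : pzRingType) (star : B -> B) (nrm : B -> R).

Definition unitary : set B := [set u | star u * u = 1 /\ u * star u = 1].

Definition unitary_orbit (x : B) : set B := [set star u * x * u | u in unitary].

Definition unitary_orbit_dist (x y : B) : R :=
  inf [set nrm (x' - y') | x' in unitary_orbit x & y' in unitary_orbit y].

End UnitaryOrbits.

Definition mxcar_orbit_dist (R : realType) m (X Y : 'M[car R]_m) : R :=
  unitary_orbit_dist (@mxcar_star R m) (@mxcar_norm R m) X Y.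

(* a^(m) = 1_(M_m) (x) a is the scalar matrix a%:M. *)
Definition amplification (R : realType) m (a : car R) : 'M[car R]_m := a%:M.

(* Main.v *)
(* In M_3 let n = e21 + e32.  The path t |-> g(t) = h(t) + w(t) n, 0 <= t <= 3,
runs from the scalar 0 to the scalar 1; on [1, 2] the weight w is 1 while h climbs
from 0 to 1.  Take a to be the limit of the block sums a_n in M_(2^n) of the g(t),
t on a grid of [0, 3] with about 2^n / 3 points, completed by 2^n mod 3 scalars 0;
for b, complete by scalars 1 instead.  Three copies of a scalar 0 (resp. 1) make
one block g(0) (resp. g(3)), so a_n (+) a_n is close to a_(n+1), and tripled, both
a_n and b_n become nearly the same grid of blocks: this gives (2).

For (1), there are polynomials N and H in x and x^* which, on a block sum x, give
N = w^3 n and a matrix H with H P = P and Q H = H, where P (resp. Q) projects onto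
the blocks with h = 1 (resp. h > 0).  If x is a block sum of the first kind and y is
close to x and unitarily conjugate to one of the second kind, then P_x is almost
below Q_y, and N provides almost matrix units of M_3 with unit Q_y - P_x, so that
rank Q_y = rank P_x mod 3.  But modulo 3 these ranks are 2^n and 0.  Hence a_n and
b_n stay uniformly far, and doubling changes nothing because x (+) x is again x in
M_(2^oo). *)
Require Import Defs.
From mathcomp Require Import all_boot all_order all_algebra.
From mathcomp Require Import all_classical all_reals.
From mathcomp Require Import interval_inference topology normedtype sequences.
From mathcomp Require Import complex sesquilinear spectral.
From mathcomp Require Import zify ring lra.

Set Implicit Arguments.
Unset Strict Implicit.
Unset Printing Implicit Defensive.

Import Order.TTheory GRing.Theory Num.Theory.
Import numFieldNormedType.Exports.
Import Normc.

Local Open Scope classical_set_scope.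
Local Open Scope ring_scope.

Local Notation "A ^H" := (ctrmx A) (at level 8, format "A ^H").

(** * Isometries and spectral calculus *)

Section Isometries.
Variable R : realType.

(** The obstacle in (1) is that P and Q jump when a parameter t crosses 2 or 1, and that block sums
    are not normal: neither projection is a continuous function of the matrix. Between two nearby
    matrices only polynomials in x and x^* are compared. They are Lipschitz on a ball, with
    constants independent of the matrix size, so that one bound serves all n. The projections enter
    through exact identities with H, and P is taken from one matrix, Q from the other: where H is 1
    for the first, H of the second cannot vanish, which gives an approximate inclusion. The weight
    is 1 while 0 < h < 1, so that N yields true matrix units between P and Q; it falls to 0 at the
    ends of the path so that triples of filler scalars are themselves blocks. *)

Definition isometry m n (W : 'M[R[i]]_(m, n)) := W^H *m W = 1%:M.

Definition coisometry m n (W : 'M[R[i]]_(m, n)) := W *m W^H = 1%:M.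

Definition projection n (P : 'M[R[i]]_n) := P^H = P /\ P *m P = P.

Lemma ctrmx0 m n : (0 : 'M[R[i]]_(m, n))^H = 0.
Proof. by apply/matrixP => i j; rewrite !mxE rmorph0. Qed.

Lemma ctrmx1 n : (1%:M : 'M[R[i]]_n)^H = 1%:M.
Proof. by rewrite /ctrmx trmx1 map_mx1. Qed.

Lemma ctrmxZr m n (c : R) (A : 'M[R[i]]_(m, n)) : (c%:C%C *: A)^H = c%:C%C *: A^H.
Proof. by apply/matrixP => i j; rewrite !mxE rmorphM /= oppr0. Qed.

Lemma ctrmx_scalar n (c : R) : (c%:C%C%:M : 'M[R[i]]_n)^H = c%:C%C%:M.
Proof. by rewrite -scalemx1 ctrmxZr ctrmx1. Qed.

Lemma ctrmx_block m n p q (A : 'M[R[i]]_(m, p)) (B : 'M[R[i]]_(m, q))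
    (C : 'M[R[i]]_(n, p)) (D : 'M[R[i]]_(n, q)) :
  (block_mx A B C D)^H = block_mx A^H C^H B^H D^H.
Proof. by rewrite /ctrmx tr_block_mx map_block_mx. Qed.

Lemma enorm_isometry m n (W : 'M[R[i]]_(m, n)) v : isometry W -> enorm (W *m v) = enorm v.
Proof.
move=> W1; apply/eqP; rewrite -(@eqrXn2 _ 2%N)// ?enorm_ge0//; apply/eqP.
have /(congr1 (@complex.Re R)) := innervv (W *m v).
by rewrite ctrmxM -mulmxA (mulmxA _ W) W1 mul1mx innervv.
Qed.

(** Cauchy-Schwarz: [|W^H v|^2 = <v, W W^H v> <= |v| |W W^H v| = |v| |W^H v|]. *)
Lemma enorm_ctrmx_isometry m n (W : 'M[R[i]]_(m, n)) v :
  isometry W -> enorm (W^H *m v) <= enorm v.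
Proof.
move=> W1; have [->|vN0] := eqVneq (enorm (W^H *m v)) 0; first exact: enorm_ge0.
have v_gt0 : 0 < enorm (W^H *m v) by rewrite lt_neqAle eq_sym vN0 enorm_ge0.
rewrite -(ler_pM2r v_gt0) -expr2 -(enorm_isometry (W^H *m v) W1).
apply: le_trans (normc_inner_le _ _).
have -> : v^H *m (W *m (W^H *m v)) = (W^H *m v)^H *m (W^H *m v).
  by rewrite ctrmxM ctrmxK !mulmxA.
by rewrite innervv normc_real ger0_norm ?sqr_ge0// enorm_isometry.
Qed.

Lemma opnorm_conj_le m n (W : 'M[R[i]]_(m, n)) X :
  isometry W -> opnorm (W^H *m X *m W) <= opnorm X.
Proof.
move=> W1; apply: opnorm_le => [|v]; first exact: opnorm_ge0.
rewrite -!mulmxA (le_trans (enorm_ctrmx_isometry _ W1))//.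
by rewrite (le_trans (enorm_mulmx_le _ _))// enorm_isometry.
Qed.

Lemma opnorm_conj m n (W : 'M[R[i]]_(m, n)) X : isometry W -> coisometry W ->
  opnorm (W^H *m X *m W) = opnorm X.
Proof.
move=> W1 W2; apply/eqP; rewrite eq_le opnorm_conj_le//=.
have W1' : isometry W^H by rewrite /isometry ctrmxK.
have := opnorm_conj_le (W^H *m X *m W) W1'.
by rewrite ctrmxK !mulmxA W2 mul1mx -mulmxA W2 mulmx1.
Qed.

Lemma opnorm_unitary n (W : 'M[R[i]]_n) : isometry W -> opnorm W <= 1.
Proof.
move=> W1; apply: opnorm_le => // v.
by rewrite enorm_isometry// mul1r.
Qed.

Lemma opnorm_projection n (P : 'M[R[i]]_n) : projection P -> opnorm P <= 1.
Proof.
move=> [PH PP]; have [->|P0] := eqVneq (opnorm P) 0; first exact: ler01.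
have P_gt0 : 0 < opnorm P by rewrite lt_neqAle eq_sym P0 opnorm_ge0.
by rewrite -(ler_pM2r P_gt0) mul1r -expr2 -opnorm_Cstar PH PP.
Qed.

Lemma projection1B n (P : 'M[R[i]]_n) : projection P -> projection (1%:M - P).
Proof.
move=> [PH PP]; split; first by rewrite ctrmxB ctrmx1 PH.
by rewrite mulmxBl mul1mx mulmxBr mulmx1 PP subrr subr0.
Qed.

Lemma opnorm_block_diag m n (A : 'M[R[i]]_m) (B : 'M[R[i]]_n) c : 0 <= c ->
  opnorm A <= c -> opnorm B <= c -> opnorm (block_mx A 0 0 B) <= c.
Proof.
move=> c0 Ac Bc; apply: opnorm_le => // v.
rewrite -[v]vsubmxK mul_block_col !mul0mx addr0 add0r.
rewrite -(@ler_pXn2r _ 2)// ?nnegrE ?mulr_ge0 ?enorm_ge0//.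
rewrite exprMn !enorm_col_mx mulrDr -!exprMn.
by rewrite lerD// ler_pXn2r ?nnegrE ?mulr_ge0 ?enorm_ge0//
  (le_trans (enorm_mulmx_le _ _))// ler_wpM2r ?enorm_ge0.
Qed.

Lemma opnorm_scalar_le n (c : R[i]) : opnorm (c%:M : 'M[R[i]]_n) <= normc c.
Proof.
rewrite -scalemx1 opnormZ ler_piMr// ?normc_ge0//.
exact: opnorm1_le.
Qed.

End Isometries.

Section Spectral.
Variable R : realType.
Implicit Types n : nat.

Lemma opnorm_diag_le n (d : 'I_n -> R) c : 0 <= c -> (forall i, `|d i| <= c) ->
  opnorm (diag_mx (\row_i (d i)%:C%C)) <= c.
Proof.
move=> c0 dc; apply: opnorm_le => // v.
rewrite -(@ler_pXn2r _ 2)// ?nnegrE ?mulr_ge0 ?enorm_ge0// exprMn !sqr_enorm mulr_sumr.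
apply: ler_sum => i _; rewrite mul_diag_mx !mxE normcM exprMn normc_real.
by rewrite ler_wpM2r ?sqr_ge0// ler_pXn2r ?nnegrE.
Qed.

Lemma opnorm_diag_ge n (d : 'I_n -> R) i :
  `|d i| <= opnorm (diag_mx (\row_i (d i)%:C%C)).
Proof.
set D := diag_mx _; have := enorm_mulmx_le D (delta_mx i 0 : 'cV_n).
have enorm_delta : enorm (delta_mx i 0 : 'cV[R[i]]_n) = 1.
  apply/eqP; rewrite -(@eqrXn2 _ 2%N)// ?enorm_ge0// expr1n sqr_enorm (bigD1 i)//=.
  rewrite big1 => [|j ji]; first by rewrite mxE !eqxx normc1 expr1n addr0.
  by rewrite mxE (negPf ji) normc0 expr0n.
have -> : D *m delta_mx i 0 = (d i)%:C%C *: (delta_mx i 0 : 'cV_n).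
  apply/matrixP => j k; rewrite mul_diag_mx !mxE.
  by case: eqVneq => [->|_] //=; rewrite !mulr0.
by rewrite enormZ normc_real enorm_delta !mulr1.
Qed.

Lemma hermitian_diag n (A : 'M[R[i]]_n) : A^H = A ->
  exists U : 'M[R[i]]_n, exists d : 'I_n -> R,
    [/\ isometry U, coisometry U & A = U^H *m diag_mx (\row_i (d i)%:C%C) *m U].
Proof.
move=> AH; have conjE m p (B : 'M[R[i]]_(m, p)) : map_mx Num.conj B^T = B^H by [].
have Ah : A \is hermsymmx.
  by apply/is_hermitianmxP; rewrite expr0 scale1r conjE AH.
have /orthomx_spectralP := hermitian_normalmx Ah.
have UU := spectral_unitarymx A; rewrite invmx_unitary// conjE => AE.
have U2 : coisometry (spectralmx A) by exact/unitarymxP.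
exists (spectralmx A), (fun i => complex.Re (spectral_diag A 0 i)); split.
- exact: mulmx1C U2.
- exact: U2.
rewrite [LHS]AE; congr (_ *m diag_mx _ *m _); apply/rowP => i; rewrite !mxE.
have /mxOverP/(_ 0 i) := hermitian_spectral_diag_real Ah.
by move=> /RRe_real ->.
Qed.


(** For unitary [U] this carries the functional calculus of a hermitian matrix: functions act on the
    eigenvalues [d]. *)
Definition diag_conj n (U : 'M[R[i]]_n) (d : 'I_n -> R) :=
  U^H *m diag_mx (\row_i (d i)%:C%C) *m U.

Lemma diag_conj_herm n U d : (@diag_conj n U d)^H = diag_conj U d.
Proof.
rewrite /diag_conj !ctrmxM ctrmxK mulmxA; congr (_ *m _ *m _).
apply/matrixP => i j; rewrite !mxE eq_sym; case: eqVneq => [->|_].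
  by rewrite !mulr1n conjc_real.
by rewrite !mulr0n conjc0.
Qed.

Lemma diag_conjB n U d e :
  @diag_conj n U d - diag_conj U e = diag_conj U (fun i => d i - e i).
Proof.
rewrite /diag_conj -mulmxBl -mulmxBr -raddfB/=; congr (_ *m diag_mx _ *m _).
by apply/rowP => i; rewrite !mxE rmorphB.
Qed.

Lemma diag_conjM n U d e : coisometry U ->
  @diag_conj n U d *m diag_conj U e = diag_conj U (fun i => d i * e i).
Proof.
move=> U2; rewrite /diag_conj !mulmxA -(mulmxA _ U) U2 mulmx1 -(mulmxA U^H).
congr (_ *m _ *m _); apply/matrixP => i j.
rewrite mul_diag_mx !mxE; case: eqVneq => [->|_]; last by rewrite !mulr0n mulr0.
by rewrite !mulr1n rmorphM.
Qed.

Lemma diag_conj1 n (U : 'M[R[i]]_n) : isometry U -> diag_conj U (fun=> 1) = 1%:M.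
Proof.
rewrite /diag_conj => U1; rewrite (_ : diag_mx _ = 1%:M) ?mulmx1//.
by apply/matrixP => i j; rewrite !mxE.
Qed.

Lemma opnorm_diag_conj_le n (U : 'M[R[i]]_n) d c : isometry U -> 0 <= c ->
  (forall i, `|d i| <= c) -> opnorm (diag_conj U d) <= c.
Proof.
by move=> U1 c0 dc; rewrite (le_trans (opnorm_conj_le _ U1))// opnorm_diag_le.
Qed.

Lemma opnorm_diag_conj_ge n (U : 'M[R[i]]_n) d i : isometry U -> coisometry U ->
  `|d i| <= opnorm (diag_conj U d).
Proof. by move=> U1 U2; rewrite opnorm_conj// opnorm_diag_ge. Qed.

(** Eigenvalues are rounded to 0 or 1 at the threshold 1/2. In [d^2 - d = d (d - 1)] the factor that
    is not the rounding error has absolute value at least 1/2, whence the factor 2. *)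
Lemma projection_near n (A : 'M[R[i]]_n) : A^H = A ->
  exists2 F, projection F & opnorm (F - A) <= opnorm (A *m A - A) *+ 2.
Proof.
move=> /hermitian_diag[U [d [U1 U2 AE]]].
pose e i : R := if d i <= 1 / 2 then 0 else 1.
have {}AE : A = diag_conj U d by exact: AE.
exists (diag_conj U e); first split; first exact: diag_conj_herm.
  rewrite diag_conjM//; congr diag_conj; apply/funext => i.
  by rewrite /e; case: ifP => _; rewrite ?mulr0 ?mulr1.
rewrite AE diag_conjM// !diag_conjB; apply: opnorm_diag_conj_le => [//||i].
  by rewrite mulrn_wge0// opnorm_ge0.
rewrite (le_trans _ (ler_wMn2r 2 (opnorm_diag_conj_ge (fun i => d i * d i - d i) i U1 U2)))//.
have -> : d i * d i - d i = d i * (d i - 1) by ring.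
rewrite normrM /e; case: ifPn => [di|]; last rewrite -ltNge => di.
  rewrite sub0r normrN -mulrnAr ler_peMr// -mulr_natr [in leRHS]ler0_norm; lra.
rewrite distrC -mulrnAl ler_peMl// -mulr_natr [in leRHS]ger0_norm; lra.
Qed.

(** Polar decomposition, [U = W (W^H W)^(-1/2)]: the eigenvalues of [W^H W] are at least 1/2, and
    [|s - 1| <= |s^2 - 1|] for [s >= 0]. *)
Lemma unitary_near n (W : 'M[R[i]]_n) : opnorm (W^H *m W - 1%:M) <= 1 / 2 ->
  exists U, [/\ isometry U, coisometry U &
    opnorm (W - U) <= opnorm (W^H *m W - 1%:M)].
Proof.
move=> WW; have /hermitian_diag[V [d [V1 V2 WE]]] : (W^H *m W)^H = W^H *m W.
  by rewrite ctrmxM ctrmxK.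
have {}WE : W^H *m W = diag_conj V d by exact: WE.
move: WW; rewrite WE -(diag_conj1 V1) diag_conjB => WW.
have dc i : `|d i - 1| <= opnorm (diag_conj V (fun i => d i - 1)).
  exact: (opnorm_diag_conj_ge (fun i => d i - 1)).
have d0 i : 0 < d i by have := le_trans (dc i) WW; rewrite ler_norml; lra.
have s0 i : 0 < Num.sqrt (d i) by rewrite sqrtr_gt0.
pose S := diag_conj V (fun i => (Num.sqrt (d i))^-1).
pose T := diag_conj V (fun i => Num.sqrt (d i)).
have ST : S *m T = 1%:M.
  rewrite diag_conjM// -(diag_conj1 V1); congr diag_conj; apply/funext => i.
  by rewrite mulVf// gt_eqF.
have U1 : isometry (W *m S).
  rewrite /isometry ctrmxM diag_conj_herm mulmxA -(mulmxA S) WE !diag_conjM//.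
  rewrite -(diag_conj1 V1); congr diag_conj; apply/funext => i.
  rewrite -{2}(@sqr_sqrtr _ (d i)) ?ltW// expr2.
  by field; rewrite gt_eqF.
exists (W *m S); split => //; first exact: mulmx1C.
have -> : W - W *m S = W *m S *m (T - 1%:M).
  by rewrite mulmxBr mulmx1 -(mulmxA W S T) ST mulmx1.
rewrite (le_trans (opnormM _ _))// (le_trans (ler_wpM2r (opnorm_ge0 _) (opnorm_unitary U1)))//.
rewrite mul1r -(diag_conj1 V1) diag_conjB; apply: opnorm_diag_conj_le => [//||i].
  exact: opnorm_ge0.
apply: le_trans (dc i); have -> : d i - 1 = (Num.sqrt (d i) - 1) * (Num.sqrt (d i) + 1).
  by rewrite -{1}(@sqr_sqrtr _ (d i)) ?ltW//; ring.
have := s0 i; move: (Num.sqrt (d i)) => s s_gt0.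
by rewrite normrM ler_peMr// ger0_norm; lra.
Qed.

End Spectral.

(** * A rank congruence modulo 3 *)

Section Ranks.
Variable R : realType.

(** A vector [v] in the range of [B] and killed by [A] satisfies [(A - B) v = - v], hence is 0; so
    [A] is injective on that range. *)
Lemma mxrank_near n (A B : 'M[R[i]]_n) : B *m B = B -> opnorm (A - B) < 1 ->
  (\rank B <= \rank A)%N.
Proof.
move=> BB AB; suff AE : \rank (A *m B) = \rank B by rewrite -AE mxrankM_maxl.
(* [mxrank_injP] speaks of row spaces and [enorm] of columns, hence the transposes. *)
rewrite -mxrank_tr trmx_mul -[RHS]mxrank_tr.
apply/mxrank_injP; apply/rowV0P => v; rewrite sub_capmx => /andP[/submxP[w vE] /sub_kermxP vA].
have {}vA : A *m v^T = 0 by rewrite -[A]trmxK -trmx_mul vA trmx0.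
have vB : B *m v^T = v^T by rewrite vE trmx_mul trmxK mulmxA BB.
suff v0 : enorm v^T = 0 by rewrite -[v]trmxK (enorm_eq0 v0) trmx0.
have := enorm_mulmx_le (A - B) v^T; rewrite mulmxBl vA vB sub0r -scaleN1r enormZ.
rewrite normcN normc1 mul1r; apply: contraTeq => v0.
by rewrite -ltNge gtr_pMl// lt_neqAle eq_sym v0 enorm_ge0.
Qed.

End Ranks.

Section Approximation.
Variables (R : realType) (eps : R) (n : nat).
Implicit Types (A B C : 'M[R[i]]_n) (k l : nat).

(** Errors are counted as a natural number of [eps], so that long chains of approximations only add
    numerals, which conversion settles. *)
Definition near_mx k A B := opnorm (A - B) <= k%:R * eps.

Lemma near_mx_eq A B : A = B -> near_mx 0 A B.
Proof. by move=> ->; rewrite /near_mx subrr opnorm0 mul0r. Qed.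

Lemma near_mx_sym k A B : near_mx k A B -> near_mx k B A.
Proof. by rewrite /near_mx opnormB. Qed.

Lemma near_mx_trans k l B A C : near_mx k A B -> near_mx l B C -> near_mx (k + l) A C.
Proof.
rewrite /near_mx => AB BC; rewrite natrD mulrDl -(subrK B A) -addrA.
by rewrite (le_trans (opnormD _ _))// lerD.
Qed.

Lemma near_mxD k l A A' B B' : near_mx k A A' -> near_mx l B B' ->
  near_mx (k + l) (A + B) (A' + B').
Proof.
rewrite /near_mx => AA BB; rewrite natrD mulrDl opprD addrACA.
by rewrite (le_trans (opnormD _ _))// lerD.
Qed.

Lemma near_mx_ctr k A B : near_mx k A B -> near_mx k A^H B^H.
Proof. by rewrite /near_mx -ctrmxB opnorm_ctrmx. Qed.

Lemma near_mxMl k A B C : opnorm C <= 1 -> near_mx k A B -> near_mx k (C *m A) (C *m B).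
Proof.
rewrite /near_mx => C1 AB; rewrite -mulmxBr (le_trans (opnormM _ _))//.
by apply: le_trans AB; rewrite ler_piMl// opnorm_ge0.
Qed.

Lemma near_mxMr k A B C : opnorm C <= 1 -> near_mx k A B -> near_mx k (A *m C) (B *m C).
Proof.
rewrite /near_mx => C1 AB; rewrite -mulmxBl (le_trans (opnormM _ _))//.
by apply: le_trans AB; rewrite ler_piMr// opnorm_ge0.
Qed.

Lemma opnormM_le1 A B : opnorm A <= 1 -> opnorm B <= 1 -> opnorm (A *m B) <= 1.
Proof.
by move=> A1 B1; rewrite (le_trans (opnormM _ _))// -[leRHS]mulr1 ler_pM ?opnorm_ge0.
Qed.

Definition comm_near k A B := near_mx k (A *m B) (B *m A).

Lemma comm_nearM k l A B C : opnorm A <= 1 -> opnorm B <= 1 ->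
  comm_near k A C -> comm_near l B C -> comm_near (k + l) (A *m B) C.
Proof.
move=> A1 B1 AC BC; rewrite /comm_near addnC; apply: (@near_mx_trans _ _ (A *m C *m B)).
  by rewrite -!mulmxA; exact: near_mxMl.
by rewrite [C *m (A *m B)]mulmxA; exact: near_mxMr.
Qed.

Hypothesis eps0 : 0 <= eps.

Lemma near_mxW k l A B : (k <= l)%N -> near_mx k A B -> near_mx l A B.
Proof. by move=> kl /le_trans; apply; rewrite ler_wpM2r// ler_nat. Qed.

End Approximation.

Lemma ord4P (C : nat -> Prop) : C 0%N -> C 1%N -> C 2%N -> C 3%N -> forall i : 'I_4, C i.
Proof. by move=> C0 C1 C2 C3 [[|[|[|[|//]]]] i4]. Qed.

(** Sixteen blocks with error 552 each give 8832, at most 10^4: the origin of the constant in [eps1]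
    below. *)
Lemma gram_error_le (R : realType) (x : R) : 0 <= x ->
  552%:R * x * (4 * 4)%:R <= 100 * (100 * x).
Proof. by move=> x0; rewrite natrM; lra. Qed.

Section TripleRank.
Variables (R : realType) (eps : R) (n : nat) (P Q N : 'M[R[i]]_n).
Local Notation near := (near_mx eps).
Local Notation comm := (comm_near eps).
Variables e D : 'M[R[i]]_n.
(** In the application [P], [N], [e] come from one matrix and [Q] from another: relations within the
    first are exact, those involving [Q] approximate. [D] replaces [Q - P], being visibly a
    contraction. Equations rather than definitions keep [e] and [D] folded. *)
Hypotheses (eE : e = N^H *m N^H *m N *m N) (DdE : D = Q *m (1%:M - P)).
Hypotheses (eps0 : 0 <= eps) (eps1 : 100 * (100 * eps) < 1).
Hypotheses (projP : projection P) (projQ : projection Q) (N1 : opnorm N <= 1).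
Hypotheses (QP : near 1 (Q *m P) P) (NP : N *m P = P *m N) (NQ : near 2 (N *m Q) (Q *m N)).
Hypotheses (N3 : N *m N *m N = 0) (N23 : e *m N^H *m N *m N *m e = 0).
Hypothesis ee : near 2 (e *m e *m (Q - P)) (e *m (Q - P)).
Hypothesis eNNe : near 2 (e *m N^H *m N *m e *m (Q - P)) (e *m (Q - P)).
Hypothesis sum_e :
  near 2 ((e + N *m e *m N^H + N *m N *m e *m N^H *m N^H) *m (Q - P)) (Q - P).

Let P1 : opnorm P <= 1. Proof. exact: opnorm_projection. Qed.
Let Q1 : opnorm Q <= 1. Proof. exact: opnorm_projection. Qed.
Let P'1 : opnorm (1%:M - P) <= 1. Proof. exact/opnorm_projection/projection1B. Qed.
Let NH1 : opnorm N^H <= 1. Proof. by rewrite opnorm_ctrmx. Qed.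
Let D1 : opnorm D <= 1. Proof. by rewrite DdE opnormM_le1. Qed.
Let e1 : opnorm e <= 1.
Proof. by rewrite eE; exact: (opnormM_le1 (opnormM_le1 (opnormM_le1 NH1 NH1) N1) N1). Qed.

Let PQ : near 1 (P *m Q) P.
Proof.
by have := near_mx_ctr QP; rewrite ctrmxM projP.1 projQ.1.
Qed.

Let DE : near 1 D (Q - P).
Proof.
by rewrite /near_mx DdE mulmxBr mulmx1 opprB addrC addrA subrK opnormB; exact: QP.
Qed.

Let DH : near 2 D^H D.
Proof.
apply: (near_mx_trans (k := 1) (l := 1) _ (near_mx_sym DE)).
have := near_mx_ctr DE; rewrite ctrmxB projP.1 projQ.1.
by [].
Qed.

Let DD : near 1 (D *m D) D.
Proof.
have : near 1 (Q *m (P *m Q) *m (1%:M - P)) (Q *m P *m (1%:M - P)).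
  by apply: near_mxMr => //; apply: near_mxMl.
have [_ PP] := projP; have [_ QQ] := projQ.
rewrite /near_mx DdE -[X in _ - X]mulmxA [P *m (1%:M - P)]mulmxBr mulmx1 PP subrr mulmx0 subr0.
suff -> : Q *m (1%:M - P) *m (Q *m (1%:M - P)) - Q *m (1%:M - P) =
    - (Q *m (P *m Q) *m (1%:M - P)) by rewrite opnormN.
rewrite !mulmxA -mulmxBl -[RHS]mulNmx; congr (_ *m _).
by rewrite mulmxBr mulmx1 mulmxBl QQ addrAC subrr sub0r.
Qed.

Let NPH : N^H *m P = P *m N^H.
Proof. by rewrite -{1}projP.1 -ctrmxM -NP ctrmxM projP.1. Qed.

Let NQH : near 2 (N^H *m Q) (Q *m N^H).
Proof.
have := near_mx_sym (near_mx_ctr NQ).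
by rewrite !ctrmxM projQ.1.
Qed.

Let ND : comm 2 N D.
Proof.
rewrite /comm_near DdE mulmxA.
have -> : Q *m (1%:M - P) *m N = Q *m N *m (1%:M - P).
  by rewrite -!mulmxA; congr (_ *m _); rewrite mulmxBl mulmxBr mul1mx mulmx1 NP.
exact: near_mxMr.
Qed.

Let NDH : comm 2 N^H D.
Proof.
rewrite /comm_near DdE mulmxA.
have -> : Q *m (1%:M - P) *m N^H = Q *m N^H *m (1%:M - P).
  by rewrite -!mulmxA; congr (_ *m _); rewrite mulmxBl mulmxBr mul1mx mulmx1 NPH.
exact: near_mxMr.
Qed.

Let comm_e X : comm 2 N X -> comm 2 N^H X -> comm 8 e X.
Proof.
move=> NX NHX; have N2 : opnorm (N^H *m N^H) <= 1 by exact: opnormM_le1.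
have N3' : opnorm (N^H *m N^H *m N) <= 1 by exact: opnormM_le1.
rewrite eE; exact: (comm_nearM N3' N1 (comm_nearM N2 N1 (comm_nearM NH1 NH1 NHX NHX) NX) NX).
Qed.

Let eD : comm 8 e D. Proof. exact: comm_e. Qed.

Let eQ : comm 8 e Q. Proof. exact: comm_e. Qed.

Let eP : e *m P = P *m e.
Proof. by rewrite eE; apply/esym; do 3![apply: comm_mxM => //]; apply/esym. Qed.

(** The hypotheses concern [Q - P]; passing to [D] costs one [eps] per unit of the bound on
    [A - B]. *)
Let near_D c (A B : 'M[R[i]]_n) : opnorm (A - B) <= c%:R -> near 2 (A *m (Q - P)) (B *m (Q - P)) ->
  near (2 + c) (A *m D) (B *m D).
Proof.
rewrite /near_mx (natrD _ 2 c) [(_ + c%:R) * _]mulrDl -!mulmxBl => AB h.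
rewrite -[in X in opnorm X <= _](subrK (Q - P) D) [D - _ + _]addrC mulmxDr.
rewrite (le_trans (opnormD _ _))// lerD// (le_trans (opnormM _ _))//.
by rewrite ler_pM ?opnorm_ge0//; have := DE; rewrite /near_mx mul1r.
Qed.

Let opnormB2 (A B : 'M[R[i]]_n) : opnorm A <= 1 -> opnorm B <= 1 -> opnorm (A - B) <= 2%:R.
Proof.
move=> A1 B1; rewrite (_ : 2%:R = 1 + 1)//.
by rewrite (le_trans (opnormD _ _))// opnormN lerD.
Qed.

Let eeD : near 4 (e *m e *m D) (e *m D).
Proof. exact/(near_D (opnormB2 (opnormM_le1 e1 e1) e1)). Qed.

Let eNNeD : near 4 (e *m N^H *m N *m e *m D) (e *m D).
Proof.
exact/(near_D (opnormB2 (opnormM_le1 (opnormM_le1 (opnormM_le1 e1 NH1) N1) e1) e1)).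
Qed.

Let sum_eD : near 6 ((e + N *m e *m N^H + N *m N *m e *m N^H *m N^H) *m D) D.
Proof.
rewrite -[X in near _ _ X]mul1mx; apply: (@near_D 4); last by rewrite mul1mx.
have n4 : (4%:R : R) = 1 + 1 + 1 + 1 by ring.
rewrite n4 (le_trans (opnormD _ _))// lerD ?opnormN ?opnorm1_le//.
have Ne := opnormM_le1 N1 e1; have NNe := opnormM_le1 (opnormM_le1 N1 N1) e1.
rewrite (le_trans (opnormD _ _))// lerD//; last first.
  exact: (opnormM_le1 (opnormM_le1 NNe NH1) NH1).
by rewrite (le_trans (opnormD _ _))// lerD//; exact: opnormM_le1.
Qed.

Let eD1 : opnorm (e *m D) <= 1. Proof. exact: opnormM_le1. Qed.

(* F is a spectral projection of D^H e D, which is almost idempotent. *)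
Let projF : exists2 F, projection F & near 103 F (e *m D).
Proof.
(* [e *m D] is hermitian only up to an error, while rounding the spectrum requires exact symmetry;
   [T] has it. *)
have [T TdE] : exists T, T = D^H *m e *m D by exists (D^H *m e *m D).
have DH1 : opnorm D^H <= 1 by rewrite opnorm_ctrmx.
have T1 : opnorm T <= 1 by rewrite TdE; exact: (opnormM_le1 (opnormM_le1 DH1 e1) D1).
have TE : near 11 T (e *m D).
  rewrite TdE; apply: (near_mx_trans (k := 2) (l := 9) (near_mxMr D1 (near_mxMr e1 DH))).
  apply: (near_mx_trans (k := 8) (l := 1) (near_mxMr D1 (near_mx_sym eD))).
  by rewrite -mulmxA; exact: near_mxMl.
have TH : T^H = T by rewrite TdE eE !ctrmxM !ctrmxK !mulmxA.
have TT : near 46 (T *m T) T.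
  apply: (near_mx_trans (k := 11) (l := 35) (near_mxMr T1 TE)).
  apply: (near_mx_trans (k := 11) (l := 24) (near_mxMl eD1 TE)).
  have -> : e *m D *m (e *m D) = e *m (D *m e) *m D by rewrite !mulmxA.
  apply: (near_mx_trans (k := 8) (l := 16) (near_mxMr D1 (near_mxMl e1 (near_mx_sym eD)))).
  have -> : e *m (e *m D) *m D = e *m e *m (D *m D) by rewrite !mulmxA.
  apply: (near_mx_trans (k := 1) (l := 15) (near_mxMl (opnormM_le1 e1 e1) DD)).
  exact: (near_mx_trans (k := 4) (l := 11) eeD (near_mx_sym TE)).
have [F pF FT] := projection_near TH; exists F => //.
(* Rounding doubles the idempotency error 46; the 11 of [TE] brings the total to 103. *)
apply: (near_mx_trans (k := 92) (l := 11) _ TE); apply: (le_trans FT).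
by rewrite -[92%N]/(46 * 2)%N natrM mulrAC -[leLHS]mulr_natr ler_wpM2r.
Qed.

Section Projection.
Variable F : 'M[R[i]]_n.
Hypotheses (pF : projection F) (FeD : near 103 F (e *m D)).

Let F1 : opnorm F <= 1. Proof. exact: opnorm_projection. Qed.

Let eDF := near_mx_sym FeD.

Let De1 : opnorm (D *m e) <= 1. Proof. exact: opnormM_le1. Qed.

Let FDe : near 111 F (D *m e).
Proof. exact: (near_mx_trans FeD eD). Qed.

(** [F] is close to [D *m e], and [e *m N = 0] because [e] ends in [N *m N] and the cube of [N] is
    0. *)
Let FN : near 111 (F *m N) 0.
Proof.
have e0 : e *m N = 0 by rewrite eE -!mulmxA (mulmxA N N N) N3 !mulmx0.
by have := near_mxMr N1 FDe; rewrite -mulmxA e0 mulmx0.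
Qed.

Let PF : near 104 (P *m F) 0.
Proof.
apply: (near_mx_trans (k := 103) (l := 1) (near_mxMl P1 FeD)).
have [_ PP] := projP; have PD : near 1 (P *m D) 0.
  have := near_mxMr P'1 PQ; rewrite -mulmxA -DdE.
  by rewrite [P *m (1%:M - P)]mulmxBr mulmx1 PP subrr.
by have := near_mxMl e1 PD; rewrite mulmxA eP mulmxA mulmx0.
Qed.

Let QF : near 214 (Q *m F) F.
Proof.
apply: (near_mx_trans (k := 103) (l := 111) (near_mxMl Q1 FeD)); rewrite mulmxA.
have [_ QQ] := projQ.
apply: (near_mx_trans (k := 8) (l := 103) (near_mxMr D1 (near_mx_sym eQ))).
by rewrite -mulmxA {1}DdE (mulmxA Q Q) QQ -DdE.
Qed.

Let QNF : near 216 (Q *m (N *m F)) (N *m F).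
Proof.
rewrite mulmxA; apply: (near_mx_trans (k := 2) (near_mxMr F1 (near_mx_sym NQ))).
by rewrite -mulmxA; exact: near_mxMl.
Qed.

Let QNNF : near 218 (Q *m (N *m N *m F)) (N *m N *m F).
Proof.
rewrite -(mulmxA N N) mulmxA.
apply: (near_mx_trans (k := 2) (near_mxMr (opnormM_le1 N1 F1) (near_mx_sym NQ))).
by rewrite -mulmxA; exact: near_mxMl.
Qed.

(** With [FeF] and [FNNNF] below: [N] and [N *m N] are almost isometric on the range of [F], with
    almost orthogonal images. In the model case [e], [N e], [N N e] are the matrix units of the
    first column. *)
Let FNNF : near 330 (F *m N^H *m (N *m F)) F.
Proof.
have NF1 := opnormM_le1 NH1 (opnormM_le1 N1 F1).
rewrite -mulmxA; apply: (near_mx_trans (k := 111) (l := 219) (near_mxMr NF1 FDe)).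
have DeN1 := opnormM_le1 (opnormM_le1 De1 NH1) N1.
rewrite !mulmxA; apply: (near_mx_trans (k := 103) (l := 116) (near_mxMl DeN1 FeD)).
have -> : D *m e *m N^H *m N *m (e *m D) = D *m (e *m N^H *m N *m e *m D).
  by rewrite !mulmxA.
apply: (near_mx_trans (k := 4) (l := 112) (near_mxMl D1 eNNeD)); rewrite mulmxA.
apply: (near_mx_trans (k := 8) (l := 104) (near_mxMr D1 (near_mx_sym eD))).
rewrite -mulmxA; exact: (near_mx_trans (k := 1) (l := 103) (near_mxMl e1 DD)).
Qed.

Let FeF : near 334 (F *m N^H *m N^H *m (N *m N *m F)) F.
Proof.
have -> : F *m N^H *m N^H *m (N *m N *m F) = F *m (e *m F).
  by rewrite eE !mulmxA.
have eF1 : opnorm (e *m F) <= 1 by exact: opnormM_le1.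
apply: (near_mx_trans (k := 111) (l := 223) (near_mxMr eF1 FDe)).
have -> : D *m e *m (e *m F) = D *m (e *m e) *m F by rewrite !mulmxA.
have Dee := opnormM_le1 D1 (opnormM_le1 e1 e1).
apply: (near_mx_trans (k := 103) (l := 120) (near_mxMl Dee FeD)).
have -> : D *m (e *m e) *m (e *m D) = D *m (e *m (e *m e *m D)) by rewrite !mulmxA.
apply: (near_mx_trans (k := 4) (l := 116) (near_mxMl D1 (near_mxMl e1 eeD))).
have -> : D *m (e *m (e *m D)) = D *m (e *m e *m D) by rewrite !mulmxA.
apply: (near_mx_trans (k := 4) (l := 112) (near_mxMl D1 eeD)); rewrite mulmxA.
apply: (near_mx_trans (k := 8) (l := 104) (near_mxMr D1 (near_mx_sym eD))).
rewrite -mulmxA; exact: (near_mx_trans (k := 1) (l := 103) (near_mxMl e1 DD)).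
Qed.

Let FNNNF : near 214 (F *m N^H *m (N *m N *m F)) 0.
Proof.
have NF1 := opnormM_le1 NH1 (opnormM_le1 (opnormM_le1 N1 N1) F1).
rewrite -mulmxA; apply: (near_mx_trans (k := 111) (l := 103) (near_mxMr NF1 FDe)).
have DeN1 := opnormM_le1 (opnormM_le1 (opnormM_le1 De1 NH1) N1) N1.
rewrite !mulmxA; have := near_mxMl DeN1 FeD.
have -> : D *m e *m N^H *m N *m N *m (e *m D) = D *m (e *m N^H *m N *m N *m e) *m D.
  by rewrite !mulmxA.
by rewrite N23 mulmx0 mul0mx.
Qed.

(** The adjoints [P], [F], [N *m F], [N *m N *m F] have almost orthogonal ranges, almost inside that
    of [Q]. The last branch stands for index 3. *)
Let z (i : nat) : 'M[R[i]]_n :=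
  match i with 0%N => P | 1%N => F | 2%N => F *m N^H | _ => F *m N^H *m N^H end.
Let b (i j : nat) : 'M[R[i]]_n := if i == j then (if i == 0%N then P else F) else 0.

Let zH : [/\ (z 0%N)^H = P, (z 1%N)^H = F, (z 2%N)^H = N *m F & (z 3%N)^H = N *m N *m F].
Proof.
split; [exact: projP.1|exact: pF.1|by rewrite ctrmxM ctrmxK pF.1|].
by rewrite [LHS]ctrmxM ctrmxK ctrmxM ctrmxK pF.1 mulmxA.
Qed.

Let z1 i : opnorm (z i) <= 1.
Proof.
have FN1 : opnorm (F *m N^H) <= 1 by exact: opnormM_le1.
by case: i => [|[|[|i]]] //; exact: opnormM_le1.
Qed.

Let Qz (j : 'I_4) : near 218 (Q *m (z j)^H) (z j)^H.
Proof.
have [h0 h1 h2 h3] := zH.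
move: j; apply: (@ord4P (fun j => near 218 (Q *m (z j)^H) (z j)^H));
  rewrite ?(h0, h1, h2, h3).
- exact: near_mxW QP.
- exact: near_mxW QF.
- exact: near_mxW QNF.
- exact: QNNF.
Qed.

Let bH (i j : nat) : (b i j)^H = b j i.
Proof.
rewrite /b [j == i]eq_sym; case: eqVneq => [->|_]; last exact: ctrmx0.
by case: ifP => _; [exact: projP.1|exact: pF.1].
Qed.

Let zz_ge (i j : 'I_4) : (i <= j)%N -> near 334 (z i *m (z j)^H) (b i j).
Proof.
have [h0 h1 h2 h3] := zH; have [_ PP] := projP; have [_ FF] := pF.
have PNF : near 104 (P *m (N *m F)) 0.
  by have := near_mxMl N1 PF; rewrite mulmxA NP mulmx0 mulmxA.
have PNNF : near 104 (P *m (N *m N *m F)) 0.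
  by have := near_mxMl N1 PNF; rewrite mulmxA NP mulmx0 !mulmxA.
have FNF : near 111 (F *m (N *m F)) 0.
  by have := near_mxMr F1 FN; rewrite mul0mx mulmxA.
have FNNF' : near 111 (F *m (N *m N *m F)) 0.
  by have := near_mxMr (opnormM_le1 N1 F1) FN; rewrite mul0mx !mulmxA.
move: i j; apply: (@ord4P (fun i => forall j : 'I_4, (i <= j)%N ->
    near 334 (z i *m (z j)^H) (b i j)));
  [pose i := 0%N|pose i := 1%N|pose i := 2%N|pose i := 3%N];
  apply: (@ord4P (fun j => (i <= j)%N -> near 334 (z i *m (z j)^H) (b i j)));
  rewrite ?(h0, h1, h2, h3).
- by rewrite PP => _; exact/(near_mxW eps0 _ (near_mx_eq _ _)).
- by move=> _; exact: near_mxW PF.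
- by move=> _; exact: near_mxW PNF.
- by move=> _; exact: near_mxW PNNF.
- by [].
- by rewrite FF => _; exact/(near_mxW eps0 _ (near_mx_eq _ _)).
- by move=> _; exact: near_mxW FNF.
- by move=> _; exact: near_mxW FNNF'.
- by [].
- by [].
- by move=> _; exact: near_mxW FNNF.
- by move=> _; exact: near_mxW FNNNF.
- by [].
- by [].
- by [].
- by move=> _; exact: FeF.
Qed.

Let zz (i j : 'I_4) : near 334 (z i *m (z j)^H) (b i j).
Proof.
case: (leqP i j) => [|/ltnW] ij; first exact: zz_ge.
by have := near_mx_ctr (zz_ge ij); rewrite bH ctrmxM ctrmxK.
Qed.

Let gram (i j : 'I_4) : near 552 (z i *m (Q *m (z j)^H)) (b i j).
Proof. exact: (near_mx_trans (k := 218) (l := 334) (near_mxMl (z1 i) (Qz j))). Qed.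

(* Z Q Z^H is close to diag(P, F, F, F), where Z is the column of the z i. *)
Let rank_ge : (\rank P + 3 * \rank F <= \rank Q)%N.
Proof.
pose d (i : nat) : 'M[R[i]]_n := if i == 0 then P else F.
have dE : \mxdiag_(i < 4) d i = \mxblock_(i < 4, j < 4) b i j.
  apply: eq_mxblock => i j; rewrite /b val_eqE.
  by case: eqVneq => // _; rewrite conform_mx_id.
have rd : (\rank (\mxdiag_(i < 4) d i) = \rank P + 3 * \rank F)%N.
  by rewrite rank_mxdiag !big_ord_recl big_ord0 /d/= addn0 !mulSn mul0n addn0.
have idem : \mxdiag_(i < 4) d i *m \mxdiag_(i < 4) d i = \mxdiag_(i < 4) d i.
  rewrite {2 3}dE mul_mxdiag_mxblock; apply: eq_mxblock => i j.
  rewrite /b /d; case: (eqVneq (i : nat) j) => [ij|_]; last exact: mulmx0.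
  by case: ifP => _; [exact: projP.2|exact: pF.2].
rewrite -rd; pose G := \mxblock_(i < 4, j < 4) (z i *m (Q *m (z j)^H)).
have GE : G = \mxcol_(i < 4) z i *m (Q *m \mxrow_(j < 4) (z j)^H).
  by rewrite mul_mxrow mul_mxcol_mxrow.
apply: (@leq_trans (\rank G)); last first.
  by rewrite GE (leq_trans (mxrankM_maxr _ _))// mxrankM_maxl.
apply: mxrank_near => //; rewrite dE -mxblockB (le_lt_trans (opnorm_mxblock_le _))//.
apply: le_lt_trans eps1.
apply: (@le_trans _ _ (\sum_(i < 4) \sum_(j < 4) 552%:R * eps)).
  by apply: ler_sum => i _; apply: ler_sum => j _; exact: gram.
rewrite !sumr_const !card_ord -mulrnA -[leLHS]mulr_natr; exact: gram_error_le.
Qed.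

(** [Q] is close to [A], the sum of [P] and three matrices of rank at most that of [F]; [sum_eD]
    says that these three exhaust [Q - P]. *)
Let rank_le : (\rank Q <= \rank P + 3 * \rank F)%N.
Proof.
pose A := P + (F + N *m F *m N^H + N *m N *m F *m N^H *m N^H).
have rA : (\rank A <= \rank P + 3 * \rank F)%N.
  rewrite (leq_trans (mxrank_add _ _))// leq_add2l !mulSn mul0n addn0 addnA.
  rewrite (leq_trans (mxrank_add _ _))// leq_add//.
    rewrite (leq_trans (mxrank_add _ _))// leq_add2l//.
    by rewrite (leq_trans (mxrankM_maxl _ _))// mxrankM_maxr.
  do 2![rewrite (leq_trans (mxrankM_maxl _ _))//].
  by rewrite mxrankM_maxr.
apply: leq_trans rA; apply: mxrank_near; first exact: projQ.2.
have NFN : near 105 (N *m F *m N^H) (N *m e *m N^H *m D).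
  apply: (near_mx_trans (k := 103) (l := 2) (near_mxMr NH1 (near_mxMl N1 FeD))).
  rewrite -!mulmxA !(mulmxA N e); apply: near_mxMl; first exact: opnormM_le1.
  exact: near_mx_sym NDH.
have NNFNN : near 107 (N *m N *m F *m N^H *m N^H) (N *m N *m e *m N^H *m N^H *m D).
  have N2 : opnorm (N *m N) <= 1 by exact: opnormM_le1.
  apply: (near_mx_trans (k := 103) (l := 4) (near_mxMr NH1 (near_mxMr NH1 (near_mxMl N2 FeD)))).
  have := near_mxMl (opnormM_le1 N2 e1) (near_mx_sym (comm_nearM NH1 NH1 NDH NDH)).
  by rewrite !mulmxA.
have AQ : near 322 A Q.
  apply: (near_mx_trans (k := 315) (l := 7)
    (near_mxD (near_mx_eq _ (erefl P)) (near_mxD (near_mxD FeD NFN) NNFNN))).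
  rewrite -!mulmxDl -[X in near _ _ X](subrK P) addrC.
  exact: (near_mxD (near_mx_trans sum_eD DE) (near_mx_eq _ (erefl P))).
apply: le_lt_trans eps1; apply: (le_trans AQ).
apply: le_trans (gram_error_le eps0); rewrite mulrAC ler_wpM2r//.
by rewrite -natrM ler_nat.
Qed.

Lemma rank_eq : \rank Q = (\rank P + 3 * \rank F)%N.
Proof. by apply/eqP; rewrite eqn_leq rank_le rank_ge. Qed.

End Projection.

(* On the range of Q - P the operators N^i e (N^H)^j are almost matrix units of
   M_3, so Q is almost the sum of P and of three projections of equal rank. *)
Lemma triple_rank : exists r, \rank Q = (\rank P + 3 * r)%N.
Proof. by have [F pF FeD] := projF; exists (\rank F); exact: rank_eq. Qed.

End TripleRank.

(** * Matrices adapted to a pair of projections *)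

Section Adapted.
Variable R : realType.

(** Commutators forget the scalar part of [h + w n]: they leave [w^2 [n^*, n]], and then [w^3 [n,
    [n^*, n]] = w^3 n]. So a polynomial extracts the nilpotent part whatever the height. *)
Definition diff_mx n (x : 'M[R[i]]_n) := x^H *m x - x *m x^H.
Definition nil_mx n (x : 'M[R[i]]_n) := x *m diff_mx x - diff_mx x *m x.
(* 10u^3 - 15u^4 + 6u^5 has a triple zero at 0 and takes the value 1 three times
   at 1, hence it does not see a perturbation of the scalars 0 and 1 by a matrix of
   nilpotency index 3. *)
Definition smoothstep n (u : 'M[R[i]]_n) :=
  u *m u *m u *m (10%:R%:C%C%:M - 15%:R%:C%C *: u + 6%:R%:C%C *: (u *m u)).
(** On [block t] the argument of [smoothstep] is [h + (w - w^3) n]: the scalar [h] when [w = 1],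
    otherwise a nilpotent perturbation of 0 or 1. *)
Definition height_mx n (x : 'M[R[i]]_n) := smoothstep (x - nil_mx x).
Definition corner_mx n (x : 'M[R[i]]_n) := (nil_mx x)^H *m (nil_mx x)^H *m nil_mx x *m nil_mx x.

(* For x = block t these three matrices vanish when weight t = 1. *)
Definition defect1 n (x : 'M[R[i]]_n) := corner_mx x *m corner_mx x - corner_mx x.
Definition defect2 n (x : 'M[R[i]]_n) :=
  corner_mx x *m (nil_mx x)^H *m nil_mx x *m corner_mx x - corner_mx x.
Definition defect3 n (x : 'M[R[i]]_n) :=
  corner_mx x + nil_mx x *m corner_mx x *m (nil_mx x)^H
  + nil_mx x *m nil_mx x *m corner_mx x *m (nil_mx x)^H *m (nil_mx x)^H - 1%:M.

(** All that the rank argument uses about block sums, in a form stable under direct sums and unitary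
    conjugation. The defects carry the factor [Q - P], which selects the blocks with [0 < h < 1]; on
    the others they need not vanish. *)
Record adapted n (x P Q : 'M[R[i]]_n) : Prop := Adapted {
  adapted_P : projection P;
  adapted_Q : projection Q;
  adapted_NP : nil_mx x *m P = P *m nil_mx x;
  adapted_NQ : nil_mx x *m Q = Q *m nil_mx x;
  adapted_hP : height_mx x *m P = P;
  adapted_Ph : P *m height_mx x = P;
  adapted_Qh : Q *m height_mx x = height_mx x;
  adapted_N3 : nil_mx x *m nil_mx x *m nil_mx x = 0;
  adapted_N23 : corner_mx x *m (nil_mx x)^H *m nil_mx x *m nil_mx x *m corner_mx x = 0;
  adapted_1 : defect1 x *m (Q - P) = 0;
  adapted_2 : defect2 x *m (Q - P) = 0;
  adapted_3 : defect3 x *m (Q - P) = 0;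
  adapted_N_le : opnorm (nil_mx x) <= 1;
  adapted_le : opnorm x <= 2 }.

Section DirectSum.
Variables m n : nat.
Local Notation dsum A B := (block_mx A 0 0 B).
Implicit Types (A C : 'M[R[i]]_m) (B D : 'M[R[i]]_n).

Lemma dsumM A B C D : dsum A B *m dsum C D = dsum (A *m C) (B *m D).
Proof. by rewrite mulmx_block !mulmx0 !mul0mx !addr0 !add0r. Qed.

Lemma dsumD A B C D : dsum A B + dsum C D = dsum (A + C) (B + D).
Proof. by rewrite add_block_mx !addr0. Qed.

Lemma dsumB A B C D : dsum A B - dsum C D = dsum (A - C) (B - D).
Proof. by rewrite opp_block_mx add_block_mx !subr0. Qed.

Lemma dsumZ c A B : c *: dsum A B = dsum (c *: A) (c *: B).
Proof. by rewrite scale_block_mx !scaler0. Qed.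

Lemma dsum_ctr A B : (dsum A B)^H = dsum A^H B^H.
Proof. by rewrite ctrmx_block !ctrmx0. Qed.

Lemma dsum_scalar (c : R[i]) : dsum (c%:M : 'M_m) (c%:M : 'M_n) = c%:M.
Proof. by rewrite -scalar_mx_block. Qed.

Lemma dsum0 : dsum (0 : 'M[R[i]]_m) (0 : 'M[R[i]]_n) = 0.
Proof. exact: block_mx0. Qed.

Definition dsumE := (dsumM, dsumD, dsumB, dsumZ, dsum_ctr).

Lemma nil_mx_dsum A B : nil_mx (dsum A B) = dsum (nil_mx A) (nil_mx B).
Proof. by rewrite /nil_mx /diff_mx !dsumE. Qed.

Lemma height_mx_dsum A B : height_mx (dsum A B) = dsum (height_mx A) (height_mx B).
Proof. by rewrite /height_mx /smoothstep nil_mx_dsum -dsum_scalar !dsumE. Qed.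

Lemma corner_mx_dsum A B : corner_mx (dsum A B) = dsum (corner_mx A) (corner_mx B).
Proof. by rewrite /corner_mx nil_mx_dsum !dsumE. Qed.

Lemma adapted_dsum A B P Q P' Q' : adapted A P Q -> adapted B P' Q' ->
  adapted (dsum A B) (dsum P P') (dsum Q Q').
Proof.
move=> [[PH PP] [QH QQ] NP NQ hP Ph Qh N3 N23 d1 d2 d3 N1 A2].
move=> [[PH' PP'] [QH' QQ'] NP' NQ' hP' Ph' Qh' N3' N23' d1' d2' d3' N1' A2'].
split; rewrite /projection /defect1 /defect2 /defect3 ?corner_mx_dsum ?height_mx_dsum
  ?nil_mx_dsum -?(dsum_scalar 1) ?dsumE.
- by rewrite PP PP' PH PH'.
- by rewrite QQ QQ' QH QH'.
- by rewrite NP NP'.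
- by rewrite NQ NQ'.
- by rewrite hP hP'.
- by rewrite Ph Ph'.
- by rewrite Qh Qh'.
- by rewrite N3 N3' dsum0.
- by rewrite N23 N23' dsum0.
- by rewrite -/(defect1 A) -/(defect1 B) d1 d1' dsum0.
- by rewrite -/(defect2 A) -/(defect2 B) d2 d2' dsum0.
- by rewrite -/(defect3 A) -/(defect3 B) d3 d3' dsum0.
- exact: opnorm_block_diag.
- exact: opnorm_block_diag.
Qed.

End DirectSum.

Section Conjugation.
Variables (m n : nat) (W : 'M[R[i]]_(m, n)).
Hypotheses (W1 : isometry W) (W2 : coisometry W).
Local Notation cj A := (W^H *m A *m W).

Lemma conjM A B : cj A *m cj B = cj (A *m B).
Proof. by rewrite !mulmxA -(mulmxA _ W W^H) W2 mulmx1. Qed.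

Lemma conjD A B : cj A + cj B = cj (A + B).
Proof. by rewrite -mulmxDl -mulmxDr. Qed.

Lemma conjB A B : cj A - cj B = cj (A - B).
Proof. by rewrite -mulmxBl -mulmxBr. Qed.

Lemma conjZ c A : c *: cj A = cj (c *: A).
Proof. by rewrite -scalemxAr -scalemxAl. Qed.

Lemma conj_ctr A : (cj A)^H = cj A^H.
Proof. by rewrite !ctrmxM ctrmxK mulmxA. Qed.

Lemma conj_scalar (c : R[i]) : cj c%:M = c%:M.
Proof. by rewrite -scalemx1 -conjZ mulmx1 (W1 : W^H *m W = 1%:M) scalemx1. Qed.

Lemma conj0 : cj 0 = 0.
Proof. by rewrite mulmx0 mul0mx. Qed.

Definition conjE := (conjM, conjD, conjB, conjZ, conj_ctr).

Lemma nil_mx_conj A : nil_mx (cj A) = cj (nil_mx A).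
Proof. by rewrite /nil_mx /diff_mx !conjE. Qed.

Lemma height_mx_conj A : height_mx (cj A) = cj (height_mx A).
Proof.
rewrite /height_mx /smoothstep nil_mx_conj -[in LHS](conj_scalar 10%:R%:C%C).
by rewrite !conjE.
Qed.

Lemma corner_mx_conj A : corner_mx (cj A) = cj (corner_mx A).
Proof. by rewrite /corner_mx nil_mx_conj !conjE. Qed.

Lemma adapted_conj A P Q : adapted A P Q -> adapted (cj A) (cj P) (cj Q).
Proof.
move=> [[PH PP] [QH QQ] NP NQ hP Ph Qh N3 N23 d1 d2 d3 N1 A2].
split; rewrite /projection /defect1 /defect2 /defect3 ?corner_mx_conj ?height_mx_conj
  ?nil_mx_conj -?(conj_scalar 1) ?conjE.
- by rewrite PP PH.
- by rewrite QQ QH.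
- by rewrite NP.
- by rewrite NQ.
- by rewrite hP.
- by rewrite Ph.
- by rewrite Qh.
- by rewrite N3 conj0.
- by rewrite N23 conj0.
- by rewrite -/(defect1 A) d1 conj0.
- by rewrite -/(defect2 A) d2 conj0.
- by rewrite -/(defect3 A) d3 conj0.
- by rewrite opnorm_conj.
- by rewrite opnorm_conj.
Qed.

End Conjugation.

End Adapted.

(** * Lipschitz estimates uniform in the matrix size *)

Section Lipschitz.
Variable R : realType.
Local Notation matfun := (forall n, 'M[R[i]]_n -> 'M[R[i]]_n).
Implicit Types f g : matfun.

(** One [L] serves all sizes [n]. It bounds values as well as increments, which makes the class
    closed under products; the radius 2 is that of [adapted_le]. *)
Definition lip f := exists2 L : R, 0 <= L &
  forall n (x y : 'M[R[i]]_n), opnorm x <= 2 -> opnorm y <= 2 ->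
    opnorm (f n x) <= L /\ opnorm (f n x - f n y) <= L * opnorm (x - y).

Lemma lip_id : lip (fun n x => x).
Proof.
exists 2 => // n x y x2 _; split => //.
by rewrite ler_peMl ?opnorm_ge0// ler1n.
Qed.

Lemma lip_cst (c : R[i]) : lip (fun n x => c%:M).
Proof.
exists (normc c) => [|n x y _ _]; first exact: normc_ge0.
by rewrite opnorm_scalar_le subrr opnorm0 mulr_ge0 ?normc_ge0 ?opnorm_ge0.
Qed.

Lemma lipD f g : lip f -> lip g -> lip (fun n x => f n x + g n x).
Proof.
move=> [L L0 fL] [M M0 gM]; exists (L + M) => [|n x y x2 y2]; first exact: addr_ge0.
have [fx fxy] := fL n x y x2 y2; have [gx gxy] := gM n x y x2 y2.
split; first by rewrite (le_trans (opnormD _ _))// lerD.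
by rewrite opprD addrACA mulrDl (le_trans (opnormD _ _))// lerD.
Qed.

Lemma lipN f : lip f -> lip (fun n x => - f n x).
Proof.
move=> [L L0 fL]; exists L => // n x y x2 y2.
by rewrite -opprD !opnormN; exact: fL.
Qed.

Lemma lip_ctr f : lip f -> lip (fun n x => (f n x)^H).
Proof.
move=> [L L0 fL]; exists L => // n x y x2 y2.
by rewrite -ctrmxB !opnorm_ctrmx; exact: fL.
Qed.

Lemma lipM f g : lip f -> lip g -> lip (fun n x => f n x *m g n x).
Proof.
move=> [L L0 fL] [M M0 gM]; exists (2 * (L * M)) => [|n x y x2 y2].
  by rewrite !mulr_ge0.
have [fx fxy] := fL n x y x2 y2; have [gx gxy] := gM n x y x2 y2.
have [gy _] := gM n y y y2 y2; have LM0 := mulr_ge0 L0 M0; split.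
  rewrite (le_trans (opnormM _ _))//; apply: (@le_trans _ _ (L * M)).
    by rewrite ler_pM ?opnorm_ge0.
  by rewrite ler_peMl// ler1n.
have -> : f n x *m g n x - f n y *m g n y =
    f n x *m (g n x - g n y) + (f n x - f n y) *m g n y.
  by rewrite mulmxBr mulmxBl addrA subrK.
have -> : 2 * (L * M) * opnorm (x - y) =
    L * (M * opnorm (x - y)) + L * opnorm (x - y) * M by ring.
rewrite (le_trans (opnormD _ _))// lerD// (le_trans (opnormM _ _))//.
  by rewrite ler_pM ?opnorm_ge0.
by rewrite ler_pM ?opnorm_ge0.
Qed.

Lemma lipZ (c : R[i]) f : lip f -> lip (fun n x => c *: f n x).
Proof.
move=> lf; have [L L0 h] := lipM (lip_cst c) lf; exists L => // n x y x2 y2.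
by have := h n x y x2 y2; rewrite !mul_scalar_mx.
Qed.

Lemma lip_nil : lip (@nil_mx R).
Proof.
have l : lip (@diff_mx R).
  by apply/lipD/lipN; apply: lipM; do ?[exact: lip_id|apply: lip_ctr].
by apply/lipD/lipN; apply: lipM => //; exact: lip_id.
Qed.

Lemma lip_height : lip (@height_mx R).
Proof.
have l : lip (fun n x => x - nil_mx x) by apply/lipD/lipN/lip_nil/lip_id.
by do ?[exact: l|exact: lip_cst|apply: lipM|apply: lipD|apply: lipN|apply: lipZ].
Qed.

Lemma lip_corner : lip (@corner_mx R).
Proof.
have l := lip_ctr lip_nil.
exact: (lipM (lipM (lipM l l) lip_nil) lip_nil).
Qed.

Lemma lip_defect1 : lip (@defect1 R).
Proof. exact: (lipD (lipM lip_corner lip_corner) (lipN lip_corner)). Qed.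

Lemma lip_defect2 : lip (@defect2 R).
Proof.
exact: (lipD (lipM (lipM (lipM lip_corner (lip_ctr lip_nil)) lip_nil) lip_corner)
             (lipN lip_corner)).
Qed.

Lemma lip_defect3 : lip (@defect3 R).
Proof.
have l := lip_ctr lip_nil; have lNe := lipM lip_nil lip_corner.
have lNNe := lipM (lipM lip_nil lip_nil) lip_corner.
exact: (lipD (lipD (lipD lip_corner (lipM lNe l)) (lipM (lipM lNNe l) l)) (lipN (lip_cst 1))).
Qed.

End Lipschitz.

(** * Ranks attached to nearby adapted matrices *)

Section LowerBound.
Variable R : realType.

(** From [z Q = z P] and [Q h = h] follows [z P = z P h = z Q h = z h], so the discontinuous [z P]
    is a polynomial expression after all; likewise [z' Q' = z' h']. Only increments of [z] and [z h]
    remain. *)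
Lemma defect_near n (z z' h h' P Q P' Q' : 'M[R[i]]_n) e :
  h *m P = P -> P *m h = P -> Q *m h = h -> z *m (Q - P) = 0 ->
  P' *m h' = P' -> Q' *m h' = h' -> z' *m (Q' - P') = 0 -> opnorm Q' <= 1 ->
  opnorm (z - z') <= e -> opnorm (z *m h - z' *m h') <= e ->
  opnorm (z *m (Q' - P)) <= 2%:R * e.
Proof.
move=> hP Ph Qh zQP Ph' Qh' zQP' Q'1 zz zhzh.
have zP : z *m P = z *m h.
  move/eqP: zQP; rewrite mulmxBr subr_eq0 => /eqP zQP.
  by rewrite -Qh mulmxA zQP -mulmxA Ph.
have zQ' : z' *m Q' = z' *m h'.
  move/eqP: zQP'; rewrite mulmxBr subr_eq0 => /eqP zQP'.
  by rewrite -[in RHS]Qh' mulmxA zQP' -mulmxA Ph'.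
have -> : z *m (Q' - P) = (z - z') *m Q' - (z *m h - z' *m h').
  by rewrite mulmxBr zP mulmxBl zQ' opprB addrA subrK.
rewrite (le_trans (opnormD _ _))// opnormN mulrDl mul1r lerD//.
rewrite (le_trans (opnormM _ _))//; apply: le_trans zz.
by rewrite ler_piMr ?opnorm_ge0.
Qed.

(** [Q P - P = (1 - Q) (h' - h) P], because [(1 - Q) h' = 0] and [h P = P]. *)
Lemma subproj_near n (h h' P Q : 'M[R[i]]_n) e : h *m P = P -> Q *m h' = h' ->
  projection P -> projection Q -> opnorm (h - h') <= e -> near_mx e 1 (Q *m P) P.
Proof.
move=> hP Qh' pP pQ hh; rewrite /near_mx mul1r.
have -> : Q *m P - P = (1%:M - Q) *m ((h' - h) *m P).
  rewrite [(h' - h) *m P]mulmxBl hP mulmxBl mul1mx [Q *m (_ - _)]mulmxBr mulmxA Qh'.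
  by rewrite opprB [RHS]addrC [RHS]addrA subrK.
rewrite (le_trans (opnormM _ _))//; apply: le_trans hh; rewrite opnormB.
rewrite -[leRHS]mul1r ler_pM ?opnorm_ge0 ?opnorm_projection//; first exact: projection1B.
by rewrite (le_trans (opnormM _ _))// ler_piMr ?opnorm_ge0 ?opnorm_projection.
Qed.

Lemma comm_near_of n (N N' Q : 'M[R[i]]_n) e : N' *m Q = Q *m N' -> opnorm Q <= 1 ->
  opnorm (N - N') <= e -> comm_near e 2 N Q.
Proof.
move=> NQ Q1 NN; rewrite /comm_near /near_mx.
have -> : N *m Q - Q *m N = (N - N') *m Q + Q *m (N' - N).
  by rewrite mulmxBl mulmxBr NQ addrA subrK.
rewrite (le_trans (opnormD _ _))// mulrDl mul1r lerD// (le_trans (opnormM _ _))//.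
  by apply: le_trans NN; rewrite ler_piMr ?opnorm_ge0.
by apply: le_trans NN; rewrite opnormB ler_piMl ?opnorm_ge0.
Qed.

Lemma near_mx_subl n (z a b C : 'M[R[i]]_n) e k : z = a - b ->
  opnorm (z *m C) <= k%:R * e -> near_mx e k (a *m C) (b *m C).
Proof. by move=> ->; rewrite /near_mx mulmxBl. Qed.

Lemma rank_adapted : exists2 d : R, 0 < d &
  forall n (x y P Q P' Q' : 'M[R[i]]_n), adapted x P Q -> adapted y P' Q' ->
    opnorm (x - y) <= d -> exists r, \rank Q' = (\rank P + 3 * r)%N.
Proof.
(* Constants may be enlarged, so that a single [L] fits eight functions: N, H, the three defects,
   and their products with H required by [defect_near]. *)
have bound (f : forall n, 'M[R[i]]_n -> 'M[R[i]]_n) : lip f -> exists2 L : R, 0 <= L &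
    forall L', L <= L' -> forall n (x y P Q P' Q' : 'M[R[i]]_n),
    adapted x P Q -> adapted y P' Q' -> opnorm (f n x - f n y) <= L' * opnorm (x - y).
  move=> [L L0 fL]; exists L => // L' LL n x y P Q P' Q' ax ay.
  have [_ /le_trans] := fL n x y (adapted_le ax) (adapted_le ay); apply.
  by rewrite ler_wpM2r// opnorm_ge0.
have lh := lip_height R.
have [L1 L1_0 l1] := bound _ (lip_nil R).
have [L2 L2_0 l2] := bound _ lh.
have [L3 L3_0 l3] := bound _ (lip_defect1 R).
have [L4 L4_0 l4] := bound _ (lipM (lip_defect1 R) lh).
have [L5 L5_0 l5] := bound _ (lip_defect2 R).
have [L6 L6_0 l6] := bound _ (lipM (lip_defect2 R) lh).
have [L7 L7_0 l7] := bound _ (lip_defect3 R).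
have [L8 L8_0 l8] := bound _ (lipM (lip_defect3 R) lh).
have [L [L_gt0 [L1L L2L L3L L4L] [L5L L6L L7L L8L]]] : exists L : R, [/\ 0 < L,
    [/\ L1 <= L, L2 <= L, L3 <= L & L4 <= L] & [/\ L5 <= L, L6 <= L, L7 <= L & L8 <= L]].
  by exists (1 + (L1 + L2 + L3 + L4 + L5 + L6 + L7 + L8)); do ?split; lra.
(* Then [eps = L * opnorm (x - y)] is at most 1/20000, and [10^4 eps <= 1/2]. *)
exists (100 * (100 * (2 * L)))^-1 => [|n x y P Q P' Q' ax ay xy].
  by rewrite invr_gt0; lra.
have [eps epsE] : exists eps, eps = L * opnorm (x - y) by exists (L * opnorm (x - y)).
have eps0 : 0 <= eps by rewrite epsE mulr_ge0 ?opnorm_ge0// ltW.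
have eps1 : 100 * (100 * eps) < 1.
  rewrite epsE; apply: (@le_lt_trans _ _ (1 / 2)); last by lra.
  rewrite (_ : 1 / 2 = 100 * (100 * (L * (100 * (100 * (2 * L)))^-1))); last first.
    by field; rewrite gt_eqF.
  by do 2![rewrite ler_pM2l//]; rewrite ler_pM2l.
have N_near := l1 L L1L _ _ _ _ _ _ _ ax ay.
have h_near := l2 L L2L _ _ _ _ _ _ _ ax ay.
have z1 := l3 L L3L _ _ _ _ _ _ _ ax ay.
have zh1 := l4 L L4L _ _ _ _ _ _ _ ax ay.
have z2 := l5 L L5L _ _ _ _ _ _ _ ax ay.
have zh2 := l6 L L6L _ _ _ _ _ _ _ ax ay.
have z3 := l7 L L7L _ _ _ _ _ _ _ ax ay.
have zh3 := l8 L L8L _ _ _ _ _ _ _ ax ay.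
rewrite -epsE in N_near h_near z1 zh1 z2 zh2 z3 zh3.
have [pP pQ NP NQ hP Ph Qh N3 N23 d1 d2 d3 N1 _] := ax.
have [pP' pQ' NP' NQ' hP' Ph' Qh' _ _ d1' d2' d3' _ _] := ay.
have Q'1 := opnorm_projection pQ'; have P1 := opnorm_projection pP.
have dn := defect_near hP Ph Qh _ Ph' Qh' _ Q'1.
apply: (@triple_rank R eps n P Q' (nil_mx x) (corner_mx x) (Q' *m (1%:M - P))) => //.
- exact: (subproj_near hP Qh').
- exact: (comm_near_of NQ').
- by apply: (near_mx_subl (erefl (defect1 x))); exact: dn d1 d1' z1 zh1.
- by apply: (near_mx_subl (erefl (defect2 x))); exact: dn d2 d2' z2 zh2.
- rewrite -[X in near_mx _ _ _ X]mul1mx.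
  by apply: (near_mx_subl (erefl (defect3 x))); exact: dn d3 d3' z3 zh3.
Qed.

End LowerBound.

(** * The path of blocks *)

Section Block.
Variable R : realType.
Local Notation E i j := (delta_mx i j : 'M[R[i]]_3).

Definition shift3 : 'M[R[i]]_3 := E 1 0 + E 2 1.

Lemma ctrmx_delta i j : (E i j)^H = E j i.
Proof. by rewrite /ctrmx trmx_delta map_delta_mx. Qed.

Lemma mul_delta3 i j k l : E i j *m E k l = (if j == k then E i l else 0).
Proof. by rewrite mul_delta_mx_cond; case: (j == k); rewrite ?mulr1n ?mulr0n. Qed.

Definition deltaE := (mulmxDl, mulmxDr, mul_delta3, mul0mx, mulmx0, addr0, add0r).

Lemma ctr_shift3 : shift3^H = E 0 1 + E 1 2.
Proof. by rewrite /shift3 ctrmxD !ctrmx_delta. Qed.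

Lemma shift3_2 : shift3 *m shift3 = E 2 0.
Proof. by rewrite /shift3 !deltaE. Qed.

Lemma shift3_3 : shift3 *m shift3 *m shift3 = 0.
Proof. by rewrite shift3_2 /shift3 !deltaE. Qed.

Lemma shift3_ctr_l : shift3^H *m shift3 = E 0 0 + E 1 1.
Proof. by rewrite ctr_shift3 /shift3 !deltaE. Qed.

Lemma shift3_ctr_r : shift3 *m shift3^H = E 1 1 + E 2 2.
Proof. by rewrite ctr_shift3 /shift3 !deltaE. Qed.

Lemma shift3_corner : shift3^H *m shift3^H *m shift3 *m shift3 = E 0 0.
Proof. by rewrite -mulmxA shift3_2 -ctrmxM shift3_2 ctrmx_delta mul_delta3. Qed.

Lemma delta3_1 : E 0 0 + E 1 1 + E 2 2 = 1%:M.
Proof. by rewrite [RHS]mx1_sum_delta !big_ord_recl big_ord0 addr0 addrA. Qed.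

Lemma opnorm_shift3 : opnorm shift3 <= 1.
Proof.
have : opnorm (shift3^H *m shift3) <= 1.
  apply: opnorm_projection; split; first by rewrite ctrmxM ctrmxK.
  by rewrite shift3_ctr_l !deltaE.
rewrite opnorm_Cstar -[X in _ <= X](expr1n _ 2).
by rewrite ler_pXn2r ?nnegrE ?opnorm_ge0.
Qed.

(** Up to a factor [sqrt 2], [shift3] is the lowering operator of the 3-dimensional irreducible
    representation of sl_2: here [d] is [diag(1, 0, -1)] and [shift3] lowers its eigenvalue by 1. *)
Lemma shift3_diff : let d := shift3^H *m shift3 - shift3 *m shift3^H in
  shift3 *m d - d *m shift3 = shift3.
Proof.
rewrite shift3_ctr_l shift3_ctr_r opprD addrA addrK /= mulmxBr mulmxBl /shift3 !deltaE.
by rewrite /= subr0 opprK.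
Qed.

Lemma shift3_corner2 : E 0 0 *m shift3^H *m shift3 *m E 0 0 = E 0 0.
Proof. by rewrite -(mulmxA (E 0 0)) shift3_ctr_l !deltaE. Qed.

Lemma shift3_corner23 : E 0 0 *m shift3^H *m shift3 *m shift3 *m E 0 0 = 0.
Proof.
by rewrite -(mulmxA _ shift3 shift3) shift3_2 ctr_shift3 !deltaE.
Qed.

Lemma shift3_sum :
  E 0 0 + shift3 *m E 0 0 *m shift3^H + shift3 *m shift3 *m E 0 0 *m shift3^H *m shift3^H
  = 1%:M.
Proof.
rewrite -(mulmxA _ shift3^H shift3^H) -ctrmxM shift3_2 ctrmx_delta ctr_shift3 !deltaE.
exact: delta3_1.
Qed.

Definition height (t : R) : R := Num.max 0 (Num.min 1 (t - 1)).
Definition weight (t : R) : R := Num.max 0 (Num.min 1 (Num.min t (3 - t))).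
Definition block (t : R) : 'M[R[i]]_3 := (height t)%:C%C%:M + (weight t)%:C%C *: shift3.

Lemma height01 t : 0 <= height t <= 1.
Proof. by rewrite /height le_max lexx ge_max ler01 ge_min lexx. Qed.

Lemma weight01 t : 0 <= weight t <= 1.
Proof. by rewrite /weight le_max lexx ge_max ler01 ge_min lexx. Qed.

Lemma weight_height t : height t != 0 -> height t != 1 -> weight t = 1.
Proof.
have [t1|t1] := lerP t 1.
  by rewrite /height min_r ?max_l ?eqxx//; lra.
have [t2|t2 _ _] := lerP 2 t.
  by rewrite /height min_l ?max_r ?eqxx//; lra.
by rewrite /weight min_l ?max_r// le_min; lra.
Qed.

Lemma comm_scalarD n (c d : R[i]) (A B : 'M[R[i]]_n) :
  (c%:M + A) *m (d%:M + B) - (d%:M + B) *m (c%:M + A) = A *m B - B *m A.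
Proof.
rewrite [(c%:M + A) *m _]mulmxDl [_ *m (c%:M + A)]mulmxDr scalar_mxC.
rewrite opprD addrACA subrr add0r mulmxDl mulmxDr [A *m d%:M]scalar_mxC.
by rewrite opprD addrACA subrr add0r.
Qed.

Lemma nil_mx_scalarD n (c : R) (A : 'M[R[i]]_n) : nil_mx (c%:C%C%:M + A) = nil_mx A.
Proof.
have dE : diff_mx (c%:C%C%:M + A) = diff_mx A.
  by rewrite /diff_mx ctrmxD ctrmx_scalar comm_scalarD.
have := comm_scalarD c%:C%C 0 A (diff_mx A).
by rewrite raddf0 add0r /nil_mx dE.
Qed.

Lemma nil_mxZ n (c : R) (A : 'M[R[i]]_n) :
  nil_mx (c%:C%C *: A) = (c ^+ 3)%:C%C *: nil_mx A.
Proof.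
have dE : diff_mx (c%:C%C *: A) = (c ^+ 2)%:C%C *: diff_mx A.
  by rewrite /diff_mx ctrmxZr -!scalemxAl -!scalemxAr !scalerA -scalerBr rmorphXn.
rewrite /nil_mx dE -!scalemxAl -!scalemxAr !scalerA -!rmorphM.
by rewrite -exprS -exprSr -scalerBr.
Qed.

Lemma nil_mx_block t : nil_mx (block t) = (weight t ^+ 3)%:C%C *: shift3.
Proof. by rewrite nil_mx_scalarD nil_mxZ /nil_mx shift3_diff. Qed.

Lemma corner_mx_block t : corner_mx (block t) = (weight t ^+ 12)%:C%C *: E 0 0.
Proof.
rewrite /corner_mx nil_mx_block ctrmxZr -shift3_corner.
by rewrite -!(scalemxAl, scalemxAr) !scalerA -!rmorphM -!exprD.
Qed.

Lemma smoothstep_nil n (v : 'M[R[i]]_n) : v *m v *m v = 0 -> smoothstep v = 0.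
Proof. by rewrite /smoothstep => ->; rewrite mul0mx. Qed.

(** The identity [s(1 + X) = 1 + X^3 (10 + 15 X + 6 X^2)] is checked in the commutative ring of
    polynomials and then evaluated at [v]. *)
Lemma smoothstep_unip n (v : 'M[R[i]]_n.+1) : v *m v *m v = 0 ->
  smoothstep (1%:M + v) = 1%:M.
Proof.
move=> v3; pose p : {poly R[i]} := 1 + 'X.
have pv : horner_mx v p = 1%:M + v by rewrite rmorphD rmorph1 /= horner_mx_X.
pose c k : R[i] := k%:R%:C%C.
have hE (x y z : R[i]) (q : {poly R[i]}) :
    horner_mx v (q * q * q * (x%:P - y%:P * q + z%:P * (q * q))) =
    horner_mx v q *m horner_mx v q *m horner_mx v q *m
      (x%:M - y *: horner_mx v q + z *: (horner_mx v q *m horner_mx v q)).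
  by rewrite !(rmorphM, rmorphB, rmorphD)/= !horner_mx_C -!mulmxE !mul_scalar_mx.
have -> : smoothstep (1%:M + v) =
    horner_mx v (p * p * p * ((c 10)%:P - (c 15)%:P * p + (c 6)%:P * (p * p))).
  by rewrite hE pv.
have -> : p * p * p * ((c 10)%:P - (c 15)%:P * p + (c 6)%:P * (p * p)) =
    1 + 'X * 'X * 'X * ((c 10)%:P + (c 15)%:P * 'X + (c 6)%:P * ('X * 'X)).
  by rewrite /p /c !rmorph_nat; ring.
rewrite rmorphD rmorphM /= !rmorphM /= horner_mx_X -!mulmxE v3 mul0mx addr0.
by rewrite rmorph1.
Qed.

Lemma adapted_block t : adapted (block t)
  (if height t == 1 then 1%:M else 0) (if height t == 0 then 0 else 1%:M).
Proof.
have p1 : projection (1%:M : 'M[R[i]]_3) by split; rewrite ?ctrmx1 ?mul1mx.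
have p0 : projection (0 : 'M[R[i]]_3) by split; rewrite ?ctrmx0 ?mul0mx.
have /andP[h0 h1] := height01 t; have /andP[w0 w1] := weight01 t.
have h_0 : height t = 0 -> height_mx (block t) = 0.
  move=> t0; rewrite /height_mx nil_mx_block /block t0 raddf0 add0r -scalerBl.
  apply: smoothstep_nil.
  by rewrite -!(scalemxAl, scalemxAr) shift3_3 !scaler0.
have h_1 : height t = 1 -> height_mx (block t) = 1%:M.
  move=> t1; rewrite /height_mx nil_mx_block /block t1 -addrA -scalerBl.
  apply: smoothstep_unip.
  by rewrite -!(scalemxAl, scalemxAr) shift3_3 !scaler0.
(* [Q - P] is nonzero only for [0 < h < 1], where the weight is 1; so each defect has to vanish only
   at weight 1. *)
have QP (A : 'M[R[i]]_3) : (weight t = 1 -> A = 0) ->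
    A *m ((if height t == 0 then 0 else 1%:M) - (if height t == 1 then 1%:M else 0)) = 0.
  move=> A0; have [t0|t0] := eqVneq (height t) 0.
    by rewrite t0 eq_sym oner_eq0 subr0 mulmx0.
  have [t1|t1] := eqVneq (height t) 1; first by rewrite subrr mulmx0.
  by rewrite A0 ?mul0mx// weight_height.
split.
- by case: ifP.
- by case: ifP.
- by case: ifP; rewrite ?mulmx1 ?mul1mx ?mulmx0 ?mul0mx.
- by case: ifP; rewrite ?mulmx1 ?mul1mx ?mulmx0 ?mul0mx.
- by case: eqP => [/h_1 ->|]; rewrite ?mulmx1 ?mulmx0.
- by case: eqP => [/h_1 ->|]; rewrite ?mulmx1 ?mul0mx.
- by case: eqP => [/h_0 ->|]; rewrite ?mulmx0 ?mul1mx.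
- by rewrite nil_mx_block -!(scalemxAl, scalemxAr) shift3_3 !scaler0.
- rewrite corner_mx_block nil_mx_block ctrmxZr -!(scalemxAl, scalemxAr).
  by rewrite shift3_corner23 !scaler0.
- apply: QP => w; rewrite /defect1 corner_mx_block w expr1n scale1r !deltaE.
  by rewrite subrr.
- apply: QP => w; rewrite /defect2 corner_mx_block nil_mx_block w !expr1n !scale1r.
  by rewrite shift3_corner2 subrr.
- apply: QP => w; rewrite /defect3 corner_mx_block nil_mx_block w !expr1n !scale1r.
  by rewrite shift3_sum subrr.
- rewrite nil_mx_block opnormZ normc_real ger0_norm ?exprn_ge0//.
  by rewrite -[leRHS]mul1r ler_pM ?opnorm_ge0 ?exprn_ge0 ?exprn_ile1 ?opnorm_shift3.
- rewrite (le_trans (opnormD _ _))// (_ : 2 = 1 + 1)// lerD//.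
    by rewrite (le_trans (opnorm_scalar_le _ _))// normc_real ger0_norm.
  rewrite opnormZ normc_real ger0_norm//.
  by rewrite -[leRHS]mul1r ler_pM ?opnorm_ge0 ?opnorm_shift3.
Qed.

End Block.

(** * Almost unitary equivalence *)

Section UnitaryNear.
Variable R : realType.

(** The sizes [m] and [n] are allowed to differ syntactically: [W] absorbs the casts between equal
    dimensions, and direct sums can be regrouped without transport. *)
Definition unear m n (c : R) (X : 'M[R[i]]_m) (Y : 'M[R[i]]_n) :=
  exists W : 'M[R[i]]_(n, m), [/\ isometry W, coisometry W & opnorm (X - W^H *m Y *m W) <= c].

Local Notation dsum A B := (block_mx A 0 0 B).

Lemma unear_le m n c d (X : 'M[R[i]]_m) (Y : 'M[R[i]]_n) : c <= d -> unear c X Y -> unear d X Y.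
Proof. by move=> cd [W [W1 W2 XY]]; exists W; split => //; exact: le_trans cd. Qed.

Lemma unear_opnorm m c (X Y : 'M[R[i]]_m) : opnorm (X - Y) <= c -> unear c X Y.
Proof.
move=> XY; exists 1%:M; split; rewrite /isometry /coisometry ctrmx1 mul1mx//.
by rewrite mulmx1.
Qed.

Lemma unear_refl m (X : 'M[R[i]]_m) : unear 0 X X.
Proof. by apply: unear_opnorm; rewrite subrr opnorm0. Qed.

Lemma unear_sym m n c (X : 'M[R[i]]_m) (Y : 'M[R[i]]_n) : unear c X Y -> unear c Y X.
Proof.
move=> [W [W1 W2 XY]]; exists W^H; split; [|by rewrite /coisometry ctrmxK|].
  by rewrite /isometry ctrmxK.
rewrite -(opnorm_conj _ W1 W2) ctrmxK mulmxBr mulmxBl.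
rewrite (_ : W^H *m (W *m X *m W^H) *m W = X) 1?opnormB//.
by rewrite !mulmxA (W1 : W^H *m W = 1%:M) mul1mx -mulmxA W1 mulmx1.
Qed.

Lemma unear_trans m n p c d (X : 'M[R[i]]_m) (Y : 'M[R[i]]_n) (Z : 'M[R[i]]_p) :
  unear c X Y -> unear d Y Z -> unear (c + d) X Z.
Proof.
move=> [W [W1 W2 XY]] [V [V1 V2 YZ]]; exists (V *m W); split.
- by rewrite /isometry ctrmxM mulmxA -(mulmxA _ V^H) V1 mulmx1.
- by rewrite /coisometry ctrmxM mulmxA -(mulmxA _ W) W2 mulmx1.
rewrite -(subrK (W^H *m Y *m W) X) -addrA (le_trans (opnormD _ _))// lerD//.
apply: le_trans YZ; rewrite -(opnorm_conj _ W1 W2) mulmxBr mulmxBl.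
by rewrite ctrmxM !mulmxA.
Qed.

Lemma unear_trans0 m n p c (X : 'M[R[i]]_m) (Y : 'M[R[i]]_n) (Z : 'M[R[i]]_p) :
  unear 0 X Y -> unear c Y Z -> unear c X Z.
Proof. by move=> XY YZ; have := unear_trans XY YZ; rewrite add0r. Qed.

Lemma unear_trans0r m n p c (X : 'M[R[i]]_m) (Y : 'M[R[i]]_n) (Z : 'M[R[i]]_p) :
  unear c X Y -> unear 0 Y Z -> unear c X Z.
Proof. by move=> XY YZ; have := unear_trans XY YZ; rewrite addr0. Qed.

Lemma unear_dsum m n p q c (X : 'M[R[i]]_m) (Y : 'M[R[i]]_n)
    (X' : 'M[R[i]]_p) (Y' : 'M[R[i]]_q) :
  unear c X Y -> unear c X' Y' -> unear c (dsum X X') (dsum Y Y').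
Proof.
move=> [W [W1 W2 XY]] [V [V1 V2 XY']].
have c0 : 0 <= c by apply: le_trans XY; exact: opnorm_ge0.
exists (block_mx W 0 0 V); rewrite /isometry /coisometry ctrmx_block !ctrmx0.
rewrite !mulmx_block !mulmx0 !mul0mx !addr0 !add0r; split.
- by rewrite W1 V1 -scalar_mx_block.
- by rewrite W2 V2 -scalar_mx_block.
rewrite !mul0mx opp_block_mx add_block_mx !oppr0 !addr0.
exact: opnorm_block_diag.
Qed.

Lemma unear_dsumC m n (X : 'M[R[i]]_m) (Y : 'M[R[i]]_n) : unear 0 (dsum X Y) (dsum Y X).
Proof.
exists (block_mx 0 1%:M 1%:M 0); rewrite /isometry /coisometry ctrmx_block !ctrmx0 !ctrmx1.
rewrite !mulmx_block !mulmx0 !mul0mx !mulmx1 !addr0 !add0r; split.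
- by rewrite -scalar_mx_block.
- by rewrite -scalar_mx_block.
by rewrite !mul1mx subrr opnorm0.
Qed.

Lemma unear_cast m n (e : m = n) (X : 'M[R[i]]_m) : unear 0 (castmx (e, e) X) X.
Proof. by case: n / e; rewrite castmx_id; exact: unear_refl. Qed.

Lemma unear_dsumA m n p (X : 'M[R[i]]_m) (Y : 'M[R[i]]_n) (Z : 'M[R[i]]_p) :
  unear 0 (dsum X (dsum Y Z)) (dsum (dsum X Y) Z).
Proof.
have := @block_mxA _ m n p m n p X 0 0 0 Y 0 0 0 Z; rewrite /= !row_mx0 !col_mx0 => ->.
exact: unear_cast.
Qed.

Lemma unear_dsumCA m n p (X : 'M[R[i]]_m) (Y : 'M[R[i]]_n) (Z : 'M[R[i]]_p) :
  unear 0 (dsum X (dsum Y Z)) (dsum Y (dsum X Z)).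
Proof.
apply: unear_trans0 (unear_dsumA _ _ _) _; apply: unear_sym.
apply: unear_trans0 (unear_dsumA _ _ _) _.
by apply: unear_dsum (unear_refl _); exact: unear_dsumC.
Qed.

Lemma unear_dsumACA m n p q (X : 'M[R[i]]_m) (Y : 'M[R[i]]_n) (Z : 'M[R[i]]_p)
    (T : 'M[R[i]]_q) :
  unear 0 (dsum (dsum X Y) (dsum Z T)) (dsum (dsum X Z) (dsum Y T)).
Proof.
apply: unear_trans0 (unear_sym (unear_dsumA _ _ _)) _; apply: unear_sym.
apply: unear_trans0 (unear_sym (unear_dsumA _ _ _)) _; apply: unear_sym.
by apply: unear_dsum (unear_refl _) _; exact: unear_dsumCA.
Qed.

Lemma unear_scalarD (z : R[i]) p q :
  unear 0 (dsum (z%:M : 'M_p) (z%:M : 'M_q)) (z%:M : 'M_(p + q)).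
Proof. by rewrite -scalar_mx_block; exact: unear_refl. Qed.

End UnitaryNear.

Section Blocks.
Variable R : realType.
Local Notation dsum A B := (block_mx A 0 0 B).

Fixpoint bdim (ts : seq R) : nat := if ts is _ :: ts' then 3 + bdim ts' else 0.

Fixpoint blocks (ts : seq R) : 'M[R[i]]_(bdim ts) :=
  if ts is t :: ts' then dsum (block t) (blocks ts') else 0.

(** The boolean is the filler: [false] for [a], [true] for [b]. *)
Definition model (ts : seq R) p (z : bool) : 'M[R[i]]_(bdim ts + p) :=
  dsum (blocks ts) (z%:R%:M : 'M_p).

Lemma bdimE ts : bdim ts = (3 * size ts)%N.
Proof. by elim: ts => //= t ts ->; rewrite mulnS. Qed.

Lemma dsum_nil n (A : 'M[R[i]]_0) (X : 'M[R[i]]_n) : dsum A X = X.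
Proof. by rewrite block_mxEv col_flat_mx row_thin_mx. Qed.

Lemma unear_blocks_cat ts ts' :
  unear 0 (blocks (ts ++ ts')) (dsum (blocks ts) (blocks ts')).
Proof.
elim: ts => [|t ts IH] /=; first by rewrite dsum_nil; exact: unear_refl.
apply: unear_trans0r (unear_dsumA _ _ _).
by apply: unear_dsum (unear_refl _) _.
Qed.

(** Only the multiset of parameters matters, so a list of blocks can be sorted before it is compared
    with a grid. *)
Lemma unear_blocks_perm ts ts' : perm_eq ts ts' -> unear 0 (blocks ts) (blocks ts').
Proof.
elim: ts ts' => [|t ts IH] ts'.
  by rewrite perm_sym => /perm_nilP ->; exact: unear_refl.
move=> tts; have : t \in ts' by rewrite -(perm_mem tts) mem_head.
move=> /path.splitPr ts'E; case: ts' / ts'E tts => s1 s2 tts.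
have {tts} /IH tts : perm_eq ts (s1 ++ s2).
  by rewrite -(perm_cons t) (perm_trans tts)// perm_catC/= perm_cons perm_catC.
apply: unear_trans0r (unear_sym (unear_blocks_cat _ _)).
apply: unear_trans0r (unear_dsumCA _ _ _) => /=.
apply: unear_dsum (unear_refl _) _.
exact: unear_trans0r (unear_blocks_cat _ _).
Qed.

Lemma unear_blocks_near c ts ts' :
  0 <= c -> all2 (fun t t' => opnorm (block t - block t') <= c) ts ts' ->
  unear c (blocks ts) (blocks ts').
Proof.
move=> c0; elim: ts ts' => [|t ts IH] [|t' ts'] //=.
  by move=> _; exact: unear_le (unear_refl _).
by move=> /andP[tt /IH tts]; apply: unear_dsum => //; exact: unear_opnorm.
Qed.

Lemma block0 : block (0 : R) = 0%:M.
Proof.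
rewrite /block; have -> : weight (0 : R) = 0.
  by rewrite /weight [Num.min 0 _]min_l ?min_r ?max_l; lra.
have -> : height (0 : R) = 0 by rewrite /height min_r ?max_l; lra.
by rewrite scale0r addr0.
Qed.

Lemma block3 : block (3 : R) = 1%:M.
Proof.
rewrite /block; have -> : weight (3 : R) = 0 by rewrite /weight !min_r ?max_l; lra.
have -> : height (3 : R) = 1 by rewrite /height !min_l ?max_r; lra.
by rewrite scale0r addr0.
Qed.

Definition endpoint (z : bool) : R := if z then 3 else 0.

Lemma block_endpoint z : block (endpoint z) = z%:R%:M.
Proof. by case: z; [exact: block3|exact: block0]. Qed.

Lemma unear_blocks_nseq q z : unear 0 (blocks (nseq q (endpoint z))) (z%:R%:M : 'M_(3 * q)).
Proof.
elim: q => [|q IH]; first by rewrite [X in unear _ _ X]flatmx0; exact: unear_refl.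
rewrite mulnS /= block_endpoint; apply: unear_trans0r (unear_scalarD _ _ _).
exact: unear_dsum (unear_refl _) IH.
Qed.

Lemma unear_scalar_cast (z : R[i]) m n : m = n -> unear 0 (z%:M : 'M_m) (z%:M : 'M_n).
Proof. by move=> ->; exact: unear_refl. Qed.

(** Of the [p] filler scalars, [3 * q] are traded for [q] blocks at the end of the path where
    [block] is that scalar. *)
Lemma unear_model ts ts' p p' q z c : 0 <= c -> p = (3 * q + p')%N ->
  unear c (blocks (ts ++ nseq q (endpoint z))) (blocks ts') ->
  unear c (model ts p z) (model ts' p' z).
Proof.
move=> c0 pE tts; have e0 := unear_scalar_cast (z%:R) pE.
apply: unear_trans0 (unear_dsum (unear_refl _) e0) _.
apply: unear_trans0 (unear_dsum (unear_refl _) (unear_sym (unear_scalarD _ _ _))) _.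
apply: unear_trans0 (unear_dsumA _ _ _) _.
apply: unear_dsum; last exact: unear_le (unear_refl _).
apply: unear_trans0 tts; apply: unear_sym.
apply: unear_trans0 (unear_blocks_cat _ _) _.
exact: unear_dsum (unear_refl _) (unear_blocks_nseq _ _).
Qed.

Lemma unear_model_dsum ts ts' p p' z :
  unear 0 (dsum (model ts p z) (model ts' p' z)) (model (ts ++ ts') (p + p') z).
Proof.
apply: unear_trans0 (unear_dsumACA _ _ _ _) _.
apply: unear_dsum; last exact: unear_scalarD.
exact/unear_sym/unear_blocks_cat.
Qed.

End Blocks.

(** * Grids of blocks *)

Lemma perm_flatten_nseq_rcons (T : eqType) m (s : seq T) x :
  perm_eq (flatten (nseq m (rcons s x))) (flatten (nseq m s) ++ nseq m x).
Proof.
elim: m => //= m IH; rewrite -cats1 -!catA perm_cat2l.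
rewrite (perm_trans (y := [:: x] ++ (flatten (nseq m s) ++ nseq m x)))//.
  by rewrite cats1 perm_cat2l.
by rewrite perm_catCA.
Qed.

(** The right-hand side is the sorted form of [m] copies of a grid: each point occurs [m] times in a
    row. *)
Lemma perm_interleave (T : eqType) (f : nat -> T) m K : (0 < m)%N ->
  perm_eq (flatten (nseq m (map f (iota 0 K)))) [seq f (j %/ m)%N | j <- iota 0 (m * K)].
Proof.
move=> m0; elim: K => [|K IH]; first by rewrite muln0 /=; elim: m {m0}.
have map_cst (S : Type) (s : seq S) : [seq f K | _ <- s] = nseq (size s) (f K).
  by elim: s => //= _ s ->.
rewrite -{1}[K.+1]addn1 iotaD map_cat /= cats1 (perm_trans (perm_flatten_nseq_rcons _ _ _))//.
rewrite add0n mulnS addnC iotaD map_cat add0n perm_cat//.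
rewrite (_ : [seq f (j %/ m)%N | j <- iota (m * K) m] = [seq f K | _ <- iota (m * K) m]).
  by rewrite map_cst size_iota.
apply/eq_in_map => j; rewrite mem_iota => /andP[j1 j2]; congr f.
by apply/eqP; rewrite eqn_leq leq_divRL// (mulnC K m) j1 andbT -ltnS ltn_divLR//; lia.
Qed.

Section Grid.
Variable R : realType.

Definition grid K : seq R := [seq 3 * (j%:R / K%:R) | j <- iota 0 K].

Lemma max_dist (a x y : R) : `|Num.max a x - Num.max a y| <= `|x - y|.
Proof.
have := ler_norm (x - y); have := ler_norm (y - x); rewrite distrC ler_norml.
by case: (lerP a x); case: (lerP a y) => ? ? ? ?; lra.
Qed.

Lemma min_dist (a x y : R) : `|Num.min a x - Num.min a y| <= `|x - y|.
Proof.
have := ler_norm (x - y); have := ler_norm (y - x); rewrite distrC ler_norml.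
by case: (lerP a x); case: (lerP a y) => ? ? ? ?; lra.
Qed.

Lemma height_dist (s t : R) : `|height s - height t| <= `|s - t|.
Proof.
rewrite (le_trans (max_dist _ _ _))// (le_trans (min_dist _ _ _))//.
by rewrite opprB addrA subrK.
Qed.

Lemma weight_dist (s t : R) : `|weight s - weight t| <= `|s - t|.
Proof.
rewrite (le_trans (max_dist _ _ _))// (le_trans (min_dist _ _ _))//.
have := ler_norm (s - t); have := ler_norm (t - s); rewrite distrC ler_norml.
by case: (lerP s (3 - s)); case: (lerP t (3 - t)) => ? ? ? ?; lra.
Qed.

Lemma block_dist (s t : R) : opnorm (block s - block t) <= 2 * `|s - t|.
Proof.
rewrite /block opprD addrACA -raddfB/= -rmorphB -scalerBl -rmorphB.
rewrite (le_trans (opnormD _ _))// mulrDl mul1r lerD//.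
  by rewrite (le_trans (opnorm_scalar_le _ _))// normc_real height_dist.
rewrite opnormZ normc_real -[leRHS]mulr1.
by rewrite ler_pM ?opnorm_ge0 ?weight_dist ?opnorm_shift3.
Qed.

(* The list of m copies of grid K, sorted and preceded by o copies of 0, has j-th
   entry 3 * ((j - o) %/ m) / K. *)
Lemma grid_dist m K q o j : (0 < K)%N -> (0 < m <= 3)%N -> (q <= 2)%N -> (q <= m)%N ->
  (o <= q)%N -> (j < m * K + q)%N ->
  `|3 * (((j - o) %/ m)%N%:R / K%:R) - 3 * (j%:R / (m * K + q)%:R)| <= 27 / (m * K + q)%:R :> R.
Proof.
move=> K0 /andP[m0 m3] q2 qm oq jK; set r := ((j - o) %/ m)%N.
have rm : (m * r <= j)%N by rewrite mulnC (leq_trans (leq_divM _ _))// leq_subr.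
have mr : (j <= m * r + m + o)%N.
  have := ltn_ceil (j - o) m0; rewrite -/r; lia.
set M := (m * K + q)%N; have M0 : (0 < M)%N by lia.
have -> : 3 * (r%:R / K%:R) - 3 * (j%:R / M%:R) =
    3 * (r * M)%:R / (K * M)%:R - 3 * (j * K)%:R / (K * M)%:R :> R.
  by rewrite !natrM; field; rewrite !pnatr_eq0; lia.
rewrite -mulrBl normrM [`|_^-1|]ger0_norm ?invr_ge0//.
have -> : 27 / M%:R = (27 * K)%:R / (K * M)%:R :> R.
  by rewrite !natrM; field; rewrite !pnatr_eq0; lia.
rewrite ler_pM2r ?invr_gt0 ?ltr0n ?muln_gt0 ?K0// -!(natrM _ 3).
have rK : (r <= K + 1)%N by nia.
(* The numerator [r * M - j * K = (m * r - j) * K + r * q] lies between [- 5 K] and [4 K], so [9 K]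
   leaves room. *)
have h1 : (3 * (r * M) <= 3 * (j * K) + 27 * K)%N by rewrite /M; nia.
have h2 : (3 * (j * K) <= 3 * (r * M) + 27 * K)%N by rewrite /M; nia.
rewrite ler_norml; apply/andP; split.
  by rewrite lerBrDr addrC lerBlDr -natrD ler_nat.
by rewrite lerBlDr -natrD ler_nat addnC.
Qed.

Lemma all2_map (I S T : Type) (r : S -> T -> bool) (f : I -> S) (g : I -> T) s :
  all (fun x => r (f x) (g x)) s -> all2 r (map f s) (map g s).
Proof. by elim: s => //= x s IH /andP[-> /IH]. Qed.

(* If m * K + q = 0 the bound is 54 / 0 = 0, but then both lists are empty. *)
Lemma unear_blocks_grid m K q z : (0 < m <= 3)%N -> (q <= 2)%N -> (q <= m)%N ->
  unear (54 / (m * K + q)%:R)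
    (blocks (flatten (nseq m (grid K)) ++ nseq q (endpoint R z)))
    (blocks (grid (m * K + q))).
Proof.
move=> m13 q2 qm; have /andP[m0 m3] := m13; set c := 54 / _.
have c0 : 0 <= c by rewrite divr_ge0.
(* 54 is the 27 of [grid_dist] times the Lipschitz constant 2 of [block]. *)
have near (t t' : R) : `|t - t'| <= 27 / (m * K + q)%:R -> opnorm (block t - block t') <= c.
  move=> tt; rewrite (le_trans (block_dist _ _))// /c (_ : 54 = 2 * 27); last by ring.
  by rewrite -mulrA ler_pM2l.
have [KE|K0] := posnP K.
  subst K.
  have -> : flatten (nseq m (grid 0)) ++ nseq q (endpoint R z) =
      [seq endpoint R z | _ <- iota 0 q].
    rewrite (_ : flatten _ = [::]) /=; last by elim: (m).
    by rewrite -[in LHS](size_iota 0 q); elim: (iota 0 q) => //= _ s ->.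
  apply: unear_blocks_near => //; rewrite muln0 add0n; apply: all2_map.
  apply/allP => j; rewrite mem_iota => /andP[_ jq]; apply: near; rewrite muln0 add0n.
  have q0 : (0 < q)%N by lia.
  have j1 : 0 <= (j%:R / q%:R : R) <= 1.
    by rewrite divr_ge0//= ler_pdivrMr ?ltr0n// mul1r ler_nat ltnW.
  (* Without grid points, both parameters are anywhere in [[0, 3]]; since [q <= 2] the bound is at
     least 27/2. *)
  apply: (@le_trans _ _ 3).
    by rewrite /endpoint; case: z; rewrite ler_norml; lra.
  have qR : q%:R <= 2 :> R by rewrite ler_nat.
  by rewrite ler_pdivlMr ?ltr0n//; lra.
(* In the sorted list zeros come first and shift the index by [q]; threes come last, where
   [j %/ m = K] already gives the parameter 3. *)
pose o := if z then 0%N else q.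
have oq : (o <= q)%N by rewrite /o; case: (z).
have E : perm_eq (flatten (nseq m (grid K)) ++ nseq q (endpoint R z))
    [seq 3 * (((j - o) %/ m)%N%:R / K%:R) | j <- iota 0 (m * K + q)].
  have cst (x : R) s (f : nat -> R) : {in s, forall j, f j = x} ->
      nseq (size s) x = [seq f j | j <- s].
    elim: s => //= y s IH fx; rewrite fx ?mem_head// -IH// => j js.
    by rewrite fx// in_cons js orbT.
  have := perm_interleave (fun j => 3 * (j%:R / K%:R) : R) K m0.
  rewrite /o; case: (z) => h.
    rewrite iotaD map_cat add0n perm_cat//.
      by rewrite (perm_trans h)//; under [X in perm_eq _ X]eq_map do rewrite subn0.
    rewrite -[X in nseq X](size_iota (m * K) q).
    rewrite (cst _ _ (fun j => 3 * (((j - 0) %/ m)%N%:R / K%:R)))// => j.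
    rewrite mem_iota => /andP[j1 j2]; rewrite subn0 /endpoint.
    have -> : (j %/ m = K)%N.
      by apply/eqP; rewrite eqn_leq leq_divRL// (mulnC K m) j1 andbT -ltnS ltn_divLR//; lia.
    by rewrite divff ?mulr1// pnatr_eq0 -lt0n.
  rewrite perm_catC addnC iotaD map_cat perm_cat//.
    rewrite -[X in nseq X](size_iota 0 q).
    rewrite (cst _ _ (fun j => 3 * (((j - q) %/ m)%N%:R / K%:R)))// => j.
    rewrite mem_iota add0n => /andP[_ /ltnW]; rewrite -subn_eq0 => /eqP ->.
    by rewrite div0n mul0r mulr0.
  rewrite add0n -[X in iota X]addn0 iotaDl -map_comp (perm_trans h)//.
  by under [X in perm_eq _ X]eq_map do rewrite /= addKn.
apply: unear_trans0 (unear_blocks_perm E) _; apply: unear_blocks_near => //.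
apply: all2_map; apply/allP => j; rewrite mem_iota => /andP[_ jM]; apply: near.
exact: grid_dist.
Qed.

Lemma adapted_scalar p (z : bool) : adapted (z%:R%:M : 'M[R[i]]_p) z%:R%:M z%:R%:M.
Proof.
have pz : projection (z%:R%:M : 'M[R[i]]_p).
  case: z; split; rewrite ?ctrmx1 ?mul1mx// raddf0 ?ctrmx0 ?mul0mx//.
have d0 : diff_mx (z%:R%:M : 'M[R[i]]_p) = 0 by rewrite /diff_mx pz.1 subrr.
have N0 : nil_mx (z%:R%:M : 'M[R[i]]_p) = 0 by rewrite /nil_mx d0 mulmx0 mul0mx subrr.
have hz : height_mx (z%:R%:M : 'M[R[i]]_p) = z%:R%:M.
  rewrite /height_mx N0 subr0 /smoothstep !pz.2; case: (z); last by rewrite raddf0 !mul0mx.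
  rewrite mul1mx !scalemx1 -raddfB -raddfD/=; congr (_%:M).
  by rewrite -rmorphB -rmorphD/= (_ : _ - _ + _ = 1) ?rmorph1//; ring.
split; rewrite ?N0 ?hz ?subrr ?mulmx0 ?mul0mx ?opnorm0 ?pz.2//.
rewrite (le_trans (opnorm_scalar_le _ _))//.
by case: (z); rewrite ?normc1 ?normc0 ?ler1n.
Qed.

(** Each block contributes 0 or 3 to either rank, the filler [z * p] to both: modulo 3 only the
    filler is seen. *)
Lemma adapted_model (ts : seq R) p z : exists P Q k l,
  [/\ adapted (model ts p z) P Q, \rank P = (3 * k + z * p)%N & \rank Q = (3 * l + z * p)%N].
Proof.
have rank_scalar q (b : bool) : \rank (b%:R%:M : 'M[R[i]]_q) = (b * q)%N.
  by case: b; rewrite ?mxrank1 ?mul1n// raddf0 mxrank0.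
suff [P [Q [k [l [a rP rQ]]]]] : exists P Q k l,
    [/\ adapted (blocks ts) P Q, \rank P = (3 * k)%N & \rank Q = (3 * l)%N].
  exists (block_mx P 0 0 z%:R%:M), (block_mx Q 0 0 z%:R%:M), k, l.
  rewrite !rank_diag_block_mx rP rQ !rank_scalar; split => //.
  exact: adapted_dsum a (adapted_scalar _ _).
elim: ts => [|t ts [P [Q [k [l [a rP rQ]]]]]].
  exists 0, 0, 0%N, 0%N; rewrite !mxrank0; split => //.
  by have := adapted_scalar 0 false; rewrite raddf0.
exists (block_mx (if height t == 1 then 1%:M else 0) 0 0 P),
  (block_mx (if height t == 0 then 0 else 1%:M) 0 0 Q),
  (nat_of_bool (height t == 1%R) + k)%N, (nat_of_bool (height t != 0%R) + l)%N.
rewrite !rank_diag_block_mx rP rQ !mulnDr; split.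
- exact: adapted_dsum (adapted_block t) a.
- by case: ifP; rewrite ?mxrank1 ?mxrank0.
- by case: ifP; rewrite ?mxrank1 ?mxrank0.
Qed.

End Grid.

(** * The finite-level matrices and their limits *)

Section Levels.
Variable R : realType.
Local Notation dsum A B := (block_mx A 0 0 B).

Definition level n (z : bool) := model (grid R (2 ^ n %/ 3)%N) (2 ^ n %% 3)%N z.

Lemma level_dim n : (bdim (grid R (2 ^ n %/ 3)%N) + 2 ^ n %% 3 = Defs.dim n)%N.
Proof. by rewrite bdimE size_map size_iota dimE mulnC -divn_eq. Qed.

(** Once [3 * q] of the [m * p] filler scalars have become blocks, what remains is the shape
    prescribed for dimension [m * 2 ^ n]. The case [m = 2] compares consecutive levels, [m = 3]
    serves (2). *)
Lemma unear_copies m n z : (0 < m <= 3)%N -> ((m * (2 ^ n %% 3)) %/ 3 <= 2)%N ->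
  ((m * (2 ^ n %% 3)) %/ 3 <= m)%N ->
  unear (54 / ((m * 2 ^ n) %/ 3)%:R)
    (model (flatten (nseq m (grid R (2 ^ n %/ 3)%N))) (m * (2 ^ n %% 3)) z)
    (model (grid R ((m * 2 ^ n) %/ 3)%N) ((m * 2 ^ n) %% 3) z).
Proof.
set K := (2 ^ n %/ 3)%N; set p := (2 ^ n %% 3)%N; set q := ((m * p) %/ 3)%N => m13 q2 qm.
have mE : (m * 2 ^ n = m * K * 3 + m * p)%N.
  by rewrite {1}(divn_eq (2 ^ n) 3) -/K -/p mulnDr mulnA.
have -> : ((m * 2 ^ n) %/ 3 = m * K + q)%N by rewrite mE divnMDl.
have -> : ((m * 2 ^ n) %% 3 = (m * p) %% 3)%N by rewrite mE modnMDl.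
apply: (unear_model (q := q)); first by rewrite divr_ge0.
  by rewrite {1}(divn_eq (m * p) 3) mulnC.
exact: unear_blocks_grid.
Qed.

Lemma pow2_mod3 n : (0 < 2 ^ n %% 3 < 3)%N.
Proof.
rewrite ltn_pmod// andbT lt0n -/(dvdn 3 (2 ^ n)).
by rewrite Euclid_dvdX.
Qed.

Lemma unear_level_step n z :
  unear (54 / (2 ^ n.+1 %/ 3)%:R) (dsum (level n z) (level n z)) (level n.+1 z).
Proof.
apply: unear_trans0 (unear_model_dsum _ _ _ _ _) _.
have /andP[p0 p3] := pow2_mod3 n.
have := @unear_copies 2 n z isT; rewrite -expnS /= cats0 mul2n -addnn; apply.
  by rewrite -ltnS ltn_divLR//; lia.
by rewrite -ltnS ltn_divLR//; lia.
Qed.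

Lemma unear_level_triple n z :
  unear (54 / (2 ^ n)%:R) (dsum (level n z) (dsum (level n z) (level n z)))
    (model (grid R (2 ^ n)) 0 z).
Proof.
apply: unear_trans0 (unear_dsum (unear_refl _) (unear_model_dsum _ _ _ _ _)) _.
apply: unear_trans0 (unear_model_dsum _ _ _ _ _) _.
have /andP[p0 p3] := pow2_mod3 n.
have := @unear_copies 3 n z isT.
rewrite mulKn// mulKn// [in X in _ -> _ -> X]modnMr /= cats0 !mulSn mul0n addn0; apply.
  by rewrite -ltnS.
exact: ltnW.
Qed.

Lemma unear_level_triples n :
  unear (108 / (2 ^ n)%:R) (dsum (level n false) (dsum (level n false) (level n false)))
    (dsum (level n true) (dsum (level n true) (level n true))).
Proof.
have -> : 108 / (2 ^ n)%:R = 54 / (2 ^ n)%:R + 54 / (2 ^ n)%:R :> R by ring.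
apply: unear_trans (unear_level_triple _ _) _.
(* With no filler left, nothing distinguishes the two models. *)
rewrite (_ : model _ 0 false = model (grid R (2 ^ n)) 0 true).
  exact/unear_sym/unear_level_triple.
by rewrite /model [X in block_mx _ _ _ X]flatmx0 [X in _ = block_mx _ _ _ X]flatmx0.
Qed.

Lemma mxrank_conj m n (W : 'M[R[i]]_(m, n)) P : isometry W -> coisometry W ->
  \rank (W^H *m P *m W) = \rank P.
Proof.
have le m' n' (V : 'M[R[i]]_(m', n')) Q : (\rank (V^H *m Q *m V) <= \rank Q)%N.
  by rewrite (leq_trans (mxrankM_maxl _ _))// mxrankM_maxr.
move=> W1 W2; apply/eqP; rewrite eqn_leq le/=.
have := le _ _ W^H (W^H *m P *m W).
by rewrite ctrmxK !mulmxA W2 mul1mx -mulmxA W2 mulmx1.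
Qed.

(** The ranks compared are 0 and [2 ^ n] modulo 3, and 3 never divides [2 ^ n]; [d] does not depend
    on the matrix size. *)
Lemma level_far : exists2 d : R, 0 < d & forall n, ~ unear d (level n false) (level n true).
Proof.
have [d d0 dP] := rank_adapted R; exists d => // n [W [W1 W2 dW]].
have [P [Q [k [l [a rP rQ]]]]] := adapted_model (grid R (2 ^ n %/ 3)%N) (2 ^ n %% 3) false.
have [P' [Q' [k' [l' [a' rP' rQ']]]]] := adapted_model (grid R (2 ^ n %/ 3)%N) (2 ^ n %% 3) true.
have [r] := dP _ _ _ _ _ _ _ a (adapted_conj W1 W2 a') dW.
rewrite mxrank_conj// rQ' rP.
have := pow2_mod3 n; lia.
Qed.

(** Doubling a level gives the next one only up to a unitary. Conjugating the next level by that
    unitary makes consecutive terms close in norm; the subset type carries the equivalence with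
    [level] through the recursion. *)
Lemma level_seq z : exists x : matseq R,
  (forall n, unear 0 (x n) (level n z)) /\
  (forall n, opnorm (x n.+1 - amp1 (x n)) <= 54 / (2 ^ n.+1 %/ 3)%:R).
Proof.
pose S n := {a : 'M[R[i]]_(Defs.dim n) | unear 0 a (level n z)}.
have step n (a : S n) : {b : S n.+1 |
    opnorm (sval b - amp1 (sval a)) <= 54 / (2 ^ n.+1 %/ 3)%:R}.
  apply: cid; case: a => a aP /=.
  have [W [W1 W2 aW]] := unear_trans0 (unear_dsum aP aP) (unear_level_step n z).
  have bP : unear 0 (W^H *m level n.+1 z *m W) (level n.+1 z).
    by exists W; split => //; rewrite subrr opnorm0.
  exists (exist (fun b : 'M_(Defs.dim n.+1) => unear 0 b (level n.+1 z)) _ bP).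
  by rewrite /= opnormB.
pose s0 : S 0 := exist (fun b : 'M_(Defs.dim 0) => unear 0 b (level 0 z)) _
    (unear_cast (level_dim 0) (level 0 z)).
pose s := nat_rect S s0 (fun n a => sval (step n a)).
exists (fun n => sval (s n)); split=> n; first exact: (svalP (s n)).
exact: (svalP (step n (s n))).
Qed.

Lemma level_seq_amp (x : matseq R) :
  (forall n, opnorm (x n.+1 - amp1 (x n)) <= 54 / (2 ^ n.+1 %/ 3)%:R) ->
  forall k n, (0 < n)%N -> opnorm (x (k + n)%N - amp k (x n)) <= 216 / (2 ^ n)%:R.
Proof.
(* Strengthened for the induction: each increment is at most
   [108 / 2^m = 216 / 2^m - 216 / 2^(m+1)], which telescopes. *)
move=> xP k n n0; apply: (@le_trans _ _ (216 / (2 ^ n)%:R - 216 / (2 ^ (k + n))%:R)); last first.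
  by rewrite gerBl divr_ge0.
elim: k => [|k IH]; first by rewrite /= !subrr opnorm0.
have -> : x (k.+1 + n)%N - amp k.+1 (x n) =
    (x (k + n).+1 - amp1 (x (k + n)%N)) + amp1 (x (k + n)%N - amp k (x n)).
  have amp1B (u v : 'M[R[i]]_(Defs.dim (k + n))) : amp1 (u - v) = amp1 u - amp1 v := ampB 1 u v.
  by rewrite amp1B addrA subrK.
rewrite (le_trans (opnormD _ _))// opnorm_amp1; apply: le_trans (lerD (xP _) IH) _.
rewrite addrCA lerD2l addSn; set m := (k + n)%N.
have m0 : (0 < m)%N by rewrite addn_gt0 n0 orbT.
(* False for [m = 0], where [2 %/ 3 = 0]; hence the condition [0 < n]. *)
have K0 : (2 ^ m <= (2 ^ m.+1 %/ 3) * 2)%N.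
  have : (2 <= 2 ^ m)%N by rewrite -{1}(expn1 2) leq_exp2l.
  by rewrite (expnS 2 m); lia.
have p0 : 0 < (2 ^ m)%:R :> R by rewrite ltr0n expn_gt0.
have k0 : 0 < (2 ^ m.+1 %/ 3)%:R :> R.
  by rewrite ltr0n; have := expn_gt0 2 m; lia.
apply: (@le_trans _ _ (108 / (2 ^ m)%:R - 216 / (2 ^ m)%:R)).
  rewrite lerD2r ler_pdivrMr// mulrAC ler_pdivlMr//.
  have : (2 ^ m)%:R <= (2 ^ m.+1 %/ 3)%:R * 2 :> R by rewrite -natrM ler_nat.
  lra.
rewrite expnS natrM invfM.
by have := invr_gt0 (2 ^ m)%:R; lra.
Qed.

Lemma near_div_pow2 (c e : R) : 0 <= c -> 0 < e -> \forall n \near \oo, c / (2 ^ n)%:R <= e.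
Proof.
move=> c0 e0; have d0 : 0 < e / (c + 1) by rewrite divr_gt0// ltr_wpDl.
near=> n; have : 1 / 2 ^+ n < e / (c + 1).
  by near: n; exact: near_infty_natSinv_expn_lt (PosNum d0).
rewrite ltr_pdivlMr ?ltr_wpDl// mul1r -natrX => /ltW; apply: le_trans.
by rewrite mulrC ler_wpM2l ?invr_ge0 ?lerDl.
Unshelve. all: by end_near. Qed.

Lemma level_seq_cauchy (x : matseq R) :
  (forall n, opnorm (x n.+1 - amp1 (x n)) <= 54 / (2 ^ n.+1 %/ 3)%:R) ->
  x \in @cauchy_matseq R.
Proof.
move=> /level_seq_amp xP; apply/asboolP => e e0; near=> n => k.
apply: (le_trans (xP k n _)); first by near: n; exact: nbhs_infty_gt.
by near: n; exact: near_div_pow2.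
Unshelve. all: by end_near. Qed.

End Levels.

(** * Matrices over the CAR algebra *)

Section Copies.
Variable R : realType.
Local Notation dsum A B := (block_mx A 0 0 B).

(** Recursive, so that the size of [kfold] unfolds to that of a block matrix; [unear_mxdiag] makes
    the link with [\mxdiag]. *)
Fixpoint kdim k n := if k is k'.+1 then (n + kdim k' n)%N else 0%N.

Fixpoint kfold k n (x : 'M[R[i]]_n) : 'M[R[i]]_(kdim k n) :=
  if k is k'.+1 then dsum x (kfold k' x) else 0.

Lemma unear_kfoldD k l n (x : 'M[R[i]]_n) :
  unear 0 (dsum (kfold k x) (kfold l x)) (kfold (k + l) x).
Proof.
elim: k => [|k IH] /=; first by rewrite dsum_nil; exact: unear_refl.
apply: unear_trans0 (unear_sym (unear_dsumA _ _ _)) _.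
exact: unear_dsum (unear_refl _) IH.
Qed.

Lemma unear_kfold k m n c (x : 'M[R[i]]_m) (y : 'M[R[i]]_n) :
  unear c x y -> unear c (kfold k x) (kfold k y).
Proof.
move=> xy; elim: k => [|k IH] /=; last exact: unear_dsum.
case: xy => W [_ _ /(le_trans (opnorm_ge0 _)) c0].
exact: unear_le (unear_refl _).
Qed.

Lemma unear_dim0 m n (X : 'M[R[i]]_m) (Y : 'M[R[i]]_n) :
  m = 0%N -> n = 0%N -> unear 0 X Y.
Proof.
move=> m0 n0; subst; apply: unear_opnorm.
by rewrite [X in opnorm X]flatmx0 opnorm0.
Qed.

Lemma unear_mxdiag m n (x : 'M[R[i]]_n) : unear 0 (\mxdiag_(i < m) x) (kfold m x).
Proof.
elim: m => [|m IH]; first by apply: unear_dim0 => //; rewrite big_ord0.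
rewrite mxdiag_recl; apply: unear_trans0 (unear_cast _ _) _.
exact: unear_dsum (unear_refl _) IH.
Qed.

Lemma unear_amp k n (x : 'M[R[i]]_(Defs.dim n)) : unear 0 (amp k x) (kfold (2 ^ k) x).
Proof.
elim: k => [|k IH].
  apply: unear_sym; apply: unear_trans0 (unear_dsumC _ _) _.
  by rewrite dsum_nil; exact: unear_refl.
rewrite expnS mul2n -addnn; apply: unear_trans0 (unear_kfoldD _ _ _).
exact: unear_dsum.
Qed.

Lemma unear_kfold3 k n (x : 'M[R[i]]_n) :
  unear 0 (kfold (3 * k) x) (kfold k (dsum x (dsum x x))).
Proof.
elim: k => [|k IH]; first exact: unear_refl.
rewrite mulnS /=; apply: unear_trans0r (unear_dsumA _ _ _).
apply: unear_dsum (unear_refl _) _; apply: unear_trans0r (unear_dsumA _ _ _).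
by apply: unear_dsum (unear_refl _) _; apply: unear_dsum (unear_refl _) _.
Qed.

Lemma opnorm_unear m n c (X : 'M[R[i]]_m) (Y : 'M[R[i]]_n) :
  unear c X Y -> opnorm X <= opnorm Y + c.
Proof.
move=> [W [W1 W2 XY]]; rewrite -(opnorm_conj Y W1 W2) addrC -{1}(subrK (W^H *m Y *m W) X).
by rewrite (le_trans (opnormD _ _))// lerD2r.
Qed.

Lemma opnorm_mxdiag_le m n (x : 'M[R[i]]_n) : opnorm (\mxdiag_(i < m) x) <= opnorm x.
Proof.
rewrite (le_trans (opnorm_unear (unear_mxdiag m x)))// addr0.
elim: m => [|m IH] /=; first by rewrite opnorm0 opnorm_ge0.
by rewrite opnorm_block_diag ?opnorm_ge0.
Qed.

End Copies.

Section Lift.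
Variable R : realType.

Lemma amp0 k n : amp k (0 : 'M[R[i]]_(Defs.dim n)) = 0.
Proof. by rewrite -[X in amp k X](subrr 0) ampB subrr. Qed.

Lemma amp_sum k n (J : finType) (F : J -> 'M[R[i]]_(Defs.dim n)) :
  amp k (\sum_j F j) = \sum_j amp k (F j).
Proof. exact: (big_morph (@amp R k n) (@ampD R k n) (@amp0 k n)). Qed.

(* At levels k < n the dimensions do not match and conform_mx returns 0. *)
Definition lift_matseq n (A : 'M[R[i]]_(Defs.dim n)) : matseq R :=
  fun k => conform_mx 0 (amp (k - n) A).

Lemma lift_matseqE n (A : 'M[R[i]]_(Defs.dim n)) k : lift_matseq A (k + n) = amp k A.
Proof. by rewrite /lift_matseq addnK conform_mx_id. Qed.

Lemma lift_matseq_cauchy n (A : 'M[R[i]]_(Defs.dim n)) : lift_matseq A \in @cauchy_matseq R.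
Proof.
have liftS p : (n <= p)%N -> lift_matseq A p.+1 = amp1 (lift_matseq A p).
  move=> np; have [j ->] : exists j, p = (j + n)%N by exists (p - n)%N; rewrite subnK.
  by rewrite lift_matseqE; exact: (lift_matseqE A j.+1).
apply/asboolP => e e0; exists n => // k /= nk l.
suff -> : lift_matseq A (l + k) = amp l (lift_matseq A k) by rewrite subrr opnorm0 ltW.
elim: l => //= l <-; apply: liftS; exact: leq_trans (leq_addl _ _).
Qed.

Definition lift_cseq n (A : 'M[R[i]]_(Defs.dim n)) : cseq R := CSeq (lift_matseq_cauchy A).

Lemma lift_cseqE n (A : 'M[R[i]]_(Defs.dim n)) k : cseq_val (lift_cseq A) (k + n) = amp k A.
Proof. exact: lift_matseqE. Qed.

End Lift.

(** * From finite levels to the limit and back *)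

Section Matrices.
Variables (R : realType) (m : nat).
Local Open Scope quotient_scope.
Local Notation car := (car R).
Implicit Types x y : 'I_m -> 'I_m -> cseq R.

Definition mxpi x : 'M[car]_m := \matrix_(i, j) \pi_car (x i j).
Definition fmul x y : 'I_m -> 'I_m -> cseq R := fun i j => \sum_k x i k * y k j.
Definition fstar x : 'I_m -> 'I_m -> cseq R := fun i j => cstar (x j i).
Definition fdiag (a : cseq R) : 'I_m -> 'I_m -> cseq R := fun i j => if i == j then a else 0.

Lemma mxpi_mul x y : mxpi x *m mxpi y = mxpi (fmul x y).
Proof.
apply/matrixP => i j; rewrite !mxE pi_sum; apply: eq_bigr => k _.
by rewrite !mxE -[LHS]/(car_mul _ _) Defs.pi_mul.
Qed.

Lemma mxpi_star x : mxcar_star (mxpi x) = mxpi (fstar x).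
Proof. by apply/matrixP => i j; rewrite !mxE car_star_pi. Qed.

Lemma mxpi_sub x y : mxpi x - mxpi y = mxpi (fun i j => x i j - y i j).
Proof.
apply/matrixP => i j; rewrite !mxE; apply: (addIr (\pi_car (y i j))).
by rewrite subrK Defs.pi_add subrK.
Qed.

Lemma mxpi_diag a : mxpi (fdiag a) = amplification m (\pi_car a).
Proof.
apply/matrixP => i j; rewrite !mxE /fdiag; case: eqVneq => _; first by rewrite mulr1n.
by rewrite mulr0n Defs.pi_zero.
Qed.

Lemma blockseq_mul x y n : blockseq (fmul x y) n = blockseq x n *m blockseq y n.
Proof. by rewrite /blockseq mul_mxblock; apply: eq_mxblock => i j; rewrite cseq_val_sum. Qed.

Lemma blockseq_star x n : blockseq (fstar x) n = (blockseq x n)^H.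
Proof. by apply/matrixP => i j; rewrite !mxE. Qed.

Lemma blockseq_sub x y n :
  blockseq (fun i j => x i j - y i j) n = blockseq x n - blockseq y n.
Proof. by rewrite /blockseq -mxblockB. Qed.

Lemma blockseq_diag a n : blockseq (fdiag a) n = \mxdiag_(i < m) cseq_val a n.
Proof.
apply: eq_mxblock => i j; rewrite /fdiag.
by case: (i == j); rewrite ?conform_mx_id.
Qed.

Definition orbit_diff x1 a x2 b : 'I_m -> 'I_m -> cseq R := fun i j =>
  fmul (fmul (fstar x1) (fdiag a)) x1 i j - fmul (fmul (fstar x2) (fdiag b)) x2 i j.

Lemma blockseq_orbit_diff x1 a x2 b n : blockseq (orbit_diff x1 a x2 b) n =
  (blockseq x1 n)^H *m (\mxdiag_(i < m) cseq_val a n) *m blockseq x1 n -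
  (blockseq x2 n)^H *m (\mxdiag_(i < m) cseq_val b n) *m blockseq x2 n.
Proof. by rewrite blockseq_sub !blockseq_mul !blockseq_star !blockseq_diag. Qed.

Lemma mxpi_orbit_diff x1 a x2 b : mxpi (orbit_diff x1 a x2 b) =
  mxcar_star (mxpi x1) *m amplification m (\pi_car a) *m mxpi x1 -
  mxcar_star (mxpi x2) *m amplification m (\pi_car b) *m mxpi x2.
Proof. by rewrite -mxpi_sub -!mxpi_mul -!mxpi_star -!mxpi_diag. Qed.

Lemma mxcar_norm0 : mxcar_norm (0 : 'M[car]_m) = 0.
Proof.
have := mxcar_normZ 0 (0 : 'M[car]_m); rewrite normc0 mul0r => h; rewrite -[RHS]h.
congr mxcar_norm.
by apply/matrixP => i j; rewrite !mxE scale0r.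
Qed.

Lemma mxdiag1 n : \mxdiag_(i < m) (1%:M : 'M[R[i]]_n) = 1%:M.
Proof. exact: mxdiagZ. Qed.

(** A unitary over the limit algebra is represented by matrices that are isometric only
    asymptotically. *)
Lemma unitary_isometry_cvg x : unitary (@mxcar_star R m) (mxpi x) ->
  opnorm ((blockseq x n)^H *m blockseq x n - 1%:M) @[n --> \oo] --> (0 : R).
Proof.
move=> [ux _]; pose y i j := fmul (fstar x) x i j - fdiag 1 i j.
have y0 : mxpi y = 0.
  rewrite -mxpi_sub -mxpi_mul -mxpi_star mxpi_diag; apply/eqP; rewrite subr_eq0; apply/eqP.
  exact: ux.
have := @mxcar_norm_cvg _ _ y; rewrite -/(mxpi y) y0 mxcar_norm0.
apply: cvg_trans; apply: near_eq_cvg; apply: nearW => n.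
by rewrite blockseq_sub blockseq_mul blockseq_star blockseq_diag -mxdiag1.
Qed.

(** The connecting map of the [M_m(M_(2^n))]: it amplifies every block, which differs from
    amplifying the whole matrix by a permutation of the basis. *)
Definition bamp k n (W : 'M[R[i]]_(\sum_(i < m) Defs.dim n)) :
    'M[R[i]]_(\sum_(i < m) Defs.dim (k + n)) :=
  \mxblock_(i < m, j < m) amp k (submxblock W i j).

Lemma bampM k n W V : @bamp k n (W *m V) = bamp k W *m bamp k V.
Proof.
rewrite /bamp mul_mxblock; apply: eq_mxblock => i j.
rewrite -[in LHS](submxblockK W) -[in LHS](submxblockK V) mul_mxblock mxblockK amp_sum.
by apply: eq_bigr => l _; rewrite ampM.
Qed.

Lemma bampB k n W V : @bamp k n (W - V) = bamp k W - bamp k V.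
Proof.
rewrite /bamp -mxblockB; apply: eq_mxblock => i j.
by rewrite submxblockB ampB.
Qed.

Lemma bamp_ctr k n W : @bamp k n W^H = (bamp k W)^H.
Proof.
apply/matrixP => i j; rewrite !mxE; set a := tagnat.sig1 i; set b := tagnat.sig1 j.
rewrite (_ : submxblock W^H a b = (submxblock W b a)^H); last by apply/matrixP => ? ?; rewrite !mxE.
by rewrite amp_ctrmx !mxE.
Qed.

Lemma bamp_mxdiag k n (x : 'M[R[i]]_(Defs.dim n)) :
  bamp k (\mxdiag_(i < m) x) = \mxdiag_(i < m) amp k x.
Proof.
apply: eq_mxblock => i j; rewrite /mxdiag mxblockK.
by case: (i == j); rewrite ?conform_mx_id ?amp0.
Qed.

Lemma opnorm_bamp k n W : opnorm (@bamp k n W) = opnorm W.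
Proof. by rewrite opnorm_mxblock_amp submxblockK. Qed.

Definition lift_mx n (W : 'M[R[i]]_(\sum_(i < m) Defs.dim n)) : 'I_m -> 'I_m -> cseq R :=
  fun i j => lift_cseq (submxblock W i j).

Lemma blockseq_lift n W k : blockseq (@lift_mx n W) (k + n) = bamp k W.
Proof. by apply: eq_mxblock => i j; rewrite -lift_cseqE. Qed.

Lemma mxpi_mul_eq1 x y N : (forall n, (N <= n)%N -> blockseq x n *m blockseq y n = 1%:M) ->
  mxpi x *m mxpi y = 1%:M.
Proof.
move=> xy1; pose z i j := fmul x y i j - fdiag 1 i j.
have zE : mxpi z = mxpi x *m mxpi y - 1%:M.
  by rewrite -mxpi_sub mxpi_mul mxpi_diag.
apply/eqP; rewrite -subr_eq0 -zE; apply/eqP/mxcar_norm_eq0.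
rewrite [mxcar_norm _]mxcar_norm_pi; apply: cvg_lim => //.
apply: cvg_near_cst; exists N => // n /= /xy1 h.
rewrite blockseq_sub blockseq_mul h blockseq_diag mxdiag1 subrr opnorm0.
by [].
Qed.

Lemma bamp1 k n : bamp k (1%:M : 'M_(\sum_(i < m) Defs.dim n)) = 1%:M.
Proof. by rewrite -mxdiag1 bamp_mxdiag amp_scalar mxdiag1. Qed.

Lemma lift_unitary n (W : 'M[R[i]]_(\sum_(i < m) Defs.dim n)) :
  isometry W -> coisometry W -> unitary (@mxcar_star R m) (mxpi (lift_mx W)).
Proof.
move=> W1 W2.
split; rewrite mxpi_star; apply: (@mxpi_mul_eq1 _ _ n) => k /subnK <-;
  rewrite blockseq_star blockseq_lift -bamp_ctr -bampM.
- by rewrite (W1 : W^H *m W = 1%:M) bamp1.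
- by rewrite (W2 : W *m W^H = 1%:M) bamp1.
Qed.

Let orbit_diffs (X Y : 'M[car]_m) : set R :=
  [set mxcar_norm (x' - y') | x' in unitary_orbit (@mxcar_star R m) X
                            & y' in unitary_orbit (@mxcar_star R m) Y].

Lemma mem_orbit_diffs a b x1 x2 :
  unitary (@mxcar_star R m) (mxpi x1) -> unitary (@mxcar_star R m) (mxpi x2) ->
  orbit_diffs (amplification m (\pi_car a)) (amplification m (\pi_car b))
    (mxcar_norm (mxpi (orbit_diff x1 a x2 b))).
Proof.
move=> u1 u2; rewrite mxpi_orbit_diff !mulmxE.
exists (mxcar_star (mxpi x1) * amplification m (\pi_car a) * mxpi x1).
  by exists (mxpi x1); [exact: u1|].
exists (mxcar_star (mxpi x2) * amplification m (\pi_car b) * mxpi x2).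
  by exists (mxpi x2); [exact: u2|].
by [].
Qed.

Lemma orbit_diffs_has_inf a b :
  has_inf (orbit_diffs (amplification m (\pi_car a)) (amplification m (\pi_car b))).
Proof.
have u1 : unitary (@mxcar_star R m) (mxpi (lift_mx (1%:M : 'M_(\sum_(i < m) Defs.dim 0)))).
  by apply: lift_unitary; rewrite /isometry /coisometry ctrmx1 mul1mx.
split; first by eexists; exact: (mem_orbit_diffs a b u1 u1).
by exists 0 => _ [x' _ [y' _ <-]]; exact: mxcar_norm_ge0.
Qed.

(** A unitary found at one finite level [n] lifts to the limit by [lift_unitary]. Beyond [n], [a]
    and [b] differ from the amplifications of their [n]-th terms by Cauchy errors, [e / 2] each. *)
Lemma orbit_dist_le (a b : cseq R) c :
  (forall N, exists2 n, (N <= n)%N &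
    unear c (\mxdiag_(i < m) cseq_val a n) (\mxdiag_(i < m) cseq_val b n)) ->
  mxcar_orbit_dist (amplification m (\pi_car a)) (amplification m (\pi_car b)) <= c.
Proof.
move=> ab; apply/ler_addgt0Pr => e e0.
have e20 : 0 < e / 2 by rewrite divr_gt0.
have /asboolP/(_ _ e20)[Na _ aP] := valP a.
have /asboolP/(_ _ e20)[Nb _ bP] := valP b.
have [n nN [W [W1 W2 abW]]] := ab (maxn Na Nb).
have {}aP := aP n (leq_trans (leq_maxl _ _) nN).
have {}bP := bP n (leq_trans (leq_maxr _ _) nN).
have uW := lift_unitary W1 W2.
have u1 : unitary (@mxcar_star R m) (mxpi (lift_mx (1%:M : 'M_(\sum_(i < m) Defs.dim n)))).
  by apply: lift_unitary; rewrite /isometry /coisometry ctrmx1 mul1mx.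
apply: (@le_trans _ _ (mxcar_norm (mxpi (orbit_diff (lift_mx 1%:M) a (lift_mx W) b)))).
  apply: ge_inf; [exact: (orbit_diffs_has_inf a b).2|exact: (mem_orbit_diffs a b u1 uW)].
rewrite mxcar_norm_pi; apply: limr_le; first exact: blockseq_cvg.
exists n => // j /= /subnK <-; set k := (j - n)%N.
rewrite blockseq_orbit_diff !blockseq_lift bamp1 ctrmx1 mul1mx mulmx1.
set A := \mxdiag_(i < m) cseq_val a (k + n); set B := \mxdiag_(i < m) cseq_val b (k + n).
set A0 := bamp k (\mxdiag_(i < m) cseq_val a n).
set B0 := bamp k (\mxdiag_(i < m) cseq_val b n).
have V1 : isometry (bamp k W) by rewrite /isometry -bamp_ctr -bampM W1 bamp1.
have -> : A - (bamp k W)^H *m B *m bamp k W = (A - A0) +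
    ((A0 - (bamp k W)^H *m B0 *m bamp k W) + (bamp k W)^H *m (B0 - B) *m bamp k W).
  by rewrite mulmxBr mulmxBl !addrA !subrK.
have -> : c + e = e / 2 + (c + e / 2) by lra.
rewrite (le_trans (opnormD _ _))// lerD//.
  by rewrite /A0 bamp_mxdiag -mxdiagB; exact: le_trans (opnorm_mxdiag_le _ _) (aP k).
rewrite (le_trans (opnormD _ _))// lerD//.
  by rewrite -bamp_ctr -!bampM -bampB opnorm_bamp.
rewrite (le_trans (opnorm_conj_le _ V1))// opnormB /B0 bamp_mxdiag -mxdiagB.
exact: le_trans (opnorm_mxdiag_le _ _) (bP k).
Qed.

Lemma conj_near n (U W A : 'M[R[i]]_n) t M : opnorm U <= 1 -> opnorm W <= 2 ->
  opnorm (W - U) <= t -> opnorm A <= M ->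
  opnorm (U^H *m A *m U - W^H *m A *m W) <= 3 * (M * t).
Proof.
move=> U1 W2 WU AM.
have -> : U^H *m A *m U - W^H *m A *m W =
    U^H *m (A *m (U - W)) + (U - W)^H *m A *m W.
  by rewrite !mulmxBr ctrmxB !mulmxBl !mulmxA addrA subrK.
have t0 := le_trans (opnorm_ge0 _) WU; have M0 := le_trans (opnorm_ge0 _) AM.
have -> : 3 * (M * t) = 1 * (M * t) + t * M * 2 by ring.
rewrite (le_trans (opnormD _ _))// lerD// (le_trans (opnormM _ _))//.
  rewrite ler_pM ?opnorm_ge0 ?opnorm_ctrmx// (le_trans (opnormM _ _))//.
  by rewrite ler_pM ?opnorm_ge0// opnormB.
rewrite ler_pM ?opnorm_ge0// (le_trans (opnormM _ _))//.
by rewrite ler_pM ?opnorm_ge0// opnorm_ctrmx opnormB.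
Qed.

Lemma blockseq_bounded x : exists2 M, 0 <= M & \forall n \near \oo, opnorm (blockseq x n) <= M.
Proof.
exists (limn (fun n => opnorm (blockseq x n)) + 1).
  by rewrite addr_ge0//; have := mxcar_norm_ge0 (mxpi x); rewrite mxcar_norm_pi.
have /cvgrPdist_lt/(_ _ ltr01) := @blockseq_cvg R m x; apply: filterS => n.
by rewrite ltr_distlC => /andP[_ /ltW].
Qed.

(** Almost optimal unitaries over the limit are represented by approximate isometries;
    [unitary_near] replaces these by true unitaries at each large level. *)
Lemma orbit_dist_lt (a b : cseq R) c :
  mxcar_orbit_dist (amplification m (\pi_car a)) (amplification m (\pi_car b)) < c ->
  \forall n \near \oo,
    unear c (\mxdiag_(i < m) cseq_val a n) (\mxdiag_(i < m) cseq_val b n).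
Proof.
rewrite -subr_gt0 => d0; have := inf_adherent d0 (orbit_diffs_has_inf a b).
rewrite addrC subrK => -[_ [_ [u1 U1 <-] [_ [u2 U2 <-] <-]]].
have [x1 u1E] := matrix_piP u1; have [x2 u2E] := matrix_piP u2.
rewrite -/(mxpi x1) in u1E; rewrite -/(mxpi x2) in u2E; subst u1 u2.
rewrite -!mulmxE -mxpi_orbit_diff; set r := mxcar_norm _ => rc.
have [Ma Ma0 aM] := blockseq_bounded (fdiag a).
have [Mb Mb0 bM] := blockseq_bounded (fdiag b).
(* Half of the slack [c - r] pays for replacing the matrices by unitaries, half for the convergence
   of the norms. The bound 1/2 is the one of [unitary_near]. *)
pose t := Num.min (1 / 2) ((c - r) / (2 * (3 * (Ma + Mb) + 1))).
have q0 : 0 < 2 * (3 * (Ma + Mb) + 1) by lra.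
have t0 : 0 < t by rewrite lt_min; apply/andP; split; [lra|rewrite divr_gt0 ?subr_gt0].
have t2 : t <= 1 / 2 by rewrite ge_min lexx.
have tM : 3 * (Ma * t) + 3 * (Mb * t) <= (c - r) / 2.
  have : t <= (c - r) / (2 * (3 * (Ma + Mb) + 1)) by rewrite ge_min lexx orbT.
  rewrite ler_pdivlMr//; lra.
have cr0 : 0 < (c - r) / 2 by lra.
near=> n.
have near_iso x : (opnorm ((blockseq x n)^H *m blockseq x n - 1%:M) <= t) ->
    exists U, [/\ isometry U, coisometry U, opnorm (blockseq x n - U) <= t &
      opnorm (blockseq x n) <= 2].
  move=> xt; have [U [V1 V2 xU]] := unitary_near (le_trans xt t2).
  have xU' := le_trans xU xt; exists U; split => //.
  rewrite -(subrK U (blockseq x n)) (le_trans (opnormD _ _))//.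
  have t1 : t <= 1 by apply: (le_trans t2); lra.
  by rewrite (_ : 2 = 1 + 1)//; exact: (lerD (le_trans xU' t1) (opnorm_unitary V1)).
have [|V1 [V1i V1c xV1 x1_2]] := near_iso x1.
  by near: n; have /cvgr0_norm_le := unitary_isometry_cvg U1; 
     move=> /(_ _ t0); apply: filterS => n; rewrite ger0_norm ?opnorm_ge0.
have [|V2 [V2i V2c xV2 x2_2]] := near_iso x2.
  by near: n; have /cvgr0_norm_le := unitary_isometry_cvg U2; 
     move=> /(_ _ t0); apply: filterS => n; rewrite ger0_norm ?opnorm_ge0.
set A := \mxdiag_(i < m) cseq_val a n; set B := \mxdiag_(i < m) cseq_val b n.
have AM : opnorm A <= Ma by rewrite /A -blockseq_diag; near: n.
have BM : opnorm B <= Mb by rewrite /B -blockseq_diag; near: n.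
have dr : opnorm ((blockseq x1 n)^H *m A *m blockseq x1 n -
    (blockseq x2 n)^H *m B *m blockseq x2 n) <= r + (c - r) / 2.
  rewrite -blockseq_orbit_diff; near: n.
  have /cvgrPdist_le/(_ _ cr0) := @mxcar_norm_cvg _ _ (orbit_diff x1 a x2 b).
  by apply: filterS => n; rewrite ler_distlC => /andP[].
(* The norm is invariant under conjugation, so [V1] is moved to the other side and a single unitary
   remains. *)
exists (V2 *m V1^H); split.
- by rewrite /isometry ctrmxM ctrmxK mulmxA -(mulmxA _ V2^H) V2i mulmx1.
- by rewrite /coisometry ctrmxM ctrmxK mulmxA -(mulmxA _ V1^H) V1i mulmx1.
have -> : A - (V2 *m V1^H)^H *m B *m (V2 *m V1^H) =
    V1^H^H *m (V1^H *m A *m V1 - V2^H *m B *m V2) *m V1^H.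
  rewrite ctrmxM !ctrmxK mulmxBr mulmxBl !mulmxA V1c mul1mx -(mulmxA A) V1c mulmx1.
  by [].
have iV : isometry V1^H by rewrite /isometry ctrmxK.
rewrite (le_trans (opnorm_conj_le _ iV))//.
have -> : V1^H *m A *m V1 - V2^H *m B *m V2 =
    (V1^H *m A *m V1 - (blockseq x1 n)^H *m A *m blockseq x1 n) +
    (((blockseq x1 n)^H *m A *m blockseq x1 n - (blockseq x2 n)^H *m B *m blockseq x2 n) -
     (V2^H *m B *m V2 - (blockseq x2 n)^H *m B *m blockseq x2 n)).
  by rewrite opprB !addrA !subrK.
have h1 := conj_near (opnorm_unitary V1i) x1_2 xV1 AM.
have h2 := conj_near (opnorm_unitary V2i) x2_2 xV2 BM.
rewrite (le_trans (opnormD _ _))//.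
rewrite (le_trans (lerD h1 (opnormD _ _)))// opnormN.
rewrite (le_trans (lerD (lexx _) (lerD dr h2)))//.
move: tM; lra.
Unshelve. all: by end_near. Qed.

End Matrices.

Section OrbitDistance.
Variable R : realType.
Local Open Scope quotient_scope.

Lemma orbit_dist_ge0 m (a b : cseq R) :
  0 <= mxcar_orbit_dist (amplification m (\pi_(car R) a)) (amplification m (\pi_(car R) b)).
Proof.
apply: lb_le_inf; first exact: (orbit_diffs_has_inf m a b).1.
by move=> _ [x' _ [y' _ <-]]; exact: mxcar_norm_ge0.
Qed.

(** Up to a unitary, [2 ^ l] copies of the [n]-th term form its amplification to level [l + n],
    which is close to the single term there. So a unitary for [2 ^ l] copies serves one copy at a
    higher level, hence [2 ^ k] copies. As [k] and [l] are arbitrary, equality follows. *)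
Lemma orbit_dist_pow2_le (a b : cseq R) k l :
  mxcar_orbit_dist (amplification (2 ^ k) (\pi_(car R) a))
    (amplification (2 ^ k) (\pi_(car R) b)) <=
  mxcar_orbit_dist (amplification (2 ^ l) (\pi_(car R) a))
    (amplification (2 ^ l) (\pi_(car R) b)).
Proof.
set d := mxcar_orbit_dist (amplification (2 ^ l) _) _.
apply/ler_addgt0Pr => e e0; have e30 : 0 < e / 3 by rewrite divr_gt0.
have dl : d < d + e / 3 by rewrite ltrDl.
have [N0 _ ab] := orbit_dist_lt dl.
have /asboolP/(_ _ e30)[Na _ aP] := valP a.
have /asboolP/(_ _ e30)[Nb _ bP] := valP b.
apply: orbit_dist_le => N; set n := maxn N (maxn N0 (maxn Na Nb)).
have [nN nN0 na nb] : [/\ N <= n, N0 <= n, Na <= n & Nb <= n]%N.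
  by rewrite /n !leq_max !leqnn !orbT.
exists (l + n)%N; first exact: leq_trans (leq_addl _ _).
have {}ab : unear (d + e / 3) (amp l (cseq_val a n)) (amp l (cseq_val b n)).
  apply: unear_trans0 (unear_amp _ _) _; apply: unear_trans0 (unear_sym (unear_mxdiag _ _)) _.
  apply: unear_trans0r (ab n nN0) _; apply: unear_trans0 (unear_mxdiag _ _) _.
  exact/unear_sym/unear_amp.
apply: unear_trans0 (unear_mxdiag _ _) _; apply: unear_sym.
apply: unear_trans0 (unear_mxdiag _ _) _; apply: unear_sym; apply: unear_kfold.
have -> : d + e = e / 3 + ((d + e / 3) + e / 3) by field.
apply: unear_trans (unear_opnorm (aP n na l)) _.
apply: unear_trans ab (unear_sym (unear_opnorm (bP n nb l))).
Qed.

End OrbitDistance.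

Theorem corollary4p11 (R : realType) :
  exists (a b : car R) (delta : R),
    [/\ 0 < delta,
        forall k : nat, (0 < k)%N ->
          mxcar_orbit_dist (amplification (2 ^ k) a) (amplification (2 ^ k) b)
            = delta
      & forall k : nat, (0 < k)%N ->
          mxcar_orbit_dist (amplification (3 * k) a) (amplification (3 * k) b)
            = 0].
Proof.
have [x [x_level xS]] := level_seq R false; have [y [y_level yS]] := level_seq R true.
pose a := CSeq (level_seq_cauchy xS); pose b := CSeq (level_seq_cauchy yS).
have [d d0 far] := level_far R.
exists (\pi_(car R) a)%qT, (\pi_(car R) b)%qT.
(* The common value is read off at one copy, where [level_far] applies directly. *)
exists (mxcar_orbit_dist (amplification (2 ^ 0) (\pi_(car R) a)%qT)
  (amplification (2 ^ 0) (\pi_(car R) b)%qT)); split=> [|k _|k _].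
- rewrite (lt_le_trans d0)// leNgt; apply/negP => /orbit_dist_lt[N _ /(_ N (leqnn N)) ab].
  apply: (far N); apply: unear_trans0 (unear_sym (x_level N)) _.
  apply: unear_trans0r (y_level N).
  apply: unear_trans0 (unear_amp 0 (x N)) _.
  apply: unear_trans0 (unear_sym (unear_mxdiag _ _)) _.
  apply: unear_trans0r ab _; apply: unear_trans0 (unear_mxdiag _ _) _.
  exact: (unear_sym (unear_amp 0 (y N))).
- by apply/eqP; rewrite eq_le !orbit_dist_pow2_le.
- apply/eqP; rewrite eq_le orbit_dist_ge0 andbT; apply/ler_addgt0Pr => e e0; rewrite add0r.
  have [N0 _ eP] := @near_div_pow2 R 108 e (ler0n _ _) e0.
  apply: orbit_dist_le => N; exists (maxn N N0); first exact: leq_maxl.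
  set n := maxn N N0; have {}eP := eP n (leq_maxr _ _).
  (* The [3 * k] copies are grouped in threes, since [unear_level_triples] compares one triple of
     each kind. *)
  have triple z (s : matseq R) : unear 0 (s n) (level R n z) ->
      unear 0 (\mxdiag_(i < 3 * k) s n)
        (kfold k (block_mx (level R n z) 0 0 (block_mx (level R n z) 0 0 (level R n z)))).
    move=> sz; apply: unear_trans0 (unear_mxdiag _ _) _.
    apply: unear_trans0 (unear_kfold3 _ _) _; apply: unear_kfold.
    by do 2![apply: unear_dsum => //].
  apply: unear_trans0 (triple _ _ (x_level n)) _; apply: unear_sym.
  apply: unear_trans0 (triple _ _ (y_level n)) _; apply: unear_sym.
  by apply: unear_kfold; exact: unear_le (unear_level_triples _ _).
Qed.
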